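(* Let $\beta>0$ and let $b$ be a standard Brownian motion. For $\lambda\in\mathbb{R}$ let $N(\lambda)$ be the number of blowups to $-\infty$ on $(0,\infty)$ of the solution $p_\lambda$ of the Riccati equation $$p'(x)=x-\lambda-p^2(x)+\tfrac{2}{\sqrt\beta}\,b'_x,\qquad p(0)=+\infty,$$ restarted at $+\infty$ immediately after each blowup to $-\infty$. Then, almost surely, for (Lebesgue-)almost all $\lambda$, $N(\lambda)$ equals the number of eigenvalues of the stochastic Airy operator $\mathcal{H}_\beta$ that are at most $\lambda$. In other words, the c\`adl\`ag version of $N(\lambda)$ is the eigenvalue counting function of $\mathcal{H}_\beta$.
   Context: The Riccati equation is understood in integrated sense: on any interval $[s,x]$ without blowup, $p(x)-p(s)=\int_s^x(y-\lambda-p^2(y))\,dy+\frac{2}{\sqrt\beta}(b_x-b_s)$; the solution starts from $+\infty$ at $x=0$ and, whenever it reaches $-\infty$, is restarted at $+\infty$ at the same point. Equivalently $p_\lambda=\psi'/\psi$, where $\psi\not\equiv0$ with $\psi(0)=0$ solves $\psi''=\frac{2}{\sqrt\beta}\psi b'+(x-\lambda)\psi$ in the integration-by-parts sense below, and blowups are zeros of $\psi$ in $(0,\infty)$. Stochastic Airy operator: $\mathcal{H}_\beta=-\frac{d^2}{dx^2}+x+\frac{2}{\sqrt\beta}b'_x$ on $[0,\infty)$, $b_0=0$. $L^*$ is the space of (locally absolutely continuous) $f:[0,\infty)\to\mathbb{R}$ with $f(0)=0$ and $\int_0^\infty (f')^2+(1+x)f^2\,dx<\infty$. A pair $(\psi,\lambda)\in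 L^*\times\mathbb{R}$ is an eigenfunction/eigenvalue pair of $\mathcal{H}_\beta$ if $\|\psi\|_2=1$ and for all $x\ge0$ $$\psi'(x)-\psi'(0)=\tfrac{2}{\sqrt\beta}\psi(x)b_x-\int_0^x\tfrac{2}{\sqrt\beta}b_y\psi'(y)\,dy+\int_0^x(y-\lambda)\psi(y)\,dy .$$ *)

(* Defs.v *)
From HB Require Import structures.
From mathcomp Require Import all_boot all_order all_algebra.
From mathcomp Require Import all_classical all_reals all_analysis.

Set Implicit Arguments.
Unset Strict Implicit.
Unset Printing Implicit Defensive.

Import Order.TTheory GRing.Theory Num.Theory.
Import numFieldNormedType.Exports.

Local Open Scope classical_set_scope.
Local Open Scope ring_scope.

(* Functions on [0, +oo[ are represented by functions on R whose values at
   negative arguments are never used. *)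

Section brownian_motion.
Context {R : realType} {d : measure_display} {T : measurableType d}.
Variable P : probability T R.

(* Taking some of the A i to be setT gives the product rule for every
   subfamily. *)
Definition mutually_independent (n : nat) (X : nat -> T -> R) : Prop :=
  forall A : nat -> set R, (forall i, measurable (A i)) ->
    P (\bigcap_(i in `I_n) (X i @^-1` A i)) =
    (\prod_(i < n) P (X i @^-1` A i))%E.

Definition standard_brownian_motion (b : R -> T -> R) : Prop :=
  [/\ forall t, 0 <= t -> measurable_fun [set: T] (b t),
      {ae P, forall w, b 0 w = 0},
      {ae P, forall w, {within `[0, +oo[, continuous (b ^~ w)}},
      forall (n : nat) (t : nat -> R), 0 <= t 0%N ->
        {homo t : i j / (i <= j)%N >-> i <= j} ->
        mutually_independent n (fun i w => b (t i.+1) w - b (t i) w)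
    & forall s t, 0 <= s -> s < t -> forall A : set R, measurable A ->
        P ((fun w => b t w - b s w) @^-1` A) =
        normal_prob 0 (Num.sqrt (t - s)) A].

End brownian_motion.

Section riccati.
Context {R : realType}.
Implicit Types (beta lambda : R) (b p : R -> R).

Definition blowups p : set R :=
  [set z | 0 < z /\ p x @[x --> z^'-] --> -oo].

(* The Riccati equation in integrated form, driven by the path b. The value of
   p at a blowup point is irrelevant. Blowups are required not to accumulate:
   beyond an accumulation point the other clauses would not determine p. *)
Definition riccati_solution beta b lambda p : Prop :=
  [/\ p x @[x --> 0^'+] --> +oo,
      forall s x, 0 < s -> s <= x -> `[s, x] `&` blowups p = set0 ->
        lebesgue_measure.-integrable `[s, x]
          (fun y => (y - lambda - p y ^+ 2)%:E) /\
        p x - p s =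
          \int[lebesgue_measure]_(y in `[s, x]) (y - lambda - p y ^+ 2) +
          2 / Num.sqrt beta * (b x - b s),
      forall z, blowups p z -> p x @[x --> z^'+] --> +oo
    & forall x, finite_set (blowups p `&` `[0, x])].

(* N(lambda) = n: the solution exists, and it has n blowups. *)
Definition number_of_blowups beta b lambda (n : \bar R) : Prop :=
  (exists p, riccati_solution beta b lambda p) /\
  forall p, riccati_solution beta b lambda p -> counting (blowups p) = n.

End riccati.

Section stochastic_airy.
Context {R : realType}.
Implicit Types (beta lambda : R) (b f g psi : R -> R).

Definition locally_absolutely_continuous f : Prop :=
  forall M e : R, 0 < e -> exists2 delta : R, 0 < delta &
    forall (n : nat) (u v : nat -> R),
      (forall i, (i < n)%N -> 0 <= u i /\ u i <= v i /\ v i <= M) ->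
      trivIset `I_n (fun i => `]u i, v i[%classic) ->
      \sum_(i < n) (v i - u i) < delta ->
      \sum_(i < n) `|f (v i) - f (u i)| < e.

(* derive1 f is the derivative only almost everywhere, which is all that the
   integral sees. *)
Definition Lstar f : Prop :=
  [/\ locally_absolutely_continuous f,
      f 0 = 0
    & (\int[lebesgue_measure]_(x in `[0%R, +oo[)
         (derive1 f x ^+ 2 + (1 + x) * f x ^+ 2)%:E < +oo)%E].

(* g is the derivative of f on [0, +oo[, one-sided at 0. *)
Definition half_line_derivative f g : Prop :=
  (forall x : R, 0 < x -> is_derive x 1 f (g x)) /\
  (h^-1 * (f h - f 0)) @[h --> 0^'+] --> g 0.

Definition eigenpair beta b psi lambda : Prop :=
  [/\ Lstar psi,
      (\int[lebesgue_measure]_(x in `[0%R, +oo[) (psi x ^+ 2)%:E = 1)%E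
    & exists2 dpsi : R -> R, half_line_derivative psi dpsi &
      forall x, 0 <= x ->
        dpsi x - dpsi 0 =
          2 / Num.sqrt beta * psi x * b x
          - \int[lebesgue_measure]_(y in `[0, x])
              (2 / Num.sqrt beta * b y * dpsi y)
          + \int[lebesgue_measure]_(y in `[0, x]) ((y - lambda) * psi y)].

Definition airy_eigenvalue beta b lambda : Prop :=
  exists psi, eigenpair beta b psi lambda.

Definition eigenvalue_count beta b lambda : \bar R :=
  counting [set mu | airy_eigenvalue beta b mu /\ mu <= lambda].

End stochastic_airy.

(* Cadlag as a real-valued function: the values and the left limits are
   finite. *)
Definition cadlag {R : realType} (F : R -> \bar R) : Prop :=
  forall x, [/\ F x \is a fin_num,
                F y @[y --> x^'+] --> F x
              & exists l : R, F y @[y --> x^'-] --> l%:E].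

(* Main.v *)
(* Write (2 / sqrt beta) b = W + S on [0, oo[, where S(x) is the integral of
   (2 / sqrt beta) b over [x, x + 1], so that S is differentiable. With
   Q = x + S' - W^2, the equation becomes the classical system
   psi' = W psi + phi, phi' = (Q - lambda) psi - W phi. Kolmogorov chaining at
   dyadic points, a Gaussian tail bound and Borel-Cantelli show that almost
   surely the squared increments of the noise over unit intervals are at most
   x / 8 + O(1), whence Q >= x / 2 - O(1) and W^2 <= x + O(1); the rest is
   deterministic.

   The Pruefer angle th of (psi, phi), with psi = rho sin th and
   phi = rho cos th, increases through each multiple of pi, so the zeros of psi
   are the times at which it reaches k pi, k > 0; Riccati solutions are unique
   and given by cot th + W, so these are also the blowups. Call lambda decaying
   if psi phi < 0 eventually. Since Q is eventually large, psi then decays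
   in the energy norm, and conversely an eigenfunction, which is proportional
   to psi, must decay: eigenvalues are the decaying lambda.

   Let n(lambda) be the number of zeros of psi; it is nondecreasing in lambda.
   If lambda is decaying and mu > lambda, a Wronskian argument gives
   n(mu) > n(lambda). The infimum of { mu : n(mu) > k } is decaying with exactly
   k zeros. So n maps the decaying mu < lambda bijectively onto
   {0, ..., n(lambda) - 1}, and n agrees with the eigenvalue count off the
   countable set of eigenvalues. *)

Require Import Defs.
From HB Require Import structures.
From mathcomp Require Import all_boot all_order all_algebra.
From mathcomp Require Import all_classical all_reals all_analysis.
From mathcomp Require Import measurable_realfun.
From mathcomp Require Import ring lra.

Set Implicit Arguments.
Unset Strict Implicit.
Unset Printing Implicit Defensive.

Import Order.TTheory GRing.Theory Num.Theory.
Import numFieldNormedType.Exports.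

Local Open Scope classical_set_scope.
Local Open Scope ring_scope.

(** * Differential inequalities *)

(** Smoothing by unit averages turns every estimate on the path into one on increments of the noise
    over unit intervals: [S'] is such an increment and [W] is minus a mean of them. Unlike the noise
    itself these grow more slowly than [sqrt x], and that is essential: their squares must stay a
    small fraction of [x], whatever [beta], for [Q] to keep growing. The exceptional event concerns
    the growth of the path alone, so one event serves all [lambda].

    A Riccati solution satisfies its equation only between blowups. To compare it with the Pruefer
    angle across them, the proof follows the squared sine of the difference of two angles: it is
    bounded, continuous through blowups, and obeys a linear differential inequality between them.

    At an eigenvalue the two counts differ by one: the number of zeros counts the eigenvalues
    strictly below [lambda], hence is the left limit of the counting function. This is why equality
    is claimed for almost all [lambda] only. *)

Section derivation_rules.
Context {R : realType}.
Implicit Types (f g : R -> R) (x a b k : R).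

Lemma isder_eq x f a b : is_derive x 1 f a -> a = b -> is_derive x 1 f b.
Proof. by move=> ? <-. Qed.

Lemma isder_cst x k : is_derive x 1 (fun=> k) 0.
Proof. exact: is_derive_cst. Qed.

Lemma isder_id x : is_derive x 1 (fun y : R => y) 1.
Proof. exact: is_derive_id. Qed.

Lemma isder_add x f g a b : is_derive x 1 f a -> is_derive x 1 g b ->
  is_derive x 1 (fun y => f y + g y) (a + b).
Proof. by move=> ? ?; exact: is_deriveD. Qed.

Lemma isder_opp x f a : is_derive x 1 f a -> is_derive x 1 (fun y => - f y) (- a).
Proof. by move=> ?; exact: is_deriveN. Qed.

Lemma isder_mul x f g a b : is_derive x 1 f a -> is_derive x 1 g b ->
  is_derive x 1 (fun y => f y * g y) (a * g x + f x * b).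
Proof.
move=> df dg; apply: (isder_eq (is_deriveM df dg)).
by rewrite /GRing.scale /=; ring.
Qed.

Lemma isder_sqr x f a : is_derive x 1 f a ->
  is_derive x 1 (fun y => f y ^+ 2) (2 * f x * a).
Proof.
move=> df; have -> : (fun y => f y ^+ 2) = (fun y => f y * f y).
  by apply/funext => y; rewrite expr2.
by apply: (isder_eq (isder_mul df df)); ring.
Qed.

Lemma isder_inv x f a : f x != 0 -> is_derive x 1 f a ->
  is_derive x 1 (fun y => (f y)^-1) (- a / f x ^+ 2).
Proof.
move=> fx0 df; apply: (isder_eq (is_deriveV fx0 df)).
by rewrite /GRing.scale /=; field.
Qed.

Lemma isder_comp x f g a b : is_derive (f x) 1 g b -> is_derive x 1 f a ->
  is_derive x 1 (fun y => g (f y)) (b * a).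
Proof. by move=> ? ?; exact: is_derive1_comp. Qed.

Lemma isder_sin x f a : is_derive x 1 f a ->
  is_derive x 1 (fun y => sin (f y)) (cos (f x) * a).
Proof. by move=> df; exact: isder_comp. Qed.

Lemma isder_cos x f a : is_derive x 1 f a ->
  is_derive x 1 (fun y => cos (f y)) (- sin (f x) * a).
Proof. by move=> df; exact: isder_comp. Qed.

Lemma isder_exp x f a : is_derive x 1 f a ->
  is_derive x 1 (fun y => expR (f y)) (expR (f x) * a).
Proof. by move=> df; exact: isder_comp. Qed.

Lemma isder_continuous x f a : is_derive x 1 f a -> {for x, continuous f}.
Proof.
by move=> df; apply: differentiable_continuous; apply/derivable1_diffP.
Qed.

Lemma continuous_sqr x f : {for x, continuous f} ->
  {for x, continuous (fun y => f y ^+ 2)}.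
Proof.
move=> cf; have -> : (fun y => f y ^+ 2) = (fun y => f y * f y).
  by apply/funext => y; rewrite expr2.
exact: (cvgM cf cf).
Qed.

Lemma isder_near x f g a : (\forall y \near x, f y = g y) ->
  is_derive x 1 f a -> is_derive x 1 g a.
Proof. by move=> fg df; apply: near_eq_is_derive fg df; rewrite oner_eq0. Qed.

End derivation_rules.

Ltac der := repeat first
  [ eassumption
  | apply: isder_add | apply: isder_opp | apply: isder_sqr | apply: isder_mul
  | apply: isder_sin | apply: isder_cos | apply: isder_exp
  | apply: isder_cst | apply: isder_id ].

Section calculus.
Context {R : realType}.
Implicit Types (f g h dh : R -> R) (x a b k : R).

Lemma nondecreasing_derive h dh a b : a <= b -> {within `[a, b], continuous h} ->
  (forall y : R, a < y < b -> is_derive y 1 h (dh y)) ->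
  (forall y : R, a < y < b -> 0 <= dh y) -> h a <= h b.
Proof.
move=> ab ch dhE dh0.
have [->//|ab'] := eqVneq a b; have a_b : a < b by rewrite lt_neqAle ab' ab.
have dhE' x : x \in `]a, b[%R -> is_derive x 1 h (dh x).
  by rewrite in_itv /=; exact: dhE.
have [c] := MVT a_b dhE' ch.
rewrite in_itv /= => /dh0 c0 hE.
by rewrite -subr_ge0 hE mulr_ge0// subr_ge0.
Qed.

Lemma within_der_continuous h dh a b :
  (forall y : R, a <= y <= b -> is_derive y 1 h (dh y)) ->
  {within `[a, b], continuous h}.
Proof.
move=> dhE; apply: continuous_in_subspaceT => x.
by rewrite inE /= in_itv /= => /dhE /isder_continuous.
Qed.

Lemma nondecreasing_der h dh a b : a <= b ->
  (forall y : R, a <= y <= b -> is_derive y 1 h (dh y)) ->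
  (forall y : R, a <= y <= b -> 0 <= dh y) -> h a <= h b.
Proof.
move=> ab dhE dh0; apply: (@nondecreasing_derive h dh) => //.
- exact: within_der_continuous dhE.
- by move=> y /andP[ay yb]; apply: dhE; rewrite !ltW.
- by move=> y /andP[ay yb]; apply: dh0; rewrite !ltW.
Qed.

Lemma isder_gt0 g x d : is_derive x 1 g d -> 0 < d ->
  exists2 e : R, 0 < e &
    forall k, k != 0 -> `|k| < e -> 0 < k^-1 * (g (x + k) - g x).
Proof.
move=> dg d0; have [dg1 dgE] := dg.
have /cvgr_gt /(_ 0) : (fun h : R => h^-1 *: (g (h *: 1 + x) - g x)) @ 0^' --> d.
  by rewrite -dgE; exact: dg1.
move=> /(_ d0) /nbhs_ballP[e /= e0 He]; exists e => // k k0 ke.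
have := He k; rewrite /ball /= sub0r normrN => /(_ ke k0).
by rewrite /GRing.scale /= mulr1 (addrC k).
Qed.

Lemma continuous_gt g x c : {for x, continuous g} -> c < g x ->
  exists2 e : R, 0 < e & forall y : R, `|y - x| < e -> c < g y.
Proof.
move=> /cvgr_gt /[apply] /nbhs_ballP[e /= e0 He].
by exists e => // y yx; apply: He; rewrite /ball /= distrC.
Qed.

Lemma continuous_lt g x c : {for x, continuous g} -> g x < c ->
  exists2 e : R, 0 < e & forall y : R, `|y - x| < e -> g y < c.
Proof.
move=> /cvgr_lt /[apply] /nbhs_ballP[e /= e0 He].
by exists e => // y yx; apply: He; rewrite /ball /= distrC.
Qed.

(* The sup of the set where [g <= 0] is a zero of [g] at which [g] would have
   to be nondecreasing. *)
Lemma barrier_le g dg a b : a <= b ->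
  (forall y : R, a <= y <= b -> is_derive y 1 g (dg y)) ->
  (forall y : R, a <= y <= b -> g y = 0 -> dg y < 0) ->
  g a <= 0 -> g b <= 0.
Proof.
move=> ab gE g0 ga; rewrite leNgt; apply/negP => gb.
pose A := [set y | a <= y <= b /\ g y <= 0].
have supA : has_sup A.
  by split; [exists a; rewrite /A /= lexx ab|exists b => y [/andP[]]].
set s := sup A.
have as_ : a <= s by apply: sup_upper_bound => //; rewrite /A /= lexx ab.
have sb : s <= b by apply: ge_sup => [|y [/andP[]]//]; have [] := supA.
have sab : a <= s <= b by rewrite as_ sb.
have cg : {for s, continuous g} by exact: isder_continuous (gE _ sab).
have gs0 : g s <= 0.
  rewrite leNgt; apply/negP => gs.
  have [e e0 He] := continuous_gt cg gs.
  have [y [yab gy] ys] := sup_adherent e0 supA.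
  have ys' : y <= s by apply: sup_upper_bound => //; split.
  have := He y; rewrite ler0_norm ?subr_le0// opprB ltrBlDr -ltrBlDl.
  by move=> /(_ ys); rewrite ltNge gy.
have sltb : s < b by rewrite lt_neqAle sb andbT; apply: contraTneq gb => <-; rewrite -leNgt.
have right y : s < y -> y <= b -> 0 < g y.
  move=> sy yb; rewrite ltNge; apply/negP => gy.
  suff : y <= s by rewrite leNgt sy.
  by apply: sup_upper_bound => //; rewrite /A /= yb (le_trans as_ (ltW sy)).
have gs : g s = 0.
  apply/eqP; rewrite eq_le gs0 /= leNgt; apply/negP => gsn.
  have [e e0 He] := continuous_lt cg gsn.
  pose y := Num.min b (s + e / 2).
  have sy : s < y by rewrite /y lt_min sltb ltrDl divr_gt0.
  have yb : y <= b by rewrite /y ge_min lexx.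
  have ye : y <= s + e / 2 by rewrite /y ge_min lexx orbT.
  have := He y; rewrite ger0_norm ?subr_ge0 ?(ltW sy)//.
  by move=> /(_ ltac:(lra)); rewrite ltNge (ltW (right _ sy yb)).
have dgs : 0 < - dg s by rewrite oppr_gt0 g0.
have [e e0 He] := isder_gt0 (isder_opp (gE _ sab)) dgs.
pose k := Num.min (b - s) (e / 2).
have k0 : 0 < k by rewrite /k lt_min subr_gt0 sltb divr_gt0.
have kb : s + k <= b by rewrite -lerBrDl /k ge_min lexx.
have ke : k <= e / 2 by rewrite /k ge_min lexx orbT.
have := He k (lt0r_neq0 k0); rewrite gtr0_norm// => /(_ ltac:(lra)).
rewrite pmulr_rgt0 ?invr_gt0// gs oppr0 subr0 oppr_gt0 => gk.
by have := right _ _ kb; rewrite ltrDl k0 => /(_ isT); rewrite ltNge (ltW gk).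
Qed.

(** Equality at [b] is impossible: a zero with negative derivative would make [g] positive just to
    its left, against [barrier_le]. *)
Lemma barrier_lt g dg a b : a < b ->
  (forall y : R, a <= y <= b -> is_derive y 1 g (dg y)) ->
  (forall y : R, a <= y <= b -> g y = 0 -> dg y < 0) ->
  g a <= 0 -> g b < 0.
Proof.
move=> ab gE g0 ga; have le0 y : a <= y <= b -> g y <= 0.
  move=> /andP[ay yb]; apply: (@barrier_le g dg a y) => // z /andP[az zy].
    by apply: gE; rewrite az (le_trans zy).
  by apply: g0; rewrite az (le_trans zy).
have bab : a <= b <= b by rewrite lexx ltW.
rewrite lt_neqAle le0// andbT; apply/eqP => gb.
have dgb : 0 < - dg b by rewrite oppr_gt0 g0.
have [e e0 He] := isder_gt0 (isder_opp (gE _ bab)) dgb.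
pose k := Num.min (b - a) (e / 2).
have k0 : 0 < k by rewrite /k lt_min subr_gt0 ab divr_gt0.
have ka : a <= b - k by rewrite lerBrDl -lerBrDr /k ge_min lexx.
have ke : k <= e / 2 by rewrite /k ge_min lexx orbT.
have := He (- k); rewrite oppr_eq0 => /(_ (lt0r_neq0 k0)).
rewrite normrN gtr0_norm// => /(_ ltac:(lra)).
rewrite invrN mulNr oppr_gt0 pmulr_rlt0 ?invr_gt0// gb oppr0 subr0 oppr_lt0.
by rewrite ltNge le0// ka lerBlDr lerDl ltW.
Qed.

(** The derivative is asked for only inside the interval because the estimate will start at a
    blowup, where the function is merely continuous. *)
Lemma gronwall f df K a b : a <= b -> {within `[a, b], continuous f} ->
  (forall y : R, a < y < b -> is_derive y 1 f (df y)) ->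
  (forall y : R, a < y < b -> df y <= K * f y) -> f b <= f a * expR (K * (b - a)).
Proof.
move=> ab cf fE fK.
pose h (y : R) := - (f y * expR (- K * y)).
have : h a <= h b.
  apply: (@nondecreasing_derive h
    (fun y => - (df y * expR (- K * y) + f y * (expR (- K * y) * (0 * y + - K * 1))))) => //.
  - move=> y; apply: cvgN; apply: cvgM; first exact: cf.
    apply: continuous_subspaceT => z.
    have : is_derive z 1 (fun y : R => expR (- K * y)) (expR (- K * z) * (0 * z + - K * 1)) by der.
    exact: isder_continuous.
  - by move=> y /fE ?; der.
  - move=> y yab; rewrite oppr_ge0.
    have -> : df y * expR (- K * y) + f y * (expR (- K * y) * (0 * y + - K * 1)) =
      (df y - K * f y) * expR (- K * y) by ring.
    by rewrite mulr_le0_ge0 ?expR_ge0// subr_le0 fK.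
rewrite /h lerN2 => ha.
have -> : expR (K * (b - a)) = expR (- K * a) / expR (- K * b).
  by rewrite -expRB; congr expR; ring.
by rewrite mulrA ler_pdivlMr ?expR_gt0.
Qed.

End calculus.

(** * Existence for ordinary differential equations *)

Section primitives.
Context {R : realType}.
Implicit Types (f g h dh dg u : R -> R) (x y a b k : R).

(** Integrating from -1 and subtracting a constant, instead of integrating from 0, makes the
    derivative at 0 two-sided. *)
Definition primitive f (x : R) : R :=
  \int[lebesgue_measure]_(t in `[-1, x]) f t -
  \int[lebesgue_measure]_(t in `[-1, 0]) f t.

Lemma primitive0 f : primitive f 0 = 0.
Proof. by rewrite /primitive subrr. Qed.

Lemma integrable_segment f a b : {within `[a, b], continuous f} ->
  lebesgue_measure.-integrable `[a, b] (EFin \o f).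
Proof.
by move=> cf; apply: continuous_compact_integrable => //; exact: segment_compact.
Qed.

Lemma isder_primitive f x : continuous f -> 0 <= x ->
  is_derive x 1 (primitive f) (f x).
Proof.
move=> cf x0.
have xx1 : x < x + 1 by rewrite ltrDl.
have x1 : -1 < x by lra.
have fi : lebesgue_measure.-integrable `[-1, x + 1] (EFin \o f).
  by apply: integrable_segment; exact: continuous_subspaceT.
have [d1 d2] := continuous_FTC1_closed xx1 fi x1 (cf x).
have H : is_derive x 1 (fun x => \int[lebesgue_measure]_(t in `[-1, x]) f t) (f x).
  by apply: (DeriveDef d1); rewrite -derive1E; exact: d2.
rewrite /primitive.
have := isder_add H (isder_cst x (- \int[lebesgue_measure]_(t in `[-1, 0]) f t)).
by rewrite addr0.
Qed.

(** Functions are controlled only on the half-line, whereas [primitive] wants continuity on all of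
    [R]; freezing the argument at 0 bridges the two. *)
Lemma continuous_clamp f : (forall x, 0 <= x -> {for x, continuous f}) ->
  continuous (fun x => f (Num.max x 0)).
Proof.
move=> cf x.
apply: (@continuous_comp _ _ _ (fun x => Num.max x 0) f).
  by apply: continuous_max; [exact: cvg_id|exact: cvg_cst].
by apply: cf; rewrite le_max lexx orbT.
Qed.

Lemma isder_bound h dh g dg a b : a <= b ->
  (forall y : R, a <= y <= b -> is_derive y 1 h (dh y)) ->
  (forall y : R, a <= y <= b -> is_derive y 1 g (dg y)) ->
  (forall y : R, a <= y <= b -> `|dh y| <= dg y) -> `|h b - h a| <= g b - g a.
Proof.
move=> ab hE gE hg.
have H1 : g a - h a <= g b - h b.
  apply: (@nondecreasing_der R (fun y => g y - h y) (fun y => dg y - dh y)) => //.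
    by move=> y yab; have := gE _ yab; have := hE _ yab => ? ?; der.
  by move=> y /hg; rewrite ler_norml subr_ge0 => /andP[].
have H2 : g a + h a <= g b + h b.
  apply: (@nondecreasing_der R (fun y => g y + h y) (fun y => dg y + dh y)) => //.
    by move=> y yab; have := gE _ yab; have := hE _ yab => ? ?; der.
  by move=> y /hg; rewrite ler_norml => /andP[]; lra.
by rewrite ler_norml; lra.
Qed.

Lemma ler_dist_max0 x y : `|Num.max x 0 - Num.max y 0| <= `|x - y|.
Proof.
have H (z t : R) : z <= t -> `|Num.max z 0 - Num.max t 0| <= `|z - t|.
  move=> zt; rewrite (ler0_norm (_ : z - t <= 0)) ?subr_le0//.
  have mzt : Num.max z 0 <= Num.max t 0 by rewrite ge_max !le_max zt lexx orbT.
  rewrite ler0_norm ?subr_le0// !opprB lerBlDr.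
  by rewrite ge_max; apply/andP; split; case: (leP t 0) => ?; case: (leP z 0) => ?; lra.
by have [/H//|/ltW/H] := leP x y; rewrite distrC (distrC y).
Qed.

Lemma le0_geometric x M : (forall n, x <= M / 2 ^+ n) -> x <= 0.
Proof.
move=> H; rewrite leNgt; apply/negP => x0.
have M0 : 0 < M by have := H 0%N; rewrite expr0 divr1; lra.
have := H (Num.truncn (M / x)).+1; rewrite ler_pdivlMr ?exprn_gt0// mulrC.
rewrite -ler_pdivlMr// leNgt => /negP; apply.
have := truncnS_gt (M / x) => /lt_trans; apply.
by rewrite -natrX ltr_nat ltn_expl.
Qed.

(** The intervals of radius [2 * M / 2 ^+ n] around [u n] are nested, and the sup of their left ends
    lies in all of them, so the limit comes with its rate. *)
Lemma geometric_limit (u : nat -> R) M :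
  (forall n, `|u n.+1 - u n| <= M / 2 ^+ n) ->
  exists l, forall n, `|l - u n| <= 2 * M / 2 ^+ n.
Proof.
move=> uM.
have M0 : 0 <= M by apply: le_trans (normr_ge0 _) (le_trans (uM 0%N) _); rewrite expr0 divr1.
pose e n := M / 2 ^+ n.
have e0 n : 0 <= e n by rewrite divr_ge0// exprn_ge0.
have eS n : e n.+1 = e n / 2 by rewrite /e exprS invfM mulrCA mulrC.
have H n (k : nat) : `|u (n + k)%N - u n| <= 2 * e n - 2 * e (n + k)%N.
  elim: k => [|k IH]; first by rewrite addn0 !subrr normr0.
  have := uM (n + k)%N; rewrite addnS -/(e _) => H.
  have -> : u (n + k).+1 - u n = (u (n + k).+1 - u (n + k)%N) + (u (n + k)%N - u n) by ring.
  apply: le_trans (ler_normD _ _) _; rewrite eS.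
  by have := e0 (n + k)%N; lra.
have H' n m : u n - 2 * e n <= u m + 2 * e m.
  have [nm|/ltnW mn] := leqP n m.
    have := H n (m - n)%N; rewrite subnKC// ler_norml => /andP[? ?].
    by have := e0 m; lra.
  have := H m (n - m)%N; rewrite subnKC// ler_norml => /andP[? ?].
  by have := e0 n; lra.
pose A := range (fun n => u n - 2 * e n).
have sA : has_sup A.
  split; first by exists (u 0%N - 2 * e 0%N); exists 0%N.
  by exists (u 0%N + 2 * e 0%N) => _ [n _ <-].
exists (sup A) => n; rewrite -mulrA -/(e n) ler_norml; apply/andP; split.
  rewrite lerBrDl; apply: sup_upper_bound => //; by exists n.
rewrite lerBlDl; apply: ge_sup => [|_ [m _ <-]]; last by have := H' m n; lra.
by case: sA.
Qed.

End primitives.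

(** * Picard iteration on the whole half-line *)

Section picard.
Context {R : realType}.
Variable F : R -> R -> R.
Hypothesis F_continuous : forall u : R -> R, continuous u ->
  continuous (fun x => F x (u x)).
Hypothesis F_lip : forall X : R, exists L : R, forall x s t : R, 0 <= x <= X ->
  `|F x s - F x t| <= L * `|s - t| /\ `|F x s| <= L.

Fixpoint picard_iter n : R -> R :=
  if n is n'.+1 then
    primitive (fun y => F y (picard_iter n' (Num.max y 0)))
  else fun=> 0.

Let U := picard_iter.

Let U_cont n : forall x : R, 0 <= x -> {for x, continuous (U n)}.
Proof.
elim: n => [x _|n IH x x0]; first exact: cvg_cst.
apply: isder_continuous; apply: isder_primitive => //.
by apply: F_continuous; exact: continuous_clamp.
Qed.

Let U_der n (x : R) : 0 <= x -> is_derive x 1 (U n.+1) (F x (U n x)).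
Proof.
move=> x0.
have := @isder_primitive R (fun y => F y (U n (Num.max y 0))) x _ x0.
rewrite max_l//; apply.
by apply: F_continuous; apply: continuous_clamp; exact: U_cont.
Qed.

Let U0 n : U n 0 = 0.
Proof. by case: n => [//|n]; rewrite /U /= primitive0. Qed.

Let lip_pos (X : R) : exists2 L : R, 0 < L & forall x s t : R, 0 <= x <= X ->
  `|F x s - F x t| <= L * `|s - t| /\ `|F x s| <= L.
Proof.
have [L HL] := F_lip X; exists (`|L| + 1) => [|x s t xX].
  by rewrite ltr_wpDl.
have [h1 h2] := HL x s t xX.
have LL : L <= `|L| + 1 by rewrite (le_trans (ler_norm _))// lerDl.
split; last exact: le_trans LL.
by apply: le_trans h1 _; rewrite ler_wpM2r.
Qed.

(** In the norm weighted by [expR (2 * L * x)] each Picard step halves the distance, whatever [X]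
    is, so no solutions on short intervals have to be glued. *)
Let U_step (X : R) : exists2 M : R, 0 <= M & forall n (x : R), 0 <= x <= X ->
  `|U n.+2 x - U n.+1 x| <= M / 2 ^+ n.
Proof.
have [L L0 HL] := lip_pos X; exists (expR (2 * L * X)) => [|n x /andP[x0 xX]].
  exact: expR_ge0.
pose g n (y : R) : R := expR (2 * L * y) / 2 ^+ n.
pose dg n (y : R) : R := expR (2 * L * y) * ((0 * y) + 2 * L * 1) * (2 ^+ n)^-1 + expR (2 * L * y) * 0.
have gE m (y : R) : is_derive y 1 (g m) (dg m y) by rewrite /g /dg; der.
have dgE m (y : R) : dg m y = 2 * L * g m y by rewrite /dg /g; ring.
have g0 m (y : R) : 0 < g m y by rewrite divr_gt0 ?expR_gt0// exprn_gt0.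
have key m (u v u1 v1 : R -> R) (y : R) :
    (forall z : R, 0 <= z -> is_derive z 1 u1 (F z (u z))) ->
    (forall z : R, 0 <= z -> is_derive z 1 v1 (F z (v z))) ->
    u1 0 = 0 -> v1 0 = 0 ->
    (forall z : R, 0 <= z <= X -> `|u z - v z| <= g m z) ->
    0 <= y <= X -> `|u1 y - v1 y| <= g m.+1 y.
  move=> u1E v1E u10 v10 uv /andP[y0 yX].
  have H : `|(u1 y - v1 y) - (u1 0 - v1 0)| <= g m.+1 y - g m.+1 0.
    apply: (@isder_bound R (fun y => u1 y - v1 y)
      (fun y => F y (u y) - F y (v y)) (g m.+1) (dg m.+1)) => // z /andP[z0 zy].
      exact: isder_add (u1E z z0) (isder_opp (v1E z z0)).
    have zX : 0 <= z <= X by rewrite z0 (le_trans zy).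
    have [h1 _] := HL z (u z) (v z) zX.
    apply: le_trans h1 _; rewrite dgE.
    have -> : g m.+1 z = g m z / 2 by rewrite /g exprS invfM mulrCA mulrC.
    by rewrite (_ : 2 * L * _ = L * g m z); [rewrite ler_wpM2l ?(ltW L0)// uv|field].
  by move: H; rewrite u10 v10 !subrr subr0; have := g0 m.+1 0; lra.
have main m (y : R) : 0 <= y <= X -> `|U m.+2 y - U m.+1 y| <= g m y.
  elim: m y => [|m IH] y /andP[y0 yX].
    have := @isder_bound R (fun y => U 2 y - U 1 y) (fun y => F y (U 1 y) - F y (U 0 y))
      (g 0%N) (dg 0%N) 0 y y0.
    rewrite !U0 !subrr subr0 => H; apply: le_trans (H _ _ _) _.
    - move=> z /andP[z0 _].
      exact: isder_add (U_der 1 z0) (isder_opp (U_der 0 z0)).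
    - move=> z /andP[z0 zy]; have zX : 0 <= z <= X by rewrite z0 (le_trans zy).
      have [_ h1] := HL z (U 1 z) 0 zX; have [_ h2] := HL z (U 0 z) 0 zX.
      apply: le_trans (ler_normB _ _) _; rewrite dgE /g expr0 divr1.
      have : 1 <= expR (2 * L * z).
        by rewrite -[leLHS]expR0 ler_expR !mulr_ge0// ltW.
      rewrite -(ler_pM2l L0) mulr1 => h3.
      by rewrite (le_trans (lerD h1 h2))// -mulrA mulr2n mulrDl !mul1r lerD.
    - by have := g0 0%N 0; lra.
  apply: (key m (U m.+2) (U m.+1) (U m.+3) (U m.+2)) => //; last by rewrite y0.
  - exact: U_der.
  - exact: U_der.
apply: le_trans (main n x _) _; first by rewrite x0.
rewrite /g ler_wpM2r ?invr_ge0 ?exprn_ge0// ler_expR ler_wpM2l//.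
by rewrite mulr_ge0// ltW.
Qed.

Let limit_ex (x : R) : exists l : R, exists M : R, forall n, 0 <= x -> `|l - U n.+1 x| <= M / 2 ^+ n.
Proof.
have [x0|x0] := leP 0 x; last by exists 0, 0.
have [M M0 HM] := U_step x.
have [l Hl] := @geometric_limit R (fun n => U n.+1 x) M (fun n => HM n x ltac:(by rewrite x0 lexx)).
by exists l, (2 * M) => n _; exact: Hl.
Qed.

Let th (x : R) : R := sval (cid (limit_ex x)).

(** The limit was chosen point by point, with a constant that may depend on the point; since limits
    are unique, it inherits the rate that is uniform on [[0, X]]. *)
Let th_unif (X : R) : exists2 M : R, 0 <= M & forall n (x : R), 0 <= x <= X ->
  `|th x - U n.+1 x| <= M / 2 ^+ n.
Proof.
have [M M0 HM] := U_step X; exists (2 * M) => [|n x /andP[x0 xX]]; first by rewrite mulr_ge0.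
have [l Hl] := @geometric_limit R (fun n => U n.+1 x) M
  (fun n => HM n x ltac:(by rewrite x0 xX)).
suff -> : th x = l by exact: Hl.
rewrite /th; case: cid => l' /= [M' HM'].
apply/eqP; rewrite -subr_eq0 -normr_eq0 eq_le normr_ge0 andbT.
apply: (@le0_geometric R _ (M' + 2 * M)) => m.
have -> : l' - l = (l' - U m.+1 x) - (l - U m.+1 x) by ring.
by apply: le_trans (ler_normB _ _) _; rewrite mulrDl lerD ?Hl ?HM'.
Qed.

(** All iterates have derivatives bounded by [L], and the limit inherits the Lipschitz bound; its
    continuity is what allows [F x (th x)] to be integrated. *)
Let th_lip (X : R) : exists2 L : R, 0 < L & forall x y : R, 0 <= x <= X -> 0 <= y <= X ->
  `|th x - th y| <= L * `|x - y|.
Proof.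
have [L L0 HL] := lip_pos X; have [M M0 HM] := th_unif X.
exists L => //.
have main (x y : R) : 0 <= y -> y <= x -> x <= X -> `|th x - th y| <= L * (x - y).
  move=> y0 yx xX; rewrite -subr_le0; apply: (@le0_geometric R _ (2 * M)) => n.
  have h1 := HM n x; have h2 := HM n y.
  have h3 : `|U n.+1 x - U n.+1 y| <= L * x - L * y.
    apply: (@isder_bound R (U n.+1) (fun y => F y (U n y)) (fun y => L * y)
      (fun y => 0 * y + L * 1) y x yx).
    - by move=> z /andP[yz _]; apply: U_der; exact: le_trans yz.
    - by move=> z _; der.
    - move=> z /andP[yz zx]; rewrite mul0r add0r mulr1.
      by have [|_] := HL z (U n z) 0; first by rewrite (le_trans y0)// (le_trans zx).
  have -> : th x - th y = (th x - U n.+1 x) - (th y - U n.+1 y) + (U n.+1 x - U n.+1 y) by ring.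
  have := ler_normD ((th x - U n.+1 x) - (th y - U n.+1 y)) (U n.+1 x - U n.+1 y).
  have := ler_normB (th x - U n.+1 x) (th y - U n.+1 y).
  have := h1 ltac:(by rewrite (le_trans y0)).
  have := h2 ltac:(by rewrite y0 (le_trans yx)).
  by rewrite -mulrA mulrBr; lra.
move=> x y /andP[x0 xX] /andP[y0 yX]; have [xy|/ltW yx] := leP x y.
  by rewrite (distrC (th x)) (distrC x) (ger0_norm (_ : 0 <= y - x)) ?subr_ge0//; exact: main.
by rewrite (ger0_norm (_ : 0 <= x - y)) ?subr_ge0//; exact: main.
Qed.

Let th_cont : continuous (fun x : R => th (Num.max x 0)).
Proof.
move=> x; pose X := Num.max x 0 + 1.
have [L L0 HL] := th_lip X.
apply/cvgrPdist_lt => e e0; near=> y.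
have xX : 0 <= Num.max x 0 <= X by rewrite /X le_max lexx orbT lerDl ler01.
have xy : `|x - y| < Num.min 1 (e / L).
  near: y; apply/nbhs_ballP; exists (Num.min 1 (e / L)) => //=.
  by rewrite lt_min ltr01 divr_gt0.
have mxy : `|Num.max x 0 - Num.max y 0| <= `|x - y|.
  exact: ler_dist_max0.
move: xy; rewrite lt_min => /andP[xy1 xye].
have yX : 0 <= Num.max y 0 <= X.
  rewrite le_max lexx orbT /X -lerBlDl.
  by rewrite (le_trans _ (ltW xy1))// (le_trans _ mxy)// distrC ler_norm.
apply: le_lt_trans (HL _ _ xX yX) _.
apply: le_lt_trans (ler_wpM2l (ltW L0) mxy) _.
by rewrite mulrC -ltr_pdivlMr.
Unshelve. all: by end_near. Qed.

Lemma picard_lindelof :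
  exists2 u : R -> R, u 0 = 0 & forall x : R, 0 <= x -> is_derive x 1 u (F x (u x)).
Proof.
pose u := primitive (fun y => F y (th (Num.max y 0))).
have ud (x : R) : 0 <= x -> is_derive x 1 u (F x (th x)).
  move=> x0; have := @isder_primitive R (fun y => F y (th (Num.max y 0))) x _ x0.
  rewrite max_l//; apply.
  exact: F_continuous th_cont.
have u0 : u 0 = 0 by rewrite /u primitive0.
exists u => // x x0; suff <- : th x = u x by exact: ud.
have [L L0 HL] := lip_pos x; have [M M0 HM] := th_unif x.
apply/eqP; rewrite -subr_eq0 -normr_eq0 eq_le normr_ge0 andbT.
(* The first [M] bounds [th - U n.+2]; [L * M * x] bounds [u - U n.+2], by integrating the
   difference of the right-hand sides at [th] and at [U n.+1]. *)
apply: (@le0_geometric R _ (M + L * M * x)) => n.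
have : `|(u x - U n.+2 x) - (u 0 - U n.+2 0)| <= L * (M / 2 ^+ n) * x - L * (M / 2 ^+ n) * 0.
  apply: (@isder_bound R (fun x => u x - U n.+2 x) (fun x => F x (th x) - F x (U n.+1 x))
    (fun x => L * (M / 2 ^+ n) * x) (fun x => 0 * x + L * (M / 2 ^+ n) * 1)) => //.
  - by move=> y /andP[y0 _]; have := ud _ y0; have := U_der n.+1 y0 => ? ?; der.
  - by move=> y _; der.
  - move=> y yx; have [h _] := HL y (th y) (U n.+1 y) yx.
    by rewrite mul0r add0r mulr1 (le_trans h)// ler_wpM2l ?(ltW L0)// HM.
rewrite u0 U0 subrr subr0 mulr0 subr0 => h.
have h2 : `|th x - U n.+2 x| <= M / 2 ^+ n.
  have := HM n.+1 x ltac:(by rewrite x0 lexx) => /le_trans; apply.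
  rewrite ler_wpM2l// lef_pV2 ?posrE ?exprn_gt0// exprS.
  by rewrite ler_peMl ?exprn_ge0// ler1n.
have -> : th x - u x = (th x - U n.+2 x) - (u x - U n.+2 x) by ring.
apply: le_trans (ler_normB _ _) _.
have -> : (M + L * M * x) / 2 ^+ n = M / 2 ^+ n + L * (M / 2 ^+ n) * x by ring.
exact: lerD.
Qed.

End picard.

(** * The Pruefer angle *)

Section trigonometry.
Context {R : realType}.
Implicit Types (s t : R) (k : nat).

Lemma natpiS k : k.+1%:R * pi = k%:R * pi + pi :> R.
Proof. by rewrite -natr1 mulrDl mul1r. Qed.

Lemma sin_natpi k : sin (k%:R * pi : R) = 0.
Proof.
elim: k => [|k IH]; first by rewrite mul0r sin0.
by rewrite natpiS sinDpi IH oppr0.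
Qed.

Lemma cos_natpi_pihalf k : cos (k%:R * pi + pi / 2 : R) = 0.
Proof. by rewrite cosDpihalf sin_natpi oppr0. Qed.

Lemma sincosDnatpi k t : sin (t + k%:R * pi) * cos (t + k%:R * pi) = sin t * cos t.
Proof.
elim: k => [|k IH]; first by rewrite mul0r addr0.
by rewrite natpiS addrA sinDpi cosDpi mulrNN.
Qed.

Lemma sincos_gt0 k t : k%:R * pi < t < k%:R * pi + pi / 2 -> 0 < sin t * cos t.
Proof.
move=> /andP[h1 h2]; rewrite -(subrK (k%:R * pi) t) sincosDnatpi.
have p0 := pi_gt0 R.
by rewrite mulr_gt0 ?sin_gt0_pihalf ?cos_gt0_pihalf//; apply/andP; split; lra.
Qed.

Lemma sincos_lt0 k t : k%:R * pi + pi / 2 < t < k.+1%:R * pi ->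
  sin t * cos t < 0.
Proof.
rewrite natpiS => /andP[h1 h2].
have p0 := pi_gt0 R.
have -> : t = (t - k%:R * pi - pi / 2) + pi / 2 + k%:R * pi by ring.
rewrite sincosDnatpi sinDpihalf cosDpihalf mulrN oppr_lt0.
by rewrite mulr_gt0 ?sin_gt0_pihalf ?cos_gt0_pihalf//; apply/andP; split; lra.
Qed.

Lemma sincos_lt0_inv k t : k%:R * pi <= t < k.+1%:R * pi -> sin t * cos t < 0 ->
  k%:R * pi + pi / 2 < t.
Proof.
move=> /andP[h1 h2] sc; rewrite ltNge; apply/negP => h3.
move: h1; rewrite le_eqVlt => /predU1P[E|h1].
  by move: sc; rewrite -E sin_natpi mul0r ltxx.
move: h3; rewrite le_eqVlt => /predU1P[E|h3].
  by move: sc; rewrite E cos_natpi_pihalf mulr0 ltxx.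
by have := @sincos_gt0 k t; rewrite h1 h3 => /(_ isT); lra.
Qed.

Lemma natpi_floor t : 0 <= t -> exists k, k%:R * pi <= t < k.+1%:R * pi.
Proof.
have p0 := pi_gt0 R.
move=> t0; exists (Num.truncn (t / pi)).
rewrite -ler_pdivlMr// -ltr_pdivrMr// truncnS_gt andbT.
by rewrite truncn_le// divr_ge0// ltW.
Qed.

Lemma ler_dist_sin s t : `|sin s - sin t| <= `|s - t|.
Proof.
have H a b : a <= b -> `|sin b - sin a| <= b - a :> R.
  move=> ab; apply: (@isder_bound R sin cos id (fun=> 1)) => // y _.
  exact: cos_max.
have [st|/ltW ts] := leP s t; last by rewrite (ger0_norm (_ : 0 <= s - t)) ?subr_ge0 ?H.
by rewrite distrC (distrC s) (ger0_norm (_ : 0 <= t - s)) ?subr_ge0 ?H.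
Qed.

Lemma ler_dist_cos s t : `|cos s - cos t| <= `|s - t|.
Proof.
have -> : s - t = (s + pi / 2) - (t + pi / 2) by ring.
by rewrite -!sinDpihalf ler_dist_sin.
Qed.

Lemma ler_dist_sin2 s t : `|sin s ^+ 2 - sin t ^+ 2| <= 2 * `|s - t|.
Proof.
rewrite subr_sqr normrM mulrC ler_pM ?ler_dist_sin//.
by rewrite (le_trans (ler_normD _ _))//; have := sin_max s; have := sin_max t; lra.
Qed.

Lemma ler_dist_sincos s t : `|sin s * cos s - sin t * cos t| <= 2 * `|s - t|.
Proof.
have -> : sin s * cos s - sin t * cos t =
  (sin s - sin t) * cos s + sin t * (cos s - cos t) by ring.
rewrite (le_trans (ler_normD _ _))// !normrM mulr2n mulrDl mul1r lerD//.
  by rewrite -[leRHS]mulr1 ler_pM ?ler_dist_sin ?cos_max.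
by rewrite -[leRHS]mul1r ler_pM ?ler_dist_cos ?sin_max.
Qed.

Lemma sin2_le1 t : sin t ^+ 2 <= 1.
Proof. by rewrite -(cos2Dsin2 t) lerDr sqr_ge0. Qed.

End trigonometry.

Lemma continuous_bounded_segment {R : realType} (f : R -> R) (X : R) :
  continuous f -> exists2 M : R, 0 <= M & forall x : R, 0 <= x <= X -> `|f x| <= M.
Proof.
move=> cf; have [X0|X0] := leP 0 X; last first.
  by exists 0 => // x /andP[x0 xX]; have := lt_le_trans X0 x0; rewrite ltNge xX.
have cnf : {within `[0, X], continuous (fun x => `|f x|)}.
  apply: continuous_subspaceT => x; exact: (cvg_norm (cf x)).
have [c _ Hc] := EVT_max X0 cnf.
exists `|f c| => // x xX; apply: Hc; by rewrite in_itv.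
Qed.

Section prufer.
Context {R : realType}.
Variables W Q : R -> R.
Hypothesis cW : continuous W.
Hypothesis cQ : continuous Q.
Implicit Types (lam mu x y t a e X Lam : R) (k : nat).

(* [psi = rho sin th] and [phi = rho cos th] turn the system
   [psi' = W psi + phi], [phi' = (Q - lam) psi - W phi] into [th' = prufer_fun]
   and [rho' / rho = rho_fun]. *)
Definition prufer_fun lam x t : R :=
  cos t ^+ 2 + 2 * W x * (sin t * cos t) - (Q x - lam) * sin t ^+ 2.

Definition rho_fun lam x t : R :=
  W x * (sin t ^+ 2 - cos t ^+ 2) + (1 + (Q x - lam)) * (sin t * cos t).

(** One constant serves all [lam] in a bounded range because angles for two different parameters
    will be compared; [1 <= L] lets [L] also absorb the effect of the change of parameter. *)
Lemma prufer_fun_lip X Lam : exists2 L : R, 1 <= L &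
  forall lam x s t, `|lam| <= Lam -> 0 <= x <= X ->
  `|prufer_fun lam x s - prufer_fun lam x t| <= L * `|s - t| /\
  `|prufer_fun lam x s| <= L.
Proof.
have [M1 M10 HW] := continuous_bounded_segment X cW.
have [M2 M20 HQ] := continuous_bounded_segment X cQ.
(* [sin ^ 2] (hence [cos ^ 2]) and [sin * cos] are 2-Lipschitz; they occur with coefficients at most
   1, [2 * M1] and [M2 + |Lam|]. *)
exists (2 + 4 * M1 + 2 * (M2 + `|Lam|)) => [|lam x s t laml xX].
  by have := normr_ge0 Lam; lra.
have hW := HW _ xX; have hQ := HQ _ xX.
have Lam0 : Lam <= `|Lam| := ler_norm Lam.
have hq : `|Q x - lam| <= M2 + `|Lam| by rewrite (le_trans (ler_normB _ _))//; lra.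
rewrite /prufer_fun; split.
  set d := `|s - t|; have d0 : 0 <= d by exact: normr_ge0.
  rewrite !cos2sin2.
  have -> : 1 - sin s ^+ 2 + 2 * W x * (sin s * cos s) - (Q x - lam) * sin s ^+ 2 -
    (1 - sin t ^+ 2 + 2 * W x * (sin t * cos t) - (Q x - lam) * sin t ^+ 2) =
    - (sin s ^+ 2 - sin t ^+ 2) + 2 * W x * (sin s * cos s - sin t * cos t)
    - (Q x - lam) * (sin s ^+ 2 - sin t ^+ 2) by ring.
  have h1 : `|sin s ^+ 2 - sin t ^+ 2| <= 2 * d by exact: ler_dist_sin2.
  have h2 : `|sin s * cos s - sin t * cos t| <= 2 * d by exact: ler_dist_sincos.
  have h3 : `|2 * W x * (sin s * cos s - sin t * cos t)| <= 2 * M1 * (2 * d).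
    by rewrite !normrM (ger0_norm (_ : 0 <= 2 :> R))// ler_pM// ?mulr_ge0// ler_wpM2l.
  have h4 : `|(Q x - lam) * (sin s ^+ 2 - sin t ^+ 2)| <= (M2 + `|Lam|) * (2 * d).
    by rewrite normrM ler_pM.
  apply: le_trans (ler_normB _ _) _; apply: le_trans (lerD (ler_normD _ _) (lexx _)) _.
  rewrite normrN; apply: le_trans (lerD (lerD h1 h3) h4) _.
  by rewrite le_eqVlt; apply/orP; left; apply/eqP; ring.
have h1 : `|cos s ^+ 2| <= 1 by rewrite normrX exprn_ile1 // ?cos_max ?sin_max.
have h2 : `|sin s * cos s| <= 1 by rewrite normrM mulr_ile1 ?sin_max ?cos_max.
have h3 : `|sin s ^+ 2| <= 1 by rewrite normrX exprn_ile1 // ?cos_max ?sin_max.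
have h4 : `|2 * W x * (sin s * cos s)| <= 2 * M1 * 1.
  by rewrite !normrM (ger0_norm (_ : 0 <= 2 :> R))// -normrM ler_pM// ?mulr_ge0// ler_wpM2l.
have h5 : `|(Q x - lam) * sin s ^+ 2| <= (M2 + `|Lam|) * 1 by rewrite normrM ler_pM.
apply: le_trans (ler_normB _ _) _; apply: le_trans (lerD (ler_normD _ _) (lexx _)) _.
by have := normr_ge0 Lam; lra.
Qed.

Lemma continuous_prufer_fun lam (u : R -> R) : continuous u ->
  continuous (fun x => prufer_fun lam x (u x)).
Proof.
move=> cu x.
have cs : {for x, continuous (fun x => sin (u x))}.
  by apply: continuous_comp; [exact: cu|exact: continuous_sin].
have cc : {for x, continuous (fun x => cos (u x))}.
  by apply: continuous_comp; [exact: cu|exact: continuous_cos].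
rewrite /prufer_fun; apply: cvgB; first apply: cvgD.
- exact: continuous_sqr.
- apply: cvgM; last exact: (cvgM cs cc).
  by apply: cvgM; [exact: cvg_cst|exact: cW].
- apply: cvgM; last exact: (continuous_sqr cs).
  by apply: cvgB; [exact: cQ|exact: cvg_cst].
Qed.

Lemma continuous_rho_fun lam (u : R -> R) : continuous u ->
  continuous (fun x => rho_fun lam x (u x)).
Proof.
move=> cu x.
have cs : {for x, continuous (fun x => sin (u x))}.
  by apply: continuous_comp; [exact: cu|exact: continuous_sin].
have cc : {for x, continuous (fun x => cos (u x))}.
  by apply: continuous_comp; [exact: cu|exact: continuous_cos].
rewrite /rho_fun; apply: cvgD; apply: cvgM.
- exact: cW.
- by apply: cvgB; exact: continuous_sqr.
- by apply: cvgD; [exact: cvg_cst|apply: cvgB; [exact: cQ|exact: cvg_cst]].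
- exact: (cvgM cs cc).
Qed.

Lemma prufer_angle_ex lam : exists2 u : R -> R, u 0 = 0 &
  forall x, 0 <= x -> is_derive x 1 u (prufer_fun lam x (u x)).
Proof.
apply: picard_lindelof => [u|X]; first exact: continuous_prufer_fun.
have [L L1 HL] := prufer_fun_lip X `|lam|.
by exists L => x s t xX; exact: HL.
Qed.

Definition th lam : R -> R := sval (cid2 (prufer_angle_ex lam)).

Lemma th0 lam : th lam 0 = 0.
Proof. by rewrite /th; case: cid2. Qed.

Lemma der_th lam x : 0 <= x -> is_derive x 1 (th lam) (prufer_fun lam x (th lam x)).
Proof. by rewrite /th; case: cid2 => u /= _; exact. Qed.

(** Once the angle is known, the radius is a quadrature. As an exponential it is positive, so [psi]
    and [phi] never vanish together. *)
Definition rho lam x : R :=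
  expR (primitive (fun y => rho_fun lam y (th lam (Num.max y 0))) x).

Definition psi lam x : R := rho lam x * sin (th lam x).
Definition phi lam x : R := rho lam x * cos (th lam x).

Lemma rho_gt0 lam x : 0 < rho lam x.
Proof. exact: expR_gt0. Qed.

Lemma der_rho lam x : 0 <= x ->
  is_derive x 1 (rho lam) (rho lam x * rho_fun lam x (th lam x)).
Proof.
move=> x0; rewrite /rho; apply: isder_exp.
have := @isder_primitive R (fun y => rho_fun lam y (th lam (Num.max y 0))) x _ x0.
rewrite max_l//; apply; apply: continuous_rho_fun; apply: continuous_clamp => y y0.
exact: isder_continuous (der_th lam y0).
Qed.

Lemma der_psi lam x : 0 <= x ->
  is_derive x 1 (psi lam) (W x * psi lam x + phi lam x).
Proof.
move=> x0; have dr := der_rho lam x0; have dt := der_th lam x0.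
apply: (isder_eq (isder_mul dr (isder_sin dt))).
rewrite /psi /phi /rho_fun /prufer_fun; have := cos2Dsin2 (th lam x).
set r := rho lam x; set s := sin _; set c := cos _ => E.
have -> : W x * (r * s) + r * c = r * (W x * s + c) * (c ^+ 2 + s ^+ 2).
  by rewrite E; ring.
by ring.
Qed.

Lemma der_phi lam x : 0 <= x ->
  is_derive x 1 (phi lam) ((Q x - lam) * psi lam x - W x * phi lam x).
Proof.
move=> x0; have dr := der_rho lam x0; have dt := der_th lam x0.
apply: (isder_eq (isder_mul dr (isder_cos dt))).
rewrite /psi /phi /rho_fun /prufer_fun; have := cos2Dsin2 (th lam x).
set r := rho lam x; set s := sin _; set c := cos _ => E.
have -> : (Q x - lam) * (r * s) - W x * (r * c) =
  r * ((Q x - lam) * s - W x * c) * (c ^+ 2 + s ^+ 2) by rewrite E; ring.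
by ring.
Qed.

Lemma psi_phi_sqr lam x : psi lam x ^+ 2 + phi lam x ^+ 2 = rho lam x ^+ 2.
Proof. by rewrite /psi /phi !exprMn -mulrDr addrC cos2Dsin2 mulr1. Qed.

(** At a multiple of pi the angle has speed [cos ^ 2 = 1], whatever [W], [Q] and [lam] are. *)
Lemma th_cross lam k a x : 0 <= a -> a < x -> k%:R * pi <= th lam a ->
  k%:R * pi < th lam x.
Proof.
move=> a0 ax ka; rewrite -subr_lt0.
apply: (@barrier_lt R (fun y => k%:R * pi - th lam y)
  (fun y => 0 - prufer_fun lam y (th lam y)) a x ax).
- move=> y /andP[ay _]; have y0 := le_trans a0 ay.
  exact: isder_add (isder_cst y _) (isder_opp (der_th lam y0)).
- move=> y _ /eqP; rewrite subr_eq0 => /eqP <-; rewrite /prufer_fun cos2sin2 sin_natpi.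
  by lra.
- by rewrite subr_le0.
Qed.

Lemma th_cross_le lam k a x : 0 <= a -> a <= x -> k%:R * pi <= th lam a ->
  k%:R * pi <= th lam x.
Proof.
move=> a0; rewrite le_eqVlt => /predU1P[<-//|ax] h.
by apply: ltW; exact: th_cross h.
Qed.

Lemma th_ge0 lam x : 0 <= x -> 0 <= th lam x.
Proof. by move=> x0; have := @th_cross_le lam 0 0 x; rewrite mul0r th0; apply. Qed.

Lemma th_gt0 lam x : 0 < x -> 0 < th lam x.
Proof. by move=> x0; have := @th_cross lam 0 0 x; rewrite mul0r th0; apply. Qed.

(** At [k pi + pi / 2] the angle has speed [- (Q - lam)], which is negative beyond [a]. *)
Lemma th_trap lam k a x : 0 <= a -> a < x -> (forall y, a <= y -> 0 < Q y - lam) ->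
  th lam a <= k%:R * pi + pi / 2 -> th lam x < k%:R * pi + pi / 2.
Proof.
move=> a0 ax q0 ka; rewrite -subr_lt0.
apply: (@barrier_lt R (fun y => th lam y - (k%:R * pi + pi / 2))
  (fun y => prufer_fun lam y (th lam y) + - 0) a x ax).
- move=> y /andP[ay _]; have y0 := le_trans a0 ay.
  by exact: isder_add (der_th lam y0) (isder_opp (isder_cst y _)).
- move=> y /andP[ay _] /eqP; rewrite subr_eq0 => /eqP ->.
  rewrite /prufer_fun sin2cos2 cos_natpi_pihalf.
  by have := q0 y ay; lra.
- by rewrite subr_le0.
Qed.

Lemma th_compare X Lam : exists2 L : R, 1 <= L &
  forall lam mu e x, `|lam| <= Lam -> `|mu| <= Lam -> 0 < e -> lam - mu < e ->
    0 <= x <= X -> th lam x - th mu x <= e * expR (2 * L * x).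
Proof.
have [L L1 HL] := prufer_fun_lip X Lam; exists L => // lam mu e x lamL muL e0 lme /andP[x0 xX].
rewrite -subr_le0.
apply: (@barrier_le R (fun y => th lam y - th mu y - e * expR (2 * L * y))
  (fun y => prufer_fun lam y (th lam y) - prufer_fun mu y (th mu y) -
     (0 * expR (2 * L * y) + e * (expR (2 * L * y) * (0 * y + 2 * L * 1)))) 0 x x0).
- move=> y /andP[y0 _]; have := der_th lam y0; have := der_th mu y0 => ? ?.
  by der.
- move=> y /andP[y0 yx] /eqP; rewrite subr_eq0 => /eqP E.
  have yX : 0 <= y <= X by rewrite y0 (le_trans yx).
  have [h _] := HL lam y (th lam y) (th mu y) lamL yX.
  have Ee : e <= e * expR (2 * L * y).
    have L0 : 0 <= L by lra.
    by rewrite ler_peMr ?(ltW e0)// -[leLHS](@expR0 R) ler_expR !mulr_ge0.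
  have E0 : 0 < e * expR (2 * L * y) by rewrite mulr_gt0 ?expR_gt0.
  move: h; rewrite E (gtr0_norm E0); set u := e * expR _ in E0 Ee *.
  rewrite ler_norml => /andP[_ h].
  have -> : prufer_fun mu y (th mu y) = prufer_fun lam y (th mu y) -
    (lam - mu) * sin (th mu y) ^+ 2 by rewrite /prufer_fun; ring.
  have h2 : (lam - mu) * sin (th mu y) ^+ 2 < u.
    have s0 := sqr_ge0 (sin (th mu y)); have s1 := sin2_le1 (th mu y).
    have [d0|d0] := leP (lam - mu) 0.
      by apply: le_lt_trans E0; rewrite mulr_le0_ge0.
    by apply: lt_le_trans Ee; apply: le_lt_trans lme; rewrite ler_piMr// ltW.
  have h3 : u <= L * u by rewrite ler_peMl// ltW.
  have -> : 0 * expR (2 * L * y) + e * (expR (2 * L * y) * (0 * y + 2 * L * 1)) = 2 * (L * u).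
    by rewrite /u; ring.
  by lra.
- by rewrite !th0 mulr0 expR0; lra.
Qed.

Lemma th_mono lam mu x : lam <= mu -> 0 <= x -> th lam x <= th mu x.
Proof.
move=> lm x0; have [L L1 HL] := th_compare x (`|lam| + `|mu|).
rewrite -subr_le0 leNgt; apply/negP => d0.
(* This makes the barrier at [x] half of the supposed gap. *)
pose e := (th lam x - th mu x) / 2 / expR (2 * L * x).
have e0 : 0 < e by rewrite !divr_gt0 ?expR_gt0.
have := HL lam mu e x; rewrite lerDl lerDr !normr_ge0 x0 lexx.
have -> : lam - mu < e by apply: le_lt_trans e0; rewrite subr_le0.
move=> /(_ isT isT e0 isT isT); rewrite /e divfK ?gt_eqF ?expR_gt0//.
by move: d0; lra.
Qed.

Lemma th_continuous lam x e : 0 <= x -> 0 < e -> exists2 d : R, 0 < d &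
  forall mu, `|mu - lam| < d -> `|th mu x - th lam x| < e.
Proof.
move=> x0 e0; have [L L1 HL] := th_compare x (`|lam| + 1).
have E0 := expR_gt0 (2 * L * x).
pose d := Num.min 1 (e / 2 / expR (2 * L * x)).
have d0 : 0 < d by rewrite lt_min ltr01 !divr_gt0.
exists d => // mu mud.
have mu1 : `|mu| <= `|lam| + 1.
  have -> : mu = lam + (mu - lam) by ring.
  rewrite (le_trans (ler_normD _ _))// lerD2l (le_trans (ltW mud))//.
  by rewrite ge_min lexx.
have lam1 : `|lam| <= `|lam| + 1 by rewrite lerDl.
have xx : 0 <= x <= x by rewrite x0 lexx.
move: mud; rewrite ltr_norml => /andP[m1 m2].
have h1 := HL mu lam d x mu1 lam1 d0 m2 xx.
have h2 := HL lam mu d x lam1 mu1 d0 ltac:(lra) xx.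
have : d * expR (2 * L * x) <= e / 2.
  by rewrite -ler_pdivlMr// ge_min lexx orbT.
by rewrite ltr_norml => ?; apply/andP; split; lra.
Qed.

End prufer.

(** * Oscillation *)

Lemma sin_mul_gt0 {R : realType} (k : nat) (s t : R) :
  k%:R * pi < s < k.+1%:R * pi -> k%:R * pi < t < k.+1%:R * pi ->
  0 < sin s * sin t.
Proof.
elim: k s t => [|k IH] s t.
  by rewrite mul0r mul1r => hs ht; rewrite mulr_gt0 ?sin_gt0_pi.
move=> /andP[s1 s2] /andP[t1 t2].
have := IH (s - pi) (t - pi).
rewrite -[X in _ -> 0 < sin X * _](subrK pi s) -[X in _ -> 0 < _ * sin X](subrK pi t).
rewrite !sinDpi mulrNN; apply; move: s1 s2 t1 t2; rewrite !natpiS => *; apply/andP; split; lra.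
Qed.

Section oscillation.
Context {R : realType}.
Variables W Q : R -> R.
Hypothesis cW : continuous W.
Hypothesis cQ : continuous Q.
Variable C : R.
Hypothesis Q_growth : forall x : R, 0 <= x -> x / 2 - C <= Q x.
Implicit Types (lam mu x y t a e X : R) (k n : nat).

Local Notation th := (th cW cQ).
Local Notation psi := (psi cW cQ).
Local Notation phi := (phi cW cQ).
Local Notation rho := (rho cW cQ).

(** This says that [psi lam] has at least [k] zeros on []0, +oo[], since the angle passes each
    multiple of pi once and upwards. In this form it is an inequality, convenient for monotonicity
    and perturbation in [lam]. *)
Definition reaches lam k := exists2 x : R, 0 <= x & k%:R * pi <= th lam x.

Definition decaying lam := exists2 X : R, 0 <= X &
  forall x : R, X <= x -> sin (th lam x) * cos (th lam x) < 0.

Lemma Q_large M : exists2 X : R, 0 <= X &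
  forall x lam, X <= x -> lam <= M -> 1 <= Q x - lam.
Proof.
exists (`|2 * (M + C + 1)|) => [|x lam Xx lamM]; first exact: normr_ge0.
have h := ler_norm (2 * (M + C + 1)).
have x0 : 0 <= x by apply: le_trans Xx; exact: normr_ge0.
by have := Q_growth x0; lra.
Qed.

Lemma reaches0 lam : reaches lam 0.
Proof. by exists 0 => //; rewrite mul0r th0. Qed.

Lemma reachesW lam j k : (j <= k)%N -> reaches lam k -> reaches lam j.
Proof.
move=> jk [x x0 kx]; exists x => //; apply: le_trans kx.
by rewrite ler_wpM2r ?pi_ge0// ler_nat.
Qed.

Lemma reaches_mono lam mu k : lam <= mu -> reaches lam k -> reaches mu k.
Proof. by move=> lm [x x0 kx]; exists x => //; apply: le_trans kx _; exact: th_mono. Qed.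

Lemma not_reaches lam k x : ~ reaches lam k -> 0 <= x -> th lam x < k%:R * pi.
Proof. by move=> nk x0; rewrite ltNge; apply/negP => h; apply: nk; exists x. Qed.

Lemma reaches_open lam k : reaches lam k -> exists2 d : R, 0 < d &
  forall mu, `|mu - lam| < d -> reaches mu k.
Proof.
move=> [x x0 kx].
(* One unit later the level is exceeded strictly, which survives a small change of [lam]. *)
have x1 : 0 <= x + 1 by lra.
have kx1 : k%:R * pi < th lam (x + 1) by apply: (th_cross x0 _ kx); lra.
have e0 : 0 < th lam (x + 1) - k%:R * pi by rewrite subr_gt0.
have [d d0 Hd] := th_continuous cW cQ lam x1 e0.
exists d => // mu /Hd; rewrite ltr_norml => /andP[h _].
by exists (x + 1) => //; lra.
Qed.

(* Beyond the point where [Q - lam] is positive the angle cannot cross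
   [k pi + pi / 2] upwards. *)
Lemma not_reaches_trap lam k X : 0 <= X -> (forall x, X <= x -> 0 < Q x - lam) ->
  th lam X <= k%:R * pi + pi / 2 -> ~ reaches lam k.+1.
Proof.
move=> X0 q0 kX [x x0].
have := pi_gt0 R => p0; rewrite natpiS => kx.
have [xX|Xx] := leP x X.
  have : k.+1%:R * pi <= th lam X by apply: (th_cross_le x0 xX); rewrite natpiS.
  by rewrite natpiS; lra.
by have := th_trap X0 Xx q0 kX; lra.
Qed.

Lemma reaches_bounded lam : exists k, ~ reaches lam k.
Proof.
have [X X0 HX] := Q_large lam.
have [k /andP[_ kX]] := natpi_floor (th_ge0 cW cQ lam X0).
exists k.+2; apply: (not_reaches_trap X0) => [x Xx|].
  by apply: lt_le_trans (HX _ _ Xx (lexx _)).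
by have := pi_gt0 R; lra.
Qed.

(** For very negative [lam] the function [Q - lam] is positive on the whole half-line, so the angle,
    starting at 0, is trapped below [pi / 2]. *)
Lemma not_reaches1 : exists M : R, forall lam, lam <= M -> ~ reaches lam 1.
Proof.
exists (- C - 1) => lam lamM; apply: (not_reaches_trap (lexx 0)).
  by move=> x x0; have := Q_growth x0; lra.
by rewrite th0 mul0r add0r divr_ge0// pi_ge0.
Qed.

(** So the number of zeros increases by at most one under a small change of [lam]: at a point beyond
    which [Q - mu] is positive for all nearby [mu], the angle is still below [k pi], and the trap at
    [k pi + pi / 2] applies. *)
Lemma not_reaches_near lam k : ~ reaches lam k -> exists2 d : R, 0 < d &
  forall mu, `|mu - lam| < d -> ~ reaches mu k.+1.
Proof.
move=> nk; have [X X0 HX] := Q_large (lam + 1).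
have kX := not_reaches nk X0.
have e0 : 0 < k%:R * pi - th lam X by rewrite subr_gt0.
have [d d0 Hd] := th_continuous cW cQ lam X0 e0.
exists (Num.min d 1) => [|mu]; first by rewrite lt_min d0 ltr01.
rewrite lt_min => /andP[/Hd]; rewrite ltr_norml => /andP[_ h1].
rewrite ltr_norml => /andP[_ h2].
apply: (not_reaches_trap X0) => [x Xx|].
  by apply: (lt_le_trans ltr01); apply: HX => //; lra.
by have := pi_gt0 R; lra.
Qed.

(** If [sin * cos] is nonnegative at some late time, the angle is in the first half of its period
    and stays there by [th_trap]. Waiting one unit makes the upper bound strict, hence stable under
    perturbation. *)
Lemma not_decaying_angle lam X : 0 <= X -> ~ decaying lam ->
  (forall x, X <= x -> 0 < Q x - lam) -> exists x j, X <= x /\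
    j%:R * pi <= th lam x < j%:R * pi + pi / 2.
Proof.
move=> X0 nd q0.
have [a Xa sca] : exists2 a : R, X <= a & 0 <= sin (th lam a) * cos (th lam a).
  apply: contrapT => H; apply: nd; exists X => // x Xx.
  by rewrite ltNge; apply/negP => sc; apply: H; exists x.
have a0 := le_trans X0 Xa.
have [j /andP[ja aj]] := natpi_floor (th_ge0 cW cQ lam a0).
have ha : th lam a <= j%:R * pi + pi / 2.
  rewrite leNgt; apply/negP => h; move: sca.
  by rewrite leNgt (@sincos_lt0 _ j)// h aj.
have aa : a < a + 1 by rewrite ltrDl.
have q1 x : a <= x -> 0 < Q x - lam by move=> ax; apply: q0; exact: le_trans ax.
exists (a + 1), j; split; first by lra.
by rewrite (ltW (th_cross a0 aa ja)) (th_trap a0 aa q1 ha).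
Qed.

(** So the number of zeros can jump only at decaying parameters: elsewhere the angle ends strictly
    inside a trap, and nearby parameters fall into the same trap. *)
Lemma not_reaches_near_not_decaying lam k : ~ reaches lam k -> ~ decaying lam ->
  exists2 d : R, 0 < d & forall mu, `|mu - lam| < d -> ~ reaches mu k.
Proof.
move=> nk nd; have [X X0 HX] := Q_large (lam + 1).
have q0 x : X <= x -> 0 < Q x - lam.
  by move=> Xx; apply: (lt_le_trans ltr01); apply: HX => //; lra.
have [x [j [Xx /andP[jx xj]]]] := not_decaying_angle X0 nd q0.
have x0 := le_trans X0 Xx.
have jk : (j < k)%N.
  rewrite ltnNge; apply/negP => kj; apply: nk.
  by apply: reachesW kj _; exists x.
have e0 : 0 < j%:R * pi + pi / 2 - th lam x by rewrite subr_gt0.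
have [d d0 Hd] := th_continuous cW cQ lam x0 e0.
exists (Num.min d 1) => [|mu]; first by rewrite lt_min d0 ltr01.
rewrite lt_min => /andP[/Hd]; rewrite ltr_norml => /andP[_ h1].
rewrite ltr_norml => /andP[_ h2] /(reachesW jk).
apply: (not_reaches_trap x0) => [y xy|]; last by lra.
apply: (lt_le_trans ltr01); apply: HX; last by lra.
exact: le_trans xy.
Qed.

Lemma der_psi_phi lam x : 0 <= x -> is_derive x 1 (fun y => psi lam y * phi lam y)
  (phi lam x ^+ 2 + (Q x - lam) * psi lam x ^+ 2).
Proof.
move=> x0; apply: (isder_eq (isder_mul (der_psi cW cQ lam x0) (der_phi cW cQ lam x0))).
by ring.
Qed.

Lemma der_wronskian lam mu x : 0 <= x ->
  is_derive x 1 (fun y => psi mu y * phi lam y - psi lam y * phi mu y)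
    ((mu - lam) * (psi lam x * psi mu x)).
Proof.
move=> x0.
have dl := der_psi cW cQ lam x0; have dm := der_psi cW cQ mu x0.
have pl := der_phi cW cQ lam x0; have pm := der_phi cW cQ mu x0.
apply: (isder_eq (isder_add (isder_mul dm pl) (isder_opp (isder_mul dl pm)))).
by ring.
Qed.

Lemma psi_phi_lt0 lam x : sin (th lam x) * cos (th lam x) < 0 ->
  psi lam x * phi lam x < 0.
Proof.
move=> sc; rewrite /psi /phi mulrACA pmulr_rlt0// mulr_gt0//; exact: rho_gt0.
Qed.

(* If both solutions decayed with the same number of zeros, their Wronskian
   would be bounded below by some [w0 > 0] while
   [(psi phi)_lam + (psi phi)_mu], whose derivative dominates the Wronskian,
   stays negative. *)
Lemma decaying_reaches lam mu j : decaying lam -> lam < mu -> reaches lam j ->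
  reaches mu j.+1.
Proof.
move=> [X1 X10 dec] lm [xj xj0 jx]; apply: contrapT => nmu.
have nlam : ~ reaches lam j.+1 by move/(reaches_mono (ltW lm)).
have [X2 X20 HX] := Q_large mu.
pose X := Num.max (Num.max X1 xj) X2.
have XX1 : X1 <= X by rewrite /X !le_max lexx.
have Xxj : xj <= X by rewrite /X !le_max lexx orbT.
have XX2 : X2 <= X by rewrite /X !le_max lexx orbT.
have X0 : 0 <= X by exact: le_trans XX1.
have p0 := pi_gt0 R.
have hl x : X <= x -> j%:R * pi + pi / 2 < th lam x < j.+1%:R * pi.
  move=> Xx; have x0 := le_trans X0 Xx.
  have h1 : th lam x < j.+1%:R * pi by exact: not_reaches.
  rewrite h1 andbT; apply: sincos_lt0_inv; last by apply: dec; exact: le_trans Xx.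
  by rewrite h1 andbT (th_cross_le xj0 _ jx)// (le_trans Xxj).
have hm x : X <= x -> j%:R * pi + pi / 2 < th mu x < j.+1%:R * pi.
  move=> Xx; have x0 := le_trans X0 Xx.
  rewrite (not_reaches nmu x0) andbT.
  by case/andP: (hl x Xx) => /lt_le_trans -> //; apply: th_mono => //; exact: ltW.
pose w x := psi mu x * phi lam x - psi lam x * phi mu x.
have dw x : 0 <= x -> is_derive x 1 w ((mu - lam) * (psi lam x * psi mu x)).
  exact: der_wronskian.
have dw0 x : X <= x -> 0 < (mu - lam) * (psi lam x * psi mu x).
  move=> Xx; rewrite mulr_gt0 ?subr_gt0// /psi mulrACA.
  apply: mulr_gt0; first by rewrite mulr_gt0 ?rho_gt0.
  apply: (@sin_mul_gt0 _ j).
    by case/andP: (hl x Xx) => h1 ->; rewrite andbT; lra.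
  by case/andP: (hm x Xx) => h1 ->; rewrite andbT; lra.
have wX : 0 <= w X.
  (* Both angles lie in the same interval of length [pi / 2], and that for [mu] is the larger, so
     the sine of their difference is nonnegative. *)
  have -> : w X = rho mu X * rho lam X * sin (th mu X - th lam X).
    rewrite sinB /w /psi /phi.
    by move: (rho mu X) (rho lam X) (sin _) (cos _) (sin _) (cos _) => *; ring.
  apply: mulr_ge0; first by rewrite ltW// mulr_gt0// rho_gt0.
  have := th_mono cW cQ (ltW lm) X0.
  have := hl X (lexx _); have := hm X (lexx _).
  rewrite natpiS => /andP[? ?] /andP[? ?] ?.
  by apply: sin_ge0_pi; apply/andP; split; lra.
have w1 : 0 < w (X + 1).
  rewrite -oppr_lt0; apply: (@barrier_lt R (fun x => - w x)
    (fun x => - ((mu - lam) * (psi lam x * psi mu x))) X (X + 1)).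
  - by rewrite ltrDl.
  - by move=> y /andP[Xy _]; apply/isder_opp/dw; exact: le_trans Xy.
  - by move=> y /andP[Xy _] _; rewrite oppr_lt0 dw0.
  - by rewrite oppr_le0.
have wge x : X + 1 <= x -> w (X + 1) <= w x.
  move=> Xx; apply: (nondecreasing_der Xx) => y /andP[Xy _].
    by apply: dw; lra.
  by apply/ltW/dw0; lra.
pose H x := psi lam x * phi lam x + psi mu x * phi mu x.
have Hlt x : X <= x -> H x < 0.
  move=> Xx; rewrite -[0]addr0 ltrD// psi_phi_lt0//; apply: (@sincos_lt0 _ j).
    exact: hl.
  exact: hm.
(* The point where the line through [(X + 1, H (X + 1))] of slope [w (X + 1)] meets 0. Since [H]
   grows at least at that slope, [H y >= 0]. *)
pose y := X + 1 + (- H (X + 1)) / w (X + 1).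
have H1 : H (X + 1) < 0 by apply: Hlt; lra.
have Xy : X + 1 <= y by rewrite /y lerDl divr_ge0 ?oppr_ge0 ?ltW.
have : H (X + 1) - w (X + 1) * (X + 1) <= H y - w (X + 1) * y.
  apply: (@nondecreasing_der R (fun x => H x - w (X + 1) * x)
    (fun x => (phi lam x ^+ 2 + (Q x - lam) * psi lam x ^+ 2) +
      (phi mu x ^+ 2 + (Q x - mu) * psi mu x ^+ 2) -
      (0 * x + w (X + 1) * 1)) _ _ Xy).
    move=> x /andP[Xx _]; have x0 : 0 <= x by lra.
    apply: isder_add; last by apply: isder_opp; der.
    exact: isder_add (der_psi_phi lam x0) (der_psi_phi mu x0).
  move=> x /andP[Xx _].
  have ql : 1 <= Q x - lam by apply: HX; lra.
  have qm : 1 <= Q x - mu by apply: HX; lra.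
  have := wge x Xx; rewrite [leRHS]/w.
  set a := psi lam x; set b := phi lam x; set c := psi mu x; set d := phi mu x.
  (* The derivative of [H] is at least [a^2 + b^2 + c^2 + d^2], which by
     [(c - b)^2 + (a + d)^2 >= 0] is at least [2 (c b - a d)], twice the Wronskian. *)
  have a2 : a ^+ 2 <= (Q x - lam) * a ^+ 2 by rewrite ler_peMl// sqr_ge0.
  have c2 : c ^+ 2 <= (Q x - mu) * c ^+ 2 by rewrite ler_peMl// sqr_ge0.
  have h1 := sqr_ge0 (c - b); have h2 := sqr_ge0 (a + d).
  by move: h1 h2 a2 c2 w1; lra.
have -> : w (X + 1) * y = w (X + 1) * (X + 1) - H (X + 1).
  by rewrite /y [LHS]mulrDr; congr (_ + _); rewrite mulrC divfK ?gt_eqF.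
by have := Hlt y ltac:(lra); lra.
Qed.

Lemma zero_count_ex lam : exists n, forall k, reaches lam k <-> (k <= n)%N.
Proof.
have ex : exists n, `[< ~ reaches lam n.+1 >].
  have [[|k] nk] := reaches_bounded lam; first by case: nk; exact: reaches0.
  by exists k; apply/asboolP.
exists (ex_minn ex); case: ex_minnP => n /asboolP nn min_n k; split => [kr|kn].
  by rewrite leqNgt; apply/negP => nk; apply: nn; exact: reachesW kr.
case: n nn min_n kn => [|n] nn min_n kn.
  by move: kn; rewrite leqn0 => /eqP ->; exact: reaches0.
apply: reachesW kn _; apply: contrapT => H.
by have := min_n n (asboolT H); rewrite ltnn.
Qed.

Definition zero_count lam : nat := sval (cid (zero_count_ex lam)).

Lemma reachesP lam k : reaches lam k <-> (k <= zero_count lam)%N.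
Proof. by rewrite /zero_count; case: cid => n /= H; exact: H. Qed.

Lemma zero_count_decaying lam mu : decaying lam -> lam < mu ->
  (zero_count lam < zero_count mu)%N.
Proof.
move=> dl lm; apply/reachesP; apply: (decaying_reaches dl lm).
by apply/reachesP.
Qed.

(** Let [s] be the infimum of the parameters that reach level [k.+1]. By openness [s] does not reach
    it. If [s] were not decaying, or did not reach level [k], a whole neighbourhood of [s] would
    miss level [k.+1], though such parameters accumulate at [s]. *)
Lemma decaying_of_lt_zero_count lam k : (k < zero_count lam)%N ->
  exists mu, [/\ mu < lam, decaying mu & zero_count mu = k].
Proof.
move=> /reachesP kl; have [M HM] := not_reaches1.
pose S := [set mu | reaches mu k.+1].
have lbM : lbound S M.
  move=> mu Smu; rewrite leNgt; apply/negP => /ltW /HM; apply.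
  exact: reachesW Smu.
have iS : has_inf S by split; [exists lam|exists M].
pose s := inf S.
have sS mu : S mu -> s <= mu by move=> Smu; apply: inf_lbound => //; exists M.
have near_s d : 0 < d -> exists2 mu, reaches mu k.+1 & `|mu - s| < d.
  move=> d0; have [mu Smu mus] := inf_adherent d0 iS.
  by exists mu => //; rewrite ger0_norm ?subr_ge0 ?sS// ltrBlDl.
have ns : ~ reaches s k.+1.
  move=> /reaches_open[d d0 Hd].
  have : S (s - d / 2).
    by apply: Hd; rewrite addrAC subrr add0r normrN gtr0_norm ?divr_gt0//; lra.
  by move/sS; lra.
exists s; split.
- rewrite lt_neqAle sS// andbT; apply/eqP => E.
  by move: ns; rewrite E.
- apply: contrapT => nd.
  have [d d0 Hd] := not_reaches_near_not_decaying ns nd.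
  by have [mu Smu /Hd] := near_s d d0.
- apply/eqP; rewrite eqn_leq; apply/andP; split.
    by rewrite leqNgt; apply/negP => /reachesP.
  apply/reachesP; apply: contrapT => nk.
  have [d d0 Hd] := not_reaches_near nk.
  by have [mu Smu /Hd] := near_s d d0.
Qed.

End oscillation.

(** * Riccati solutions and their blowups *)

Section one_sided.
Context {R : realType}.
Implicit Types (P : R -> Prop) (f : R -> R) (z : R).

Lemma near_rightP P z : (\forall x \near z^'+, P x) <->
  exists2 e : R, 0 < e & forall x, z < x -> x < z + e -> P x.
Proof.
split=> [/nbhs_ballP[e /= e0 He]|[e e0 He]].
  exists e => // x zx xe; apply: He => //.
  by rewrite /ball /= distrC ger0_norm ?subr_ge0 ?(ltW zx)// ltrBlDl.
apply/nbhs_ballP; exists e => //= x; rewrite /ball /= => zxe zx.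
apply: He => //; move: zxe.
by rewrite distrC ger0_norm ?subr_ge0 ?(ltW zx)// ltrBlDl.
Qed.

Lemma near_leftP P z : (\forall x \near z^'-, P x) <->
  exists2 e : R, 0 < e & forall x, x < z -> z - e < x -> P x.
Proof.
split=> [/nbhs_ballP[e /= e0 He]|[e e0 He]].
  exists e => // x zx xe; apply: He => //.
  by rewrite /ball /= ger0_norm ?subr_ge0 ?(ltW zx)// ltrBlDl -ltrBlDr.
apply/nbhs_ballP; exists e => //= x; rewrite /ball /= => zxe zx.
apply: He => //; move: zxe.
by rewrite ger0_norm ?subr_ge0 ?(ltW zx)// ltrBlDl -ltrBlDr.
Qed.

Lemma cvg_right_pinftyP f z : f x @[x --> z^'+] --> +oo <->
  forall A : R, exists2 e : R, 0 < e & forall x, z < x -> x < z + e -> A < f x.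
Proof.
split=> [/cvgryPgt H A|H]; first by have /near_rightP := H A.
by apply/cvgryPgt => A; apply/near_rightP.
Qed.

Lemma cvg_left_ninftyP f z : f x @[x --> z^'-] --> -oo <->
  forall A : R, exists2 e : R, 0 < e & forall x, x < z -> z - e < x -> f x < A.
Proof.
split=> [/cvgrNyPlt H A|H]; first by have /near_leftP := H A.
by apply/cvgrNyPlt => A; apply/near_leftP.
Qed.

End one_sided.

Lemma finite_set_isolated {R : realType} (A : set R) (x : R) : finite_set A ->
  exists2 e : R, 0 < e & forall y, A y -> y != x -> e <= `|y - x|.
Proof.
move=> fA.
have cA : closed (A `\ x).
  apply: (proj1 accessible_finite_set_closed); last first.
    by apply: (sub_finite_set _ fA) => y [].
  by apply: hausdorff_accessible; exact: Rhausdorff.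
have : nbhs x (~` (A `\ x)).
  by apply: open_nbhs_nbhs; split; [exact: closed_openC|case=> _; apply].
move=> /nbhs_ballP[e /= e0 He]; exists e => // y Ay yx.
rewrite leNgt; apply/negP => ye; apply: (He y).
  by rewrite /ball /= distrC.
by split=> // E; rewrite E eqxx in yx.
Qed.

Lemma counting_card {T : choiceType} {R : realType} (A : set T) n :
  (A #= `I_n)%card -> (counting A : \bar R) = n%:R%:E.
Proof.
move=> An; rewrite /counting asboolT; first by rewrite (card_fset_set An).
by apply/finite_setP; exists n.
Qed.

Section prufer_riccati.
Context {R : realType}.
Variables W Q S b : R -> R.
Hypothesis cW : continuous W.
Hypothesis cQ : continuous Q.
Variable beta : R.
Hypothesis bWS : forall x : R, 0 <= x -> 2 / Num.sqrt beta * b x = W x + S x.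
Hypothesis dS : forall x : R, 0 <= x -> is_derive x 1 S (Q x - x + W x ^+ 2).
Implicit Types (lam mu x y t a e X z : R) (k n : nat) (p : R -> R).

Local Notation th := (th cW cQ).

Definition zeros lam := [set z : R | 0 < z /\ sin (th lam z) = 0].

Lemma th_zero lam z : zeros lam z -> exists2 k, (0 < k)%N & th lam z = k%:R * pi.
Proof.
move=> [z0 sz].
have [k /andP[k1 k2]] := natpi_floor (ltW (th_gt0 cW cQ lam z0)).
move: k1; rewrite le_eqVlt => /predU1P[E|k1]; last first.
  have := @sin_mul_gt0 R k (th lam z) (th lam z).
  by rewrite k1 k2 sz mul0r ltxx => /(_ isT isT).
exists k => //; rewrite lt0n; apply/eqP => k0.
by have := th_gt0 cW cQ lam z0; rewrite -E k0 mul0r ltxx.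
Qed.

Lemma th_within_continuous lam a y : 0 <= a -> {within `[a, y], continuous (th lam)}.
Proof.
move=> a0; apply: (@within_der_continuous R _ (fun x => prufer_fun W Q lam x (th lam x))).
by move=> x /andP[ax _]; apply: der_th; exact: le_trans ax.
Qed.

Lemma reaches_eq lam k : reaches cW cQ lam k -> exists2 z, 0 <= z & th lam z = k%:R * pi.
Proof.
move=> [x x0 kx]; have [||z] := @IVT R (th lam) 0 x (k%:R * pi) x0.
- exact: th_within_continuous.
- rewrite th0 ge_min le_max kx orbT andbT mulr_ge0 ?pi_ge0//.
by rewrite in_itv /= => /andP[z0 _] zk; exists z.
Qed.

Lemma th_natpi_inj lam k x y : 0 <= x -> 0 <= y -> th lam x = k%:R * pi ->
  th lam y = k%:R * pi -> x = y.
Proof.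
move=> x0 y0 xk yk; apply/eqP; rewrite eq_le !leNgt.
apply/andP; split; apply/negP => h.
  by have := @th_cross R W Q cW cQ lam k y x y0 h; rewrite yk xk lexx ltxx => /(_ isT).
by have := @th_cross R W Q cW cQ lam k x y x0 h; rewrite yk xk lexx ltxx => /(_ isT).
Qed.

Lemma card_zeros lam n : (forall k, reaches cW cQ lam k <-> (k <= n)%N) ->
  (zeros lam #= `I_n)%card.
Proof.
move=> Hn; have p0 := pi_gt0 R.
(* Level 0 is attained at [x = 0], which is not a zero in []0, +oo[]; hence the shift to level
   [k.+1]. *)
have ex k : exists z, (k < n)%N -> 0 <= z /\ th lam z = k.+1%:R * pi.
  have [kn|kn] := boolP (k < n)%N; last by exists 0.
  by have /Hn/reaches_eq[z z0 zk] := kn; exists z.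
pose f k := sval (cid (ex k)).
have fE k : (k < n)%N -> 0 <= f k /\ th lam (f k) = k.+1%:R * pi.
  by rewrite /f; case: cid.
have -> : zeros lam = f @` `I_n.
  apply/seteqP; split=> [z zz|_ [k /= kn <-]].
    have [[//|k] _ zk] := th_zero zz; have z0 : 0 <= z by case: zz => /ltW.
    have kn : (k < n)%N by apply/Hn; exists z => //; rewrite zk.
    exists k => //=; have [f0 fk] := fE _ kn.
    exact: th_natpi_inj fk zk.
  have [f0 fk] := fE _ kn; split; last by rewrite fk sin_natpi.
  rewrite lt_neqAle f0 andbT; apply/eqP => E.
  by move: fk; rewrite -E th0 => /eqP; rewrite eq_sym mulf_eq0 pnatr_eq0 /= gt_eqF.
apply: inj_card_eq => i j; rewrite !inE /= => iN jN E.
have [_ fi] := fE _ iN; have [_ fj] := fE _ jN.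
move: fi; rewrite E fj => /(mulIf (lt0r_neq0 p0))/eqP.
by rewrite eqr_nat eqSS => /eqP.
Qed.

Lemma finite_zeros_segment lam x : finite_set (zeros lam `&` `[0, x]).
Proof.
have [x0|x0] := leP 0 x; last first.
  apply: (sub_finite_set _ (finite_set0 R)) => z [_]; rewrite /= in_itv /=.
  by move=> /andP[z0 zx]; have := lt_le_trans x0 z0; rewrite ltNge zx.
have [K /andP[_ HK]] := natpi_floor (th_ge0 cW cQ lam x0).
pose f z := Num.truncn (th lam z / pi).
have p0 := pi_gt0 R.
have fE z k : th lam z = k%:R * pi -> f z = k.
  by move=> zk; rewrite /f zk mulfK ?gt_eqF// natrK.
have inj : {in zeros lam `&` `[0, x] &, injective f}.
  move=> y z; rewrite !inE => -[Zy _] [Zz _].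
  have [k _ yk] := th_zero Zy; have [l _ zl] := th_zero Zz.
  rewrite (fE _ _ yk) (fE _ _ zl) => kl; rewrite -kl in zl.
  by apply: th_natpi_inj yk zl; apply: ltW; [case: Zy|case: Zz].
apply/finite_set_leP; exists K.+1; have := inj_card_eq inj.
rewrite card_eq_sym => /card_le_eql ->; apply: subset_card_le => _ [z [Zz zx] <-] /=.
have [k _ zk] := th_zero Zz; rewrite (fE _ _ zk).
move: zx; rewrite /= in_itv /= => /andP[z0 zx].
have := @th_cross_le R W Q cW cQ lam k z x z0 zx; rewrite zk lexx => /(_ isT).
move=> /le_lt_trans /(_ HK); by rewrite ltr_pM2r// ltr_nat.
Qed.

(** This is [psi' / psi], because [psi' = W psi + phi]. At a zero of [psi] the division by 0 gives
    an arbitrary value. *)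
Definition riccati lam x : R := cos (th lam x) / sin (th lam x) + W x.

Lemma der_sincos_th lam z : 0 <= z -> sin (th lam z) = 0 ->
  is_derive z 1 (fun x => sin (th lam x) * cos (th lam x)) 1.
Proof.
move=> z0 sz; have dt := der_th cW cQ lam z0.
apply: (isder_eq (isder_mul (isder_sin dt) (isder_cos dt))).
by rewrite /prufer_fun sz cos2sin2 sz; have := cos2Dsin2 (th lam z); rewrite sz => h; ring: h.
Qed.

(* [cot = cos^2 / (sin cos)], and [sin cos] vanishes at [z] with derivative 1. *)
Lemma riccati_near_zero lam z A : 0 <= z -> sin (th lam z) = 0 ->
  exists2 e, 0 < e &
  forall x, `|x - z| < e -> x != z -> A < Num.sg (x - z) * riccati lam x.
Proof.
move=> z0 sz; have dt := der_th cW cQ lam z0.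
have [e1 e10 H1] := isder_gt0 (der_sincos_th z0 sz) ltr01.
have cW1 : exists2 e : R, 0 < e & forall x, `|x - z| < e -> `|W x| < `|W z| + 1.
  have cn : {for z, continuous (fun x => `|W x|)} by apply: cvg_norm; exact: cW.
  by apply: (continuous_lt cn); rewrite ltrDl.
have [e2 e20 H2] := cW1.
(* The part [|W z| + 1] pays for the summand [W x] with [x] near [z]. *)
pose A' := `|A| + `|W z| + 1.
have A'0 : 0 < A' by have := normr_ge0 A; have := normr_ge0 (W z); rewrite /A'; lra.
have c1 : cos (th lam z) ^+ 2 = 1 by rewrite cos2sin2 sz expr0n subr0.
have [e3 e30 H3] : exists2 e : R, 0 < e & forall x, `|x - z| < e ->
    0 < cos (th lam x) ^+ 2 - A' * `|sin (th lam x) * cos (th lam x)|.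
  apply: (@continuous_gt R (fun x => cos (th lam x) ^+ 2 -
    A' * `|sin (th lam x) * cos (th lam x)|)); last by rewrite c1 sz mul0r normr0 mulr0 subr0.
  have ct := isder_continuous dt.
  have cs := isder_continuous (isder_sin dt); have cc := isder_continuous (isder_cos dt).
  apply: cvgB; first exact: continuous_sqr.
  apply: cvgM; first exact: cvg_cst.
  by apply: cvg_norm; exact: (cvgM cs cc).
exists (Num.min e1 (Num.min e2 e3)) => [|x]; first by rewrite !lt_min e10 e20 e30.
rewrite !lt_min => /andP[h1 /andP[/H2 h2 /H3 h3]] xz.
have := H1 (x - z); rewrite subr_eq0 => /(_ xz h1).
rewrite sz mul0r subr0 subrKC; set s := sin _ in h3 *; set c := cos _ in h3 *.
move=> h4; have xz0 : x - z != 0 by rewrite subr_eq0.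
have sg1 : Num.sg (x - z) * (s * c) = `|s * c|.
  have E : Num.sg (x - z) * (s * c) = `|x - z| * ((x - z)^-1 * (s * c)).
    by rewrite normrEsg -[RHS]mulrA mulVKf.
  have : 0 <= Num.sg (x - z) * (s * c) by rewrite E mulr_ge0// ltW.
  by move=> /ger0_norm <-; rewrite normrM normr_sg xz0 mul1r.
have sc0 : s * c != 0 by apply: contraTneq h4 => ->; rewrite mulr0 ltxx.
have nsc : 0 < `|s * c| by rewrite normr_gt0.
have s0 : s != 0 by apply: contraNneq sc0 => ->; rewrite mul0r.
have c0 : c != 0 by apply: contraNneq sc0 => ->; rewrite mulr0.
rewrite /riccati -/s -/c mulrDr.
have -> : Num.sg (x - z) * (c / s) = c ^+ 2 / `|s * c|.
  rewrite -sg1 invfM invr_sg [RHS]mulrCA; congr (_ * _).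
  by field; rewrite s0 c0.
have hA : A' < c ^+ 2 / `|s * c| by rewrite ltr_pdivlMr// -subr_gt0.
have hW : - (`|W z| + 1) < Num.sg (x - z) * W x.
  rewrite ltrNl; apply: le_lt_trans h2; rewrite -mulNr (le_trans (ler_norm _))//.
  by rewrite normrM normrN normr_sg xz0 mul1r.
by have := ler_norm A; move: hA hW; rewrite /A'; lra.
Qed.

Lemma riccati_right lam z : 0 <= z -> sin (th lam z) = 0 ->
  riccati lam x @[x --> z^'+] --> +oo.
Proof.
move=> z0 sz; apply/cvg_right_pinftyP => A.
have [e e0 He] := riccati_near_zero A z0 sz; exists e => // x zx xe.
have := He x; rewrite gtr0_norm ?subr_gt0// ltrBlDl => /(_ xe).
by rewrite gt_eqF// gtr0_sg ?subr_gt0// mul1r => /(_ isT).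
Qed.

Lemma riccati_left lam z : 0 <= z -> sin (th lam z) = 0 ->
  riccati lam x @[x --> z^'-] --> -oo.
Proof.
move=> z0 sz; apply/cvg_left_ninftyP => A.
have [e e0 He] := riccati_near_zero (- A) z0 sz; exists e => // x zx xe.
have := He x; rewrite ltr0_norm ?subr_lt0// opprB ltrBlDr -ltrBlDl => /(_ xe).
by rewrite lt_eqF// ltr0_sg ?subr_lt0// mulN1r ltrN2 => /(_ isT).
Qed.

Lemma der_cot_th lam x : 0 <= x -> sin (th lam x) != 0 ->
  is_derive x 1 (fun y => cos (th lam y) / sin (th lam y))
    (Q x - lam - 2 * W x * (cos (th lam x) / sin (th lam x)) -
     (cos (th lam x) / sin (th lam x)) ^+ 2).
Proof.
move=> x0 sx; have dt := der_th cW cQ lam x0.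
apply: (isder_eq (isder_mul (isder_cos dt) (isder_inv sx (isder_sin dt)))).
have := cos2Dsin2 (th lam x); rewrite /prufer_fun.
set s := sin _ in sx *; set c := cos _ => E.
have -> : - s * (c ^+ 2 + 2 * W x * (s * c) - (Q x - lam) * s ^+ 2) / s +
  c * (- (c * (c ^+ 2 + 2 * W x * (s * c) - (Q x - lam) * s ^+ 2)) / s ^+ 2) =
  (c ^+ 2 + s ^+ 2) * (Q x - lam - 2 * W x * (c / s) - (c / s) ^+ 2) by field.
by rewrite E mul1r.
Qed.

Lemma riccati_continuous lam x : 0 <= x -> sin (th lam x) != 0 ->
  {for x, continuous (riccati lam)}.
Proof.
move=> x0 sx; apply: cvgD; last exact: cW.
exact: isder_continuous (der_cot_th x0 sx).
Qed.

Lemma blowups_riccati lam : blowups (riccati lam) = zeros lam.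
Proof.
apply/seteqP; split=> z [z0 hz]; split => //; last exact: riccati_left (ltW z0) hz.
apply/eqP; apply: contrapT => /negP sz.
have cr := riccati_continuous (ltW z0) sz.
have lt1 : riccati lam z - 1 < riccati lam z by lra.
have [e1 e10 H1] := continuous_gt cr lt1.
have /cvg_left_ninftyP /(_ (riccati lam z - 1))[e2 e20 H2] := hz.
pose e := Num.min e1 e2; have e0 : 0 < e by rewrite lt_min e10 e20.
have ee1 : e <= e1 by rewrite ge_min lexx.
have ee2 : e <= e2 by rewrite ge_min lexx orbT.
have := H1 (z - e / 2); have := H2 (z - e / 2).
have -> : z - e / 2 - z = - (e / 2) by ring.
rewrite normrN gtr0_norm ?divr_gt0// => h2 h1.
by have := h1 ltac:(lra); have := h2 ltac:(lra) ltac:(lra); lra.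
Qed.

Lemma FTC2_continuous (F f : R -> R) a c : a <= c ->
  (forall x, a <= x <= c -> is_derive x 1 F (f x)) ->
  {within `[a, c], continuous f} ->
  \int[lebesgue_measure]_(y in `[a, c]) f y = F c - F a.
Proof.
rewrite le_eqVlt => /predU1P[<- _ _|ac dF cf].
  by rewrite set_itv1 Rintegral_set1 subrr.
rewrite /Rintegral (continuous_FTC2 (F := F) ac cf) //.
- split.
  + move=> x; rewrite in_itv /= => /andP[ax xc].
    by have [] := dF x ltac:(by rewrite !ltW).
  + apply: cvg_at_right_filter; apply: isder_continuous (dF a _).
    by rewrite lexx ltW.
  + apply: cvg_at_left_filter; apply: isder_continuous (dF c _).
    by rewrite lexx ltW.
- move=> x; rewrite in_itv /= => /andP[ax xc].
  have dx : is_derive x 1 F (f x) by apply: dF; rewrite !ltW.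
  by rewrite derive1E; apply: derive_val.
Qed.

Lemma riccati_solution_riccati lam : riccati_solution beta b lam (riccati lam).
Proof.
have s0 : sin (th lam 0) = 0 by rewrite th0 sin0.
rewrite /riccati_solution blowups_riccati; split.
- exact: riccati_right s0.
- move=> s x s_gt0 sx noz.
  have nz y : s <= y <= x -> sin (th lam y) != 0.
    move=> syx; apply/eqP => sy; suff : (`[s, x] `&` zeros lam) y by rewrite noz.
    split; first by rewrite /= in_itv.
    by split => //; case/andP: syx => /(lt_le_trans s_gt0).
  have cp : {within `[s, x], continuous (fun y => y - lam - riccati lam y ^+ 2)}.
    apply: continuous_in_subspaceT => y; rewrite inE /= in_itv /= => syx.
    have y0 : 0 <= y by case/andP: syx => /(le_trans (ltW s_gt0)).
    apply: cvgB; first by apply: cvgB; [exact: cvg_id|exact: cvg_cst].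
    by apply: continuous_sqr; apply: riccati_continuous => //; exact: nz.
  split; first exact: integrable_segment.
  (* [cot - S] is the Riccati function minus the noise [W + S]; it is differentiable although
     neither of the two need be. *)
  have dF y : s <= y <= x -> is_derive y 1
      (fun y => cos (th lam y) / sin (th lam y) - S y) (y - lam - riccati lam y ^+ 2).
    move=> syx; have y0 : 0 <= y by case/andP: syx => /(le_trans (ltW s_gt0)).
    apply: (isder_eq (isder_add (der_cot_th y0 (nz y syx)) (isder_opp (dS y0)))).
    by rewrite /riccati; ring.
  rewrite (FTC2_continuous sx dF cp) mulrBr !bWS ?(le_trans _ sx) ?(ltW s_gt0)// /riccati.
  by ring.
- by move=> z [z0 sz]; exact: riccati_right (ltW z0) sz.
- by move=> x; exact: finite_zeros_segment.
Qed.

(** * Blowups of an arbitrary Riccati solution *)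

Section uniqueness.
Variables (lam : R) (p : R -> R).
Hypothesis p_sol : riccati_solution beta b lam p.

Lemma blowups_isolated x : 0 <= x -> exists2 e : R, 0 < e &
  forall y, y != x -> `|y - x| < e -> ~ blowups p y.
Proof.
move=> x0; have [_ _ _ fin] := p_sol.
have [e e0 He] := finite_set_isolated x (fin (x + 1)).
exists (Num.min e 1) => [|y yx]; first by rewrite lt_min e0 ltr01.
rewrite lt_min => /andP[ye y1] py.
have /He/(_ yx) : (blowups p `&` `[0, x + 1]) y.
  split=> //; rewrite /= in_itv /= (ltW (proj1 py)) /= -lerBlDl.
  exact: le_trans (ler_norm _) (ltW y1).
by rewrite leNgt ye.
Qed.

(** A bootstrap on a window without blowups: the integral of an integrable function is continuous,
    so the integrated equation makes [p] continuous; then the integrand is continuous and the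
    integral is differentiable. Subtracting [W] leaves only the differentiable part [S] of the
    noise. *)
Lemma der_riccati_solution x : 0 < x -> ~ blowups p x ->
  is_derive x 1 (fun y => p y - W y)
    (Q x - lam - 2 * W x * (p x - W x) - (p x - W x) ^+ 2).
Proof.
move=> x0 nx; have [_ int_eq _ _] := p_sol.
have [e e0 He] := blowups_isolated (ltW x0).
pose d := Num.min e x; have d0 : 0 < d by rewrite lt_min e0 x0.
have de : d <= e by rewrite ge_min lexx.
have dx : d <= x by rewrite ge_min lexx orbT.
pose s := x - d / 2; pose u := x + d / 2.
have s0 : 0 < s by rewrite /s; lra.
have su : s < u by rewrite /s /u; lra.
have sx : s < x by rewrite /s; lra.
have xu : x < u by rewrite /u; lra.
have noz t : t <= u -> `[s, t] `&` blowups p = set0.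
  move=> tu; apply/seteqP; split => // y [/=]; rewrite in_itv /= => /andP[sy yt].
  have [->//|yx] := eqVneq y x; apply: He => //.
  have yu := le_trans yt tu; rewrite ltr_norml; move: sy yu; rewrite /s /u => ? ?.
  by apply/andP; split; lra.
pose g y := y - lam - p y ^+ 2.
pose I t := \int[lebesgue_measure]_(y in `[s, t]) g y.
have [intg _] := int_eq s u s0 (ltW su) (noz u (lexx _)).
have cI : {for x, continuous I}.
  have := parameterized_integral_continuous (ltW su) intg.
  by move/(within_continuous_continuous su); apply; rewrite in_itv /= sx xu.
pose c := p s - (W s + S s).
have pE t : s <= t -> t <= u -> p t = c + I t + S t + W t.
  move=> st tu; have [_] := int_eq s t s0 st (noz t tu).
  have t0 : 0 <= t := le_trans (ltW s0) st.
  rewrite mulrBr !bWS ?(ltW s0)// => E.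
  have -> : p t = p s + (p t - p s) by ring.
  by rewrite E /c /I /g; ring.
have near_su (P : R -> Prop) : (forall t, s <= t -> t <= u -> P t) -> \forall t \near x, P t.
  move=> H; apply/nbhs_ballP; exists (d / 2) => /=; first by rewrite divr_gt0.
  move=> t; rewrite /ball /= ltr_norml => /andP[h1 h2].
  by apply: H; rewrite /s /u; lra.
have cp : {for x, continuous p}.
  have -> : {for x, continuous p} = (p @ x --> p x) by [].
  rewrite (pE x) ?(ltW sx) ?(ltW xu)//.
  have : (fun t => c + I t + S t + W t) @ x --> c + I x + S x + W x.
    apply: cvgD; last exact: cW.
    apply: cvgD; last exact: isder_continuous (dS (ltW x0)).
    by apply: cvgD; [exact: cvg_cst|exact: cI].
  apply: cvg_trans; apply: near_eq_cvg.
  by apply: near_su => t st tu; rewrite /= (pE t).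
have cg : {for x, continuous g}.
  apply: cvgB; last exact: continuous_sqr.
  by apply: cvgB; [exact: cvg_id|exact: cvg_cst].
have [d1 d2] := continuous_FTC1_closed xu intg sx cg.
have dI : is_derive x 1 I (g x) by apply: (DeriveDef d1); rewrite -derive1E; exact: d2.
apply: (@isder_near _ _ (fun t => c + I t + S t)).
  by apply: near_su => t st tu; rewrite pE// addrK.
apply: (isder_eq (isder_add (isder_add (isder_cst x c) dI) (dS (ltW x0)))).
by rewrite /g; ring.
Qed.

(* [sin^2] of the difference between the Pruefer angle of [p], for which
   [cot = p - W], and [th lam]; it extends continuously across the blowups. *)
Definition angle_defect x : R :=
  if x <= 0 then 0 else
  if `[< blowups p x >] then sin (th lam x) ^+ 2 else
  (sin (th lam x) * (p x - W x) - cos (th lam x)) ^+ 2 * (1 + (p x - W x) ^+ 2)^-1.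

(** The logarithmic derivative of [angle_defect] between blowups. Its numerator is quadratic in [r],
    like its denominator, so it stays bounded as [r] becomes infinite. *)
Definition defect_rate x : R :=
  let s := sin (th lam x) in let c := cos (th lam x) in let r := p x - W x in
  2 * (c * r + s) * (- (1 + (Q x - lam)) * (s * r + c) + 2 * W x * (c * r - s)) /
  (1 + r ^+ 2).

Lemma angle_defect_ge0 x : 0 <= angle_defect x.
Proof.
rewrite /angle_defect; case: ifP => // _; case: ifP => _; first exact: sqr_ge0.
by rewrite mulr_ge0 ?sqr_ge0// invr_ge0 addr_ge0 ?sqr_ge0.
Qed.

Lemma der_angle_defect x : 0 < x -> ~ blowups p x ->
  is_derive x 1 angle_defect (angle_defect x * defect_rate x).
Proof.
move=> x0 nx; have [e e0 He] := blowups_isolated (ltW x0).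
have E1 : angle_defect x = (sin (th lam x) * (p x - W x) - cos (th lam x)) ^+ 2 *
    (1 + (p x - W x) ^+ 2)^-1.
  by rewrite /angle_defect leNgt x0 /= asboolF.
rewrite E1; apply: (@isder_near _ _ (fun x => (sin (th lam x) * (p x - W x) - cos (th lam x)) ^+ 2 *
    (1 + (p x - W x) ^+ 2)^-1)).
  apply/nbhs_ballP; exists (Num.min e x) => /=; first by rewrite lt_min e0 x0.
  move=> y; rewrite /ball /= distrC lt_min => /andP[ye yx].
  have y0 : 0 < y by move: yx; rewrite ltr_norml => /andP[]; lra.
  rewrite /angle_defect leNgt y0 /= asboolF//.
  by have [->//|yx'] := eqVneq y x; exact: He.
have dr := der_riccati_solution x0 nx; have dt := der_th cW cQ lam (ltW x0).
have D0 : 0 < 1 + (p x - W x) ^+ 2 by rewrite ltr_pwDl// sqr_ge0.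
have dD := isder_inv (f := fun y => 1 + (p y - W y) ^+ 2) (lt0r_neq0 D0) (isder_add (isder_cst x 1) (isder_sqr dr)).
have du := isder_sqr (isder_add (isder_mul (isder_sin dt) dr) (isder_opp (isder_cos dt))).
apply: (isder_eq (isder_mul du dD)).
move: D0; rewrite /defect_rate /prufer_fun /=; have := cos2Dsin2 (th lam x).
set s := sin _; set c := cos _; set r := p x - W x; set q := Q x - lam.
clearbody s c r q; move: (W x) => w E D0.
(* The left side is [1 + r^2] times the difference between the speed of [th lam] and that of the
   angle with cotangent [r]. Both angles obey the same equation, so it vanishes where they agree,
   that is where [s r = c]; the identity extracts this factor using [c^2 + s^2 = 1]. *)
have key : (c ^+ 2 + 2 * w * (s * c) - q * s ^+ 2) * (1 + r ^+ 2) + (q - 2 * w * r - r ^+ 2)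
   = (s * r - c) * (- (1 + q) * (s * r + c) + 2 * w * (c * r - s)).
  have -> : (c ^+ 2 + 2 * w * (s * c) - q * s ^+ 2) * (1 + r ^+ 2) + (q - 2 * w * r - r ^+ 2)
   = (s * r - c) * (- (1 + q) * (s * r + c) + 2 * w * (c * r - s)) +
     (c ^+ 2 + s ^+ 2 - 1) * (r ^+ 2 - q + 2 * w * r) by ring.
  by rewrite E subrr mul0r addr0.
have D1 : 1 + r ^+ 2 != 0 by exact: lt0r_neq0.
transitivity (2 * (s * r - c) * (c * r + s) *
  ((c ^+ 2 + 2 * w * (s * c) - q * s ^+ 2) * (1 + r ^+ 2) + (q - 2 * w * r - r ^+ 2)) /
  (1 + r ^+ 2) ^+ 2); first by field.
by rewrite key; field.
Qed.

(** Each linear factor is a coordinate of the image of [(r, 1)] under an orthogonal matrix, so its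
    square is at most [1 + r^2]. The resulting bound is free of [p], hence uniform up to the
    blowups. *)
Lemma defect_rate_le x : defect_rate x <= 2 * (`|1 + (Q x - lam)| + 2 * `|W x|).
Proof.
rewrite /defect_rate /=; have := cos2Dsin2 (th lam x).
set s := sin _; set c := cos _; set r := p x - W x; set q := Q x - lam.
clearbody s c r q; move: (W x) => w E.
have D0 : 0 < 1 + r ^+ 2 by rewrite ltr_pwDl// sqr_ge0.
rewrite ler_pdivrMr//.
have H1 : (c * r + s) ^+ 2 + (s * r - c) ^+ 2 = 1 + r ^+ 2.
  have -> : (c * r + s) ^+ 2 + (s * r - c) ^+ 2 = (c ^+ 2 + s ^+ 2) * (1 + r ^+ 2) by ring.
  by rewrite E mul1r.
have H2 : (s * r + c) ^+ 2 + (c * r - s) ^+ 2 = 1 + r ^+ 2.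
  have -> : (s * r + c) ^+ 2 + (c * r - s) ^+ 2 = (c ^+ 2 + s ^+ 2) * (1 + r ^+ 2) by ring.
  by rewrite E mul1r.
have prod_le a z : a ^+ 2 <= 1 + r ^+ 2 -> z ^+ 2 <= 1 + r ^+ 2 -> `|a * z| <= 1 + r ^+ 2.
  move=> ha hz; have := sqr_ge0 (`|a| - `|z|); rewrite normrM.
  by rewrite sqrrB !real_normK ?num_real//; lra.
have b1 : (c * r + s) ^+ 2 <= 1 + r ^+ 2 by rewrite -H1 lerDl sqr_ge0.
have b2 : (s * r + c) ^+ 2 <= 1 + r ^+ 2 by rewrite -H2 lerDl sqr_ge0.
have b3 : (c * r - s) ^+ 2 <= 1 + r ^+ 2 by rewrite -H2 lerDr sqr_ge0.
have h1 : - (1 + q) * ((c * r + s) * (s * r + c)) <= `|1 + q| * (1 + r ^+ 2).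
  by apply: le_trans (ler_norm _) _; rewrite normrM normrN ler_wpM2l ?prod_le.
have h2 : w * ((c * r + s) * (c * r - s)) <= `|w| * (1 + r ^+ 2).
  by apply: le_trans (ler_norm _) _; rewrite normrM ler_wpM2l ?prod_le.
have -> : 2 * (c * r + s) * (- (1 + q) * (s * r + c) + 2 * w * (c * r - s)) =
  2 * (- (1 + q) * ((c * r + s) * (s * r + c))) + 4 * (w * ((c * r + s) * (c * r - s))) by ring.
have -> : 2 * (`|1 + q| + 2 * `|w|) * (1 + r ^+ 2) =
  2 * (`|1 + q| * (1 + r ^+ 2)) + 4 * (`|w| * (1 + r ^+ 2)) by ring.
by lra.
Qed.

Lemma defect_near_infinity (s c r : R) : c ^+ 2 + s ^+ 2 = 1 -> 1 <= `|r| ->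
  `|(s * r - c) ^+ 2 * (1 + r ^+ 2)^-1 - s ^+ 2| <= 2 / `|r|.
Proof.
move=> E r1; have D0 : 0 < 1 + r ^+ 2 by rewrite ltr_pwDl// sqr_ge0.
have r0 : 0 < `|r| by lra.
have -> : (s * r - c) ^+ 2 * (1 + r ^+ 2)^-1 - s ^+ 2 =
  ((c ^+ 2 - s ^+ 2) - 2 * (s * c) * r) / (1 + r ^+ 2) by field; rewrite lt0r_neq0.
rewrite normrM normfV (gtr0_norm D0) ler_pdivrMr// [leRHS]mulrAC ler_pdivlMr//.
have sc : `|2 * (s * c)| <= 1.
  have := sqr_ge0 (s - c); have := sqr_ge0 (s + c).
  by rewrite ler_norml sqrrB sqrrD => ? ?; apply/andP; split; lra.
have cs : `|c ^+ 2 - s ^+ 2| <= 1.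
  by have := sqr_ge0 s; have := sqr_ge0 c => ? ?; rewrite ler_norml; apply/andP; split; lra.
have h : `|c ^+ 2 - s ^+ 2 - 2 * (s * c) * r| <= 1 + `|r|.
  apply: le_trans (ler_normB _ _) _; rewrite lerD// normrM ler_piMl//.
apply: le_trans (ler_wpM2r (ltW r0) h) _.
rewrite -(real_normK (num_real r)); move: (`|r|) r1 => t t1.
by have : t <= t ^+ 2 by [rewrite expr2 ler_peMl//; lra]; lra.
Qed.

Lemma continuous_defect_pole x : 0 <= x ->
  (forall A : R, exists2 e : R, 0 < e &
    forall y, 0 < y -> y != x -> `|y - x| < e -> A < `|p y|) ->
  angle_defect x = sin (th lam x) ^+ 2 ->
  {for x, continuous angle_defect}.
Proof.
move=> x0 pole fx; apply/cvgrPdist_lt => eps eps0.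
have [e1 e10 H1] := blowups_isolated x0.
(* Passing from [p] to [r = p - W] costs at most [|W x| + 1]; what is left exceeds [4 / eps], so
   that [2 / |r| <= eps / 2]. *)
pose A := 4 / eps + `|W x| + 2.
have [e2 e20 H2] := pole A.
have cn : {for x, continuous (fun x => `|W x|)} by apply: cvg_norm; exact: cW.
have lt1 : `|W x| < `|W x| + 1 by rewrite ltrDl.
have [e3 e30 H3] := continuous_lt cn lt1.
have cs : {for x, continuous (fun y => `|sin (th lam y) ^+ 2 - sin (th lam x) ^+ 2|)}.
  apply: cvg_norm; apply: cvgB; last exact: cvg_cst.
  exact/continuous_sqr/isder_continuous/isder_sin/der_th.
have lt2 : `|sin (th lam x) ^+ 2 - sin (th lam x) ^+ 2| < eps / 2.
  by rewrite subrr normr0 divr_gt0.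
have [e4 e40 H4] := continuous_lt cs lt2.
(* For [x > 0] the neighbourhood is kept inside the positive axis; for [x = 0] the defect is 0 on
   the left by definition. *)
have [e5 e50 H5] : exists2 e : R, 0 < e & x = 0 \/ e <= x.
  move: x0; rewrite le_eqVlt => /predU1P[<-|x0]; first by exists 1 => //; left.
  by exists x => //; right.
apply/nbhs_ballP; exists (Num.min e1 (Num.min e2 (Num.min e3 (Num.min e4 e5)))) => /=.
  by rewrite !lt_min e10 e20 e30 e40 e50.
move=> y; rewrite /ball /= distrC !lt_min => /andP[y1 /andP[y2 /andP[y3 /andP[y4 y5]]]].
rewrite fx distrC; have [->|yx] := eqVneq y x; first by rewrite fx subrr normr0.
have [y0|y0] := leP y 0.
  have xz : x = 0.
    case: H5 => // ex; move: y5; rewrite ltr_norml => /andP[+ _]; lra.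
  by rewrite /angle_defect y0 xz th0 sin0 expr0n subrr normr0.
rewrite /angle_defect leNgt y0 /= asboolF; last exact: H1.
set r := p y - W y.
have rA : 4 / eps + 1 < `|r|.
  have h2 := H2 y y0 yx y2; have h3 := H3 y y3.
  have := ler_normD r (W y); rewrite subrK.
  by move: h2 h3; rewrite /A; lra.
have ep4 : 0 < 4 / eps by rewrite divr_gt0.
have r1 : 1 <= `|r| by lra.
have h := defect_near_infinity (cos2Dsin2 (th lam y)) r1.
have hr : 2 / `|r| <= eps / 2.
  rewrite ler_pdivrMr ?(lt_le_trans ltr01 r1)//.
  rewrite mulrC -ler_pdivrMr ?divr_gt0// invf_div.
  have -> : 2 * (2 / eps) = 4 / eps by field; rewrite gt_eqF.
  by apply: ltW; apply: lt_trans rA; rewrite ltrDl.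
have h4 := H4 y y4.
rewrite (_ : _ - _ = ((sin (th lam y) * r - cos (th lam y)) ^+ 2 / (1 + r ^+ 2) - sin (th lam y) ^+ 2)
  + (sin (th lam y) ^+ 2 - sin (th lam x) ^+ 2)); last by ring.
apply: le_lt_trans (ler_normD _ _) _.
by rewrite [ltRHS](splitr eps) ler_ltD// (le_trans h).
Qed.

Lemma continuous_angle_defect x : 0 <= x -> {for x, continuous angle_defect}.
Proof.
move=> x0; have [p0 _ pr _] := p_sol.
have [xb|nx] := pselect (x = 0 \/ blowups p x); last first.
  have x1 : 0 < x by rewrite lt_neqAle x0 andbT eq_sym; apply/eqP => xE; apply: nx; left.
  apply: isder_continuous (der_angle_defect x1 _).
  by move=> bx; apply: nx; right.
apply: continuous_defect_pole => //; last first.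
  case: xb => [->|bx]; first by rewrite /angle_defect lexx th0 sin0 expr0n.
  by rewrite /angle_defect leNgt (proj1 bx) /= asboolT.
move=> A; have [e1 e10 H1] : exists2 e : R, 0 < e & forall y, x < y -> y < x + e -> A < p y.
  case: xb => [->|/pr]; first by move/cvg_right_pinftyP : p0; exact.
  by move/cvg_right_pinftyP; exact.
have [e2 e20 H2] : exists2 e : R, 0 < e & forall y, 0 < y -> y < x -> x - e < y -> p y < - A.
  case: xb => [->|[_ /cvg_left_ninftyP/(_ (- A))[e e0 He]]].
    by exists 1 => // y y0 /(lt_trans y0); rewrite ltxx.
  by exists e => // y _; exact: He.
exists (Num.min e1 e2) => [|y y0 yx]; first by rewrite lt_min e10 e20.
rewrite lt_min !ltr_norml => /andP[/andP[_ h1] /andP[h2 _]].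
have [xy|yx'] := ltP x y.
  by apply: lt_le_trans (ler_norm _); apply: H1 => //; lra.
have yx2 : y < x by rewrite lt_neqAle yx.
rewrite -normrN; apply: lt_le_trans (ler_norm _).
by rewrite ltrNr; apply: H2 => //; lra.
Qed.

(** Take the infimum [s] of the points where the defect is nonzero. By continuity it vanishes at
    [s], and since blowups are isolated there is none just after [s], where Gronwall keeps it 0. The
    argument starts because both angles have infinite cotangent at 0. *)
Lemma angle_defect0 x : 0 <= x -> angle_defect x = 0.
Proof.
move=> x0; apply/eqP; apply: contrapT => /negP fx.
pose A := [set y | 0 <= y /\ angle_defect y != 0].
have iA : has_inf A by split; [exists x|exists 0 => y []].
pose s := inf A.
have s0 : 0 <= s by apply: lb_le_inf => [|y []]; [case: iA|].
have below y : y < s -> angle_defect y = 0.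
  move=> ys; have [y0|y0] := leP y 0; first by rewrite /angle_defect y0.
  apply/eqP; apply: contrapT => /negP fy.
  suff : s <= y by rewrite leNgt ys.
  by apply: inf_lbound; [case: iA|split => //; exact: ltW].
have fs : angle_defect s = 0.
  apply/eqP; rewrite eq_le angle_defect_ge0 andbT leNgt; apply/negP => fs.
  have [e e0 He] := continuous_gt (continuous_angle_defect s0) fs.
  have := He (s - e / 2); rewrite below; last lra.
  have -> : s - e / 2 - s = - (e / 2) by ring.
  rewrite ltxx normrN gtr0_norm ?divr_gt0// => H.
  by have := H ltac:(lra).
have [e e0 He] := blowups_isolated s0.
have above y : s < y -> y < s + e -> angle_defect y = 0.
  move=> sy ye; apply/eqP; rewrite eq_le angle_defect_ge0 andbT.
  have [M1 M10 HW] := continuous_bounded_segment y cW.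
  have [M2 M20 HQ] := continuous_bounded_segment y cQ.
  pose K := 2 * (1 + M2 + `|lam| + 2 * M1).
  rewrite -[leRHS](mul0r (expR (K * (y - s)))) -fs.
  apply: (@gronwall R angle_defect (fun t => angle_defect t * defect_rate t)) => //.
  - exact: ltW.
  - apply: continuous_in_subspaceT => t; rewrite inE /= in_itv /= => /andP[st _].
    by apply: continuous_angle_defect; exact: le_trans st.
  - move=> t /andP[st ty]; apply: der_angle_defect; first lra.
    by apply: He; [rewrite gt_eqF|rewrite gtr0_norm ?subr_gt0//; lra].
  - move=> t /andP[st ty]; rewrite mulrC ler_wpM2r ?angle_defect_ge0//.
    apply: le_trans (defect_rate_le t) _; rewrite /K.
    have t0 : 0 <= t <= y by apply/andP; split; lra.
    have := HW t t0; have := HQ t t0.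
    have := ler_normD 1 (Q t - lam); have := ler_normB (Q t) lam; rewrite normr1.
    by lra.
have [y [y0 fy] ys] := inf_adherent e0 iA.
have sy : s <= y by apply: inf_lbound; [case: iA|].
move: fy; move: sy; rewrite le_eqVlt => /predU1P[<-|sy]; first by rewrite fs eqxx.
by rewrite above ?eqxx.
Qed.

(** At a blowup the zero defect is [sin ^ 2]. At a zero of [sin] that is not a blowup it would be
    [cos ^ 2 / (1 + r ^ 2)], which is positive. *)
Lemma blowups_riccati_solution : blowups p = zeros lam.
Proof.
apply/seteqP; split=> z [z0 hz].
  split=> //; have := angle_defect0 (ltW z0).
  by rewrite /angle_defect leNgt z0 /= asboolT// => /eqP; rewrite sqrf_eq0 => /eqP.
apply: contrapT => nz; have := angle_defect0 (ltW z0).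
rewrite /angle_defect leNgt z0 /= asboolF// hz mul0r sub0r => /eqP.
have D0 : 1 + (p z - W z) ^+ 2 != 0 by rewrite lt0r_neq0// ltr_pwDl// sqr_ge0.
rewrite mulf_eq0 invr_eq0 (negbTE D0) orbF sqrf_eq0 oppr_eq0 => /eqP cz.
by have := cos2Dsin2 (th lam z); rewrite hz cz !expr0n addr0 => /eqP; rewrite eq_sym oner_eq0.
Qed.

End uniqueness.

Lemma number_of_blowups_zeros lam n : (zeros lam #= `I_n)%card ->
  number_of_blowups beta b lam n%:R%:E.
Proof.
move=> Zn; split; first by exists (riccati lam); exact: riccati_solution_riccati.
by move=> p /blowups_riccati_solution ->; exact: counting_card.
Qed.

End prufer_riccati.

(** * Eigenfunctions *)

Section half_line_integrals.
Context {R : realType}.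
Implicit Types (e F f : R -> R) (M x : R).
Notation mu := (@lebesgue_measure R).

Lemma within_half_line f : (forall x, 0 <= x -> {for x, continuous f}) ->
  {within `[0, +oo[, continuous f}.
Proof.
move=> cf; apply: continuous_in_subspaceT => x.
by rewrite inE /= in_itv /= andbT; exact: cf.
Qed.

Lemma measurable_half_line f : (forall x, 0 <= x -> {for x, continuous f}) ->
  measurable_fun (`[0, +oo[ : set R) f.
Proof.
move=> cf; apply: subspace_continuous_measurable_fun => //.
exact: within_half_line.
Qed.

Lemma bounded_primitive_integral_lty e F M :
  (forall x, 0 <= x -> is_derive x 1 F (e x)) ->
  (forall x, 0 <= x -> {for x, continuous e}) ->
  (forall x, 0 <= x -> 0 <= e x) -> (forall x, 0 <= x -> F x <= M) ->
  (\int[mu]_(x in `[0%R, +oo[) (e x)%:E < +oo)%E.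
Proof.
move=> dF ce e0 FM.
pose H x := F (Num.max x 0).
have Hmono : {homo H : x y / x <= y}.
  move=> x y xy; have mxy : Num.max x 0 <= Num.max y 0 by rewrite ge_max !le_max xy lexx orbT.
  have m0 : 0 <= Num.max x 0 by rewrite le_max lexx orbT.
  apply: (nondecreasing_der mxy) => z /andP[mz _]; last by apply: e0; exact: le_trans mz.
  by apply: dF; exact: le_trans mz.
have ubH : has_ubound (range H).
  by exists M => _ [x _ <-]; apply: FM; rewrite le_max lexx orbT.
have cH := nondecreasing_cvgr Hmono ubH.
rewrite (@ge0_continuous_FTC2y R e F 0 (sup (range H))) ?ltry//.
- exact: within_half_line.
- apply: cvg_trans cH; apply: near_eq_cvg; near=> x.
  by rewrite /H max_l//; near: x; exact: nbhs_pinfty_ge.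
- by move=> x x0; have [] := dF x (ltW x0).
- by apply: cvg_at_right_filter; exact: isder_continuous (dF 0 (lexx _)).
- move=> x; rewrite in_itv /= andbT => x0.
  have dx := dF x (ltW x0); by rewrite derive1E; apply: derive_val.
Unshelve. all: by end_near. Qed.

End half_line_integrals.

Lemma isder_cvg_right {R : realType} (f : R -> R) (d : R) : is_derive (0 : R) 1 f d ->
  (h^-1 * (f h - f 0)) @[h --> (0 : R)^'+] --> d.
Proof.
move=> [d1 <-]; apply/cvgrPdist_lt => e e0.
have /cvgrPdist_lt /(_ e e0) /nbhs_ballP[r /= r0 Hr] := d1.
apply/near_rightP; exists r => // x x0; rewrite add0r => xr.
have := Hr x; rewrite /ball /= sub0r normrN gtr0_norm// => /(_ xr (lt0r_neq0 x0)).
by rewrite /GRing.scale /= mulr1 addr0.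
Qed.

Section eigenfunctions.
Context {R : realType}.
Variables W Q S b : R -> R.
Hypothesis cW : continuous W.
Hypothesis cQ : continuous Q.
Variable beta : R.
Hypothesis bWS : forall x : R, 0 <= x -> 2 / Num.sqrt beta * b x = W x + S x.
Hypothesis dS : forall x : R, 0 <= x -> is_derive x 1 S (Q x - x + W x ^+ 2).
Variable C : R.
Hypothesis Q_growth : forall x : R, 0 <= x -> x / 2 - C <= Q x.
Hypothesis W_growth : forall x : R, 0 <= x -> W x ^+ 2 <= x + C.
Implicit Types (lam x y a e X : R) (f df : R -> R).
Notation mu := (@lebesgue_measure R).

Local Notation th := (th cW cQ).
Local Notation psi := (psi cW cQ).
Local Notation phi := (phi cW cQ).
Local Notation rho := (rho cW cQ).
Local Notation decaying := (decaying cW cQ).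

Definition dpsi lam x : R := W x * psi lam x + phi lam x.

Let energy lam x : R := dpsi lam x ^+ 2 + (1 + x) * psi lam x ^+ 2.

Lemma continuous_psi lam x : 0 <= x -> {for x, continuous (psi lam)}.
Proof. by move=> x0; exact: isder_continuous (der_psi cW cQ lam x0). Qed.

Lemma continuous_phi lam x : 0 <= x -> {for x, continuous (phi lam)}.
Proof. by move=> x0; exact: isder_continuous (der_phi cW cQ lam x0). Qed.

Lemma continuous_dpsi lam x : 0 <= x -> {for x, continuous (dpsi lam)}.
Proof.
move=> x0; apply: cvgD; last exact: continuous_phi.
by apply: cvgM; [exact: cW|exact: continuous_psi].
Qed.

Let continuous_energy lam x : 0 <= x -> {for x, continuous (energy lam)}.
Proof.
move=> x0; apply: cvgD; first by apply: continuous_sqr; exact: continuous_dpsi.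
apply: cvgM; first by apply: cvgD; [exact: cvg_cst|exact: cvg_id].
by apply: continuous_sqr; exact: continuous_psi.
Qed.

Let energy_ge0 lam x : 0 <= x -> 0 <= energy lam x.
Proof. by move=> x0; rewrite addr_ge0 ?sqr_ge0// mulr_ge0 ?sqr_ge0//; lra. Qed.

(* [psi phi] is negative and increasing, and its derivative
   [phi^2 + (Q - lam) psi^2] dominates the energy density up to a constant. *)
Lemma decaying_energy lam : decaying lam ->
  (\int[mu]_(x in `[0%R, +oo[) (energy lam x)%:E < +oo)%E.
Proof.
move=> [X0 X00 dec].
have ce := continuous_clamp (continuous_energy (lam := lam)).
pose F := primitive (fun x => energy lam (Num.max x 0)).
have dF x : 0 <= x -> is_derive x 1 F (energy lam x).
  by move=> x0; have := isder_primitive ce x0; rewrite max_l.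
(* With [Q >= y / 2 - C], this is the threshold beyond which [2 (y + C) + 1 + y <= 8 (Q - lam)], the
   comparison of the coefficients of [psi ^ 2] below. *)
pose X := Num.max X0 `|10 * C + 8 * lam + 1|.
have XX0 : X0 <= X by rewrite le_max lexx.
have XX1 : 10 * C + 8 * lam + 1 <= X.
  by apply: le_trans (ler_norm _) _; rewrite le_max lexx orbT.
have X_0 : 0 <= X := le_trans X00 XX0.
have Fmono x y : 0 <= x -> x <= y -> F x <= F y.
  move=> x0 xy; apply: (nondecreasing_der xy) => z /andP[xz _].
    by apply: dF; exact: le_trans xz.
  by apply: energy_ge0; exact: le_trans xz.
pose G x := psi lam x * phi lam x.
have G0 x : X <= x -> G x < 0.
  by move=> Xx; apply: psi_phi_lt0; apply: dec; exact: le_trans Xx.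
apply: (@bounded_primitive_integral_lty R _ F (F X - 8 * G X)) => //.
- by move=> x; exact: continuous_energy.
- by move=> x; exact: energy_ge0.
move=> x x0; have [xX|/ltW Xx] := leP x X.
  by have := Fmono x X x0 xX; have := G0 X (lexx _); lra.
have : 8 * G X - F X <= 8 * G x - F x.
  apply: (@nondecreasing_der R (fun x => 8 * G x - F x)
    (fun x => (0 * G x + 8 * (phi lam x ^+ 2 + (Q x - lam) * psi lam x ^+ 2)) - energy lam x) _ _ Xx).
    move=> y /andP[Xy _]; have y0 := le_trans X_0 Xy.
    have dG := der_psi_phi cW cQ lam y0.
    exact: isder_add (isder_mul (isder_cst y 8) dG) (isder_opp (dF y y0)).
  move=> y /andP[Xy _]; have y0 := le_trans X_0 Xy.
  rewrite /energy /dpsi mul0r add0r.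
  set p := psi lam y; set q := phi lam y.
  have h1 : (W y * p + q) ^+ 2 <= 2 * (W y ^+ 2 * p ^+ 2) + 2 * q ^+ 2.
    by have := sqr_ge0 (W y * p - q); rewrite sqrrB sqrrD exprMn; lra.
  have p0 : 0 <= p ^+ 2 by exact: sqr_ge0.
  have h2 : W y ^+ 2 * p ^+ 2 <= (y + C) * p ^+ 2 by rewrite ler_wpM2r// W_growth.
  have h3 : (2 * (y + C) + 1 + y) * p ^+ 2 <= 8 * (Q y - lam) * p ^+ 2.
    by rewrite ler_wpM2r//; have := Q_growth y0; lra.
  have q0 : 0 <= q ^+ 2 by exact: sqr_ge0.
  by move: h1 h2 h3 p0 q0; lra.
by have := G0 x Xx; lra.
Qed.

Lemma psi0 lam : psi lam 0 = 0.
Proof. by rewrite /psi th0 sin0 mulr0. Qed.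

Lemma lac_psi lam a : locally_absolutely_continuous (fun x => a * psi lam x).
Proof.
move=> M e e0.
have cd : continuous (fun x => a * dpsi lam (Num.max x 0)).
  move=> x; apply: cvgM; first exact: cvg_cst.
  by apply: continuous_clamp => y y0; exact: continuous_dpsi.
have [K K0 HK] := continuous_bounded_segment M cd.
exists (e / (K + 1)) => [|n u v uv _ duv].
  by rewrite divr_gt0// ltr_wpDl.
apply: (@le_lt_trans _ _ (K * \sum_(i < n) (v i - u i))).
  rewrite mulr_sumr; apply: ler_sum => i _; have [u0 [uvi vM]] := uv i (ltn_ord i).
  rewrite mulrBr; apply: (@isder_bound R (fun x => a * psi lam x) (fun x => 0 * psi lam x + a * dpsi lam x)
     (fun x => K * x) (fun x => 0 * x + K * 1) _ _ uvi).
  - move=> y /andP[uy _]; have y0 := le_trans u0 uy.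
    exact: isder_mul (isder_cst y a) (der_psi cW cQ lam y0).
  - by move=> y _; der.
  - move=> y /andP[uy yv]; have y0 := le_trans u0 uy.
    rewrite !mul0r !add0r mulr1; have := HK y; rewrite max_l//; apply.
    by rewrite y0 (le_trans yv).
apply: (@le_lt_trans _ _ (K * (e / (K + 1)))).
  by rewrite ler_wpM2l// ltW.
rewrite mulrA ltr_pdivrMr ?ltr_wpDl// mulrC ltr_pM2l// ltrDl ltr01//.
Qed.

Lemma derive1_psi lam a x : 0 <= x -> derive1 (fun x => a * psi lam x) x = a * dpsi lam x.
Proof.
move=> x0; have dx := isder_mul (isder_cst x a) (der_psi cW cQ lam x0).
by rewrite derive1E (@derive_val _ _ _ _ _ _ _ dx) mul0r add0r.
Qed.

Lemma Lstar_psi lam a : decaying lam -> Lstar (fun x => a * psi lam x).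
Proof.
move=> dec; split; first exact: lac_psi.
- by rewrite psi0 mulr0.
- rewrite [X in (X < _)%E](_ : _ =
      (\int[mu]_(x in `[0%R, +oo[) ((a ^+ 2)%:E * (energy lam x)%:E))%E); last first.
    apply: eq_integral => x; rewrite inE /= in_itv /= andbT => x0.
    by rewrite derive1_psi// -EFinM /energy; congr EFin; ring.
  rewrite ge0_integralZl_EFin//.
  + by rewrite lte_mul_pinfty// ?lee_fin ?sqr_ge0// ?decaying_energy.
  + by move=> x; rewrite /= in_itv /= andbT => x0; rewrite lee_fin energy_ge0.
  + by apply/measurable_EFinP; apply: measurable_half_line => x; exact: continuous_energy.
  + exact: sqr_ge0.
Qed.

Lemma integral_psi_sqr_gt0 lam :
  (0 < \int[mu]_(x in `[0%R, +oo[) (psi lam x ^+ 2)%:E)%E.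
Proof.
have d1 := der_psi cW cQ lam (lexx 0).
have dpsi1 : 0 < W 0 * psi lam 0 + phi lam 0.
  by rewrite psi0 mulr0 add0r /phi th0 cos0 mulr1 rho_gt0.
have [e1 e10 H1] := isder_gt0 d1 dpsi1.
pose x1 := e1 / 2; have x10 : 0 < x1 by rewrite divr_gt0.
have p1 : 0 < psi lam x1.
  have := H1 x1 (lt0r_neq0 x10); rewrite gtr0_norm// psi0 subr0 add0r => /(_ ltac:(rewrite /x1; lra)).
  by rewrite pmulr_rgt0// invr_gt0.
have c2 : {for x1, continuous (fun x => psi lam x ^+ 2)}.
  by apply: continuous_sqr; apply: continuous_psi; exact: ltW.
have lt2 : psi lam x1 ^+ 2 / 2 < psi lam x1 ^+ 2 by have := exprn_gt0 2 p1; lra.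
have [e e0 He] := continuous_gt c2 lt2.
have m2 : measurable_fun (`[0, +oo[ : set R) (fun x => (psi lam x ^+ 2)%:E).
  apply/measurable_EFinP; apply: measurable_half_line => x x0.
  by apply: continuous_sqr; exact: continuous_psi.
have sub : `[x1, x1 + e / 2] `<=` (`[0, +oo[ : set R).
  by move=> x; rewrite /= !in_itv /= andbT => /andP[+ _]; exact: le_trans (ltW x10).
apply: (@lt_le_trans _ _ (\int[mu]_(x in `[x1, (x1 + e / 2)%R]) cst (psi lam x1 ^+ 2 / 2)%:E x)%E).
  rewrite integral_cst//= lebesgue_measure_itv /= lte_fin ifT; last lra.
  by rewrite -EFinB -EFinM lte_fin mulr_gt0 ?divr_gt0 ?exprn_gt0//; lra.
apply: (@le_trans _ _ (\int[mu]_(x in `[x1, (x1 + e / 2)%R]) (psi lam x ^+ 2)%:E)%E); last first.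
  by apply: ge0_subset_integral => // x _; rewrite lee_fin sqr_ge0.
apply: ge0_le_integral => //.
- by move=> x _; rewrite /= lee_fin divr_ge0 ?sqr_ge0.
- exact: measurable_funS m2.
- move=> x; rewrite /= in_itv /= => /andP[h1 h2]; rewrite lee_fin ltW//.
  by apply: He; rewrite ger0_norm ?subr_ge0//; lra.
Qed.

Lemma integral_psi_sqr_lty lam : decaying lam ->
  (\int[mu]_(x in `[0%R, +oo[) (psi lam x ^+ 2)%:E < +oo)%E.
Proof.
move=> dec; apply: le_lt_trans (decaying_energy dec).
apply: ge0_le_integral => //.
- by move=> x _; rewrite lee_fin sqr_ge0.
- apply/measurable_EFinP; apply: measurable_half_line => x x0.
  by apply: continuous_sqr; exact: continuous_psi.
- by apply/measurable_EFinP; apply: measurable_half_line => x; exact: continuous_energy.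
- move=> x; rewrite /= in_itv /= andbT => x0; rewrite lee_fin /energy.
  have h1 := sqr_ge0 (dpsi lam x); have h2 := mulr_ge0 x0 (sqr_ge0 (psi lam x)).
  by rewrite mulrDl mul1r; lra.
Qed.

(** This is the fundamental theorem of calculus for [phi - S psi], which equals [psi' - (W + S) psi]
    and is therefore what remains of [psi'] after the integration by parts. *)
Lemma psi_equation lam a x : 0 <= x ->
  a * dpsi lam x - a * dpsi lam 0 =
  2 / Num.sqrt beta * (a * psi lam x) * b x
  - \int[mu]_(y in `[0, x]) (2 / Num.sqrt beta * b y * (a * dpsi lam y))
  + \int[mu]_(y in `[0, x]) ((y - lam) * (a * psi lam y)).
Proof.
move=> x0.
pose g1 y := (y - lam) * (a * psi lam y).
pose g2 y := (W y + S y) * (a * dpsi lam y).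
have cg1 : {within `[0, x], continuous g1}.
  apply: continuous_in_subspaceT => y; rewrite inE /= in_itv /= => /andP[y0 _].
  apply: cvgM; first by apply: cvgB; [exact: cvg_id|exact: cvg_cst].
  by apply: cvgM; [exact: cvg_cst|exact: continuous_psi].
have cg2 : {within `[0, x], continuous g2}.
  apply: continuous_in_subspaceT => y; rewrite inE /= in_itv /= => /andP[y0 _].
  apply: cvgM; first by apply: cvgD; [exact: cW|exact: isder_continuous (dS y0)].
  by apply: cvgM; [exact: cvg_cst|exact: continuous_dpsi].
have -> : \int[mu]_(y in `[0, x]) (2 / Num.sqrt beta * b y * (a * dpsi lam y)) =
    \int[mu]_(y in `[0, x]) g2 y.
  apply: eq_Rintegral => y; rewrite inE /= in_itv /= => /andP[y0 _].
  by rewrite bWS.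
have dH y : 0 <= y <= x -> is_derive y 1 (fun y => a * (phi lam y - S y * psi lam y)) (g1 y - g2 y).
  move=> /andP[y0 _].
  have d1 := der_psi cW cQ lam y0; have d2 := der_phi cW cQ lam y0; have d3 := dS y0.
  apply: (isder_eq (isder_mul (isder_cst y a) (isder_add d2 (isder_opp (isder_mul d3 d1))))).
  by rewrite /g1 /g2 /dpsi; ring.
have cg : {within `[0, x], continuous (fun y => g1 y - g2 y)}.
  by move=> y; apply: cvgB; [exact: cg1|exact: cg2].
have := FTC2_continuous x0 dH cg.
rewrite RintegralB//; [|exact: integrable_segment|exact: integrable_segment].
rewrite psi0 /g1 mulr0 subr0 => E.
have -> : 2 / Num.sqrt beta * (a * psi lam x) * b x = (W x + S x) * (a * psi lam x).
  by rewrite -bWS//; ring.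
by move/(canRL (subrK _)): E => ->; rewrite /dpsi psi0; ring.
Qed.

Lemma decaying_airy_eigenvalue lam : decaying lam -> airy_eigenvalue beta b lam.
Proof.
move=> dec.
pose N := fine (\int[mu]_(x in `[0%R, +oo[) (psi lam x ^+ 2)%:E).
have NE : (\int[mu]_(x in `[0%R, +oo[) (psi lam x ^+ 2)%:E = N%:E)%E.
  rewrite fineK// ge0_fin_numE; first exact: integral_psi_sqr_lty.
  exact/ltW/integral_psi_sqr_gt0.
have N0 : 0 < N by rewrite -lte_fin -NE integral_psi_sqr_gt0.
pose a := (Num.sqrt N)^-1.
have a2 : a ^+ 2 = N^-1 by rewrite exprVn sqr_sqrtr// ltW.
exists (fun x => a * psi lam x); split; first exact: Lstar_psi.
- rewrite [LHS](_ : _ =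
      (\int[mu]_(x in `[0%R, +oo[) ((a ^+ 2)%:E * (psi lam x ^+ 2)%:E))%E); last first.
    by apply: eq_integral => x _; rewrite -EFinM exprMn.
  rewrite ge0_integralZl_EFin ?sqr_ge0//.
  + by rewrite NE -EFinM a2 mulVf ?gt_eqF.
  + by move=> x _; rewrite lee_fin sqr_ge0.
  + apply/measurable_EFinP; apply: measurable_half_line => x x0.
    by apply: continuous_sqr; exact: continuous_psi.
- exists (fun x => a * dpsi lam x); last exact: psi_equation.
  have d x : 0 <= x -> is_derive x 1 (fun x => a * psi lam x) (a * dpsi lam x).
    move=> x0; apply: (isder_eq (isder_mul (isder_cst x a) (der_psi cW cQ lam x0))).
    by rewrite mul0r add0r.
  split; first by move=> x /ltW; exact: d.
  exact: isder_cvg_right (d 0 (lexx _)).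
Qed.

(** * Eigenfunctions are multiples of [psi] *)

Section converse.
Variables (lam : R) (f df : R -> R).
Hypothesis f_Lstar : Lstar f.
Hypothesis f_norm : (\int[mu]_(x in `[0%R, +oo[) (f x ^+ 2)%:E = 1)%E.
Hypothesis f_der : half_line_derivative f df.
Hypothesis f_eq : forall x, 0 <= x ->
  df x - df 0 = 2 / Num.sqrt beta * f x * b x
  - \int[mu]_(y in `[0, x]) (2 / Num.sqrt beta * b y * df y)
  + \int[mu]_(y in `[0, x]) ((y - lam) * f y).

Let fc x := f (Num.max x 0).

Let cfc : continuous fc.
Proof.
move=> x; apply/cvgrPdist_lt => e e0.
have [lac _ _] := f_Lstar.
have [d d0 Hd] := lac (Num.max x 0 + 1) e e0.
have step u v : 0 <= u -> u <= v -> v <= Num.max x 0 + 1 -> v - u < d -> `|f v - f u| < e.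
  move=> u0 uv vM vud; have := Hd 1%N (fun=> u) (fun=> v).
  rewrite !big_ord1; apply => //.
  by move=> i j; rewrite /= !ltnS !leqn0 => /eqP -> /eqP ->.
apply/nbhs_ballP; exists (Num.min d 1) => /=; first by rewrite lt_min d0 ltr01.
move=> y; rewrite /ball /= lt_min => /andP[xyd xy1].
have m0 (z : R) : 0 <= Num.max z 0 by rewrite le_max lexx orbT.
have h := ler_dist_max0 x y.
have [mxy|/ltW myx] := leP (Num.max x 0) (Num.max y 0).
  rewrite distrC; move: h; rewrite (distrC (Num.max x 0)) ger0_norm ?subr_ge0// => h.
  by apply: step => //; [rewrite -lerBlDl|]; lra.
move: h; rewrite ger0_norm ?subr_ge0// => h.
by apply: step => //; [rewrite lerDl|]; lra.
Qed.

Let f_within x : {within `[0, x], continuous f}.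
Proof.
apply: (@subspace_eq_continuous _ _ _ fc).
  by move=> y; rewrite inE /= in_itv /= /fc => /andP[y0 _]; rewrite /from_subspace max_l.
exact: (continuous_subspaceT cfc).
Qed.

Let fE x : 0 < x -> is_derive x 1 f (df x).
Proof. by move=> x0; case: f_der => H _; exact: H. Qed.

Let measurable_f : measurable_fun (`[0, +oo[ : set R) f.
Proof.
apply: (eq_measurable_fun fc).
  by move=> y; rewrite inE /= in_itv /= /fc andbT => y0; rewrite max_l.
apply: measurable_funS (continuous_measurable_fun cfc) => //.
Qed.

(** Continuity of [df] will come from the equation, but only once [b * df] is known to be
    integrable; so measurability is taken from difference quotients. The point 0, where the
    derivative is one-sided, is split off. *)
Let measurable_df : measurable_fun (`[0, +oo[ : set R) df.
Proof.
rewrite -(@setU1itv _ R +oo%O 0 false)//; apply/measurable_funU => //; split.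
  exact: measurable_fun_set1.
pose D n x := n.+1%:R * (fc (x + n.+1%:R^-1) - fc x).
apply: (@measurable_realfun.measurable_fun_cvg _ _ _ _ D) => [n|x].
  apply: measurable_funS (continuous_measurable_fun _) => // x.
  apply: cvgM; first exact: cvg_cst.
  apply: cvgB; last exact: cfc.
  apply: (@continuous_comp _ _ _ (fun x => x + n.+1%:R^-1) fc); last exact: cfc.
  by apply: cvgD; [exact: cvg_id|exact: cvg_cst].
rewrite /= in_itv /= andbT => x0.
have [d1 dE] := fE x0; rewrite -dE; apply/cvgrPdist_lt => e e0.
have /cvgrPdist_lt /(_ e e0) /nbhs_ballP[r /= r0 Hr] := d1.
near=> n.
have nr : n.+1%:R^-1 < r by near: n; exact: (near_infty_natSinv_lt (PosNum r0)).
have n0 : 0 < n.+1%:R^-1 :> R by rewrite invr_gt0.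
have := Hr n.+1%:R^-1; rewrite /ball /= sub0r normrN gtr0_norm// => /(_ nr (lt0r_neq0 n0)).
rewrite /GRing.scale /= mulr1 invrK /D /fc !max_l ?(ltW x0) ?addr_ge0 ?(ltW x0) ?(ltW n0)//.
by rewrite (addrC x).
Unshelve. all: by end_near. Qed.

Let e x := df x ^+ 2 + (1 + x) * f x ^+ 2.

Let e_ge0 x : 0 <= x -> 0 <= e x.
Proof. by move=> x0; rewrite addr_ge0 ?sqr_ge0// mulr_ge0 ?sqr_ge0//; lra. Qed.

Let measurable_e : measurable_fun (`[0, +oo[ : set R) (fun x => (e x)%:E).
Proof.
apply/measurable_EFinP; apply: measurable_funD; first exact: measurable_funX.
apply: measurable_funM; last exact: measurable_funX.
by apply: measurable_funD => //; exact: measurable_cst.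
Qed.

Let e_lty : (\int[mu]_(x in `[0%R, +oo[) (e x)%:E < +oo)%E.
Proof.
have [_ _ fin] := f_Lstar; move: fin.
have sub : `]0, +oo[ `<=` (`[0, +oo[ : set R).
  by move=> x; rewrite /= !in_itv /= !andbT => /ltW.
have me : measurable_fun (`]0, +oo[ : set R) (fun x => (e x)%:E).
  exact: measurable_funS measurable_e.
have eqe : {in `]0, +oo[%classic, (fun x : R => (e x)%:E) =1
    (fun x : R => (derive1 f x ^+ 2 + (1 + x) * f x ^+ 2)%:E)}.
  move=> x; rewrite inE /= in_itv /= andbT => x0.
  by rewrite /e derive1E (@derive_val _ _ _ _ _ _ _ (fE x0)).
rewrite -integral_itv_obnd_cbnd; last exact: eq_measurable_fun me.
rewrite [X in (X < _)%E -> _](_ : _ = (\int[mu]_(x in `]0%R, +oo[) (e x)%:E)%E).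
  by rewrite integral_itv_obnd_cbnd.
by apply: eq_integral => x xi; rewrite eqe.
Qed.

Let g y := 2 / Num.sqrt beta * b y * df y.

Let gE y : 0 <= y -> g y = (W y + S y) * df y.
Proof. by move=> y0; rewrite /g bWS. Qed.

Let cWS y : 0 <= y -> {for y, continuous (fun y => W y + S y)}.
Proof.
by move=> y0; apply: cvgD; [exact: cW|exact: isder_continuous (dS y0)].
Qed.

Let integrable_g X : mu.-integrable `[0, X] (EFin \o g).
Proof.
have sub : `[0, X] `<=` (`[0, +oo[ : set R).
  by move=> x; rewrite /= !in_itv /= andbT => /andP[].
have [K K0 HK] := continuous_bounded_segment X (continuous_clamp cWS).
have iE : mu.-integrable `[0, +oo[ (fun y => (e y)%:E).
  apply/integrableP; split; first exact: measurable_e.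
  rewrite (_ : (\int[mu]_(x in `[0%R, +oo[) `|(e x)%:E|)%E = (\int[mu]_(x in `[0%R, +oo[) (e x)%:E)%E)//.
  apply: eq_integral => x; rewrite inE /= in_itv /= andbT => x0.
  by rewrite ger0_norm// e_ge0.
have mX : measurable (`[0, X] : set (measurableTypeR R)) by [].
have iE' : mu.-integrable `[0, X] (fun y => (e y)%:E).
  by apply: (integrableS _ mX sub iE).
have iG : mu.-integrable `[0, X] (fun y => (K%:E + K%:E * (e y)%:E)%E).
  apply: (integrableD mX _ (integrableZl mX K iE')).
  by apply: (integrable_segment (f := cst K)); apply: continuous_subspaceT; exact: cst_continuous.
apply: (le_integrable _ _ _ iG) => //.
- apply/measurable_EFinP.
  apply: (eq_measurable_fun (fun y => (W (Num.max y 0) + S (Num.max y 0)) * df y)).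
    by move=> y; rewrite inE /= in_itv /= => /andP[y0 _]; rewrite gE// max_l.
  apply: measurable_funM; last exact: measurable_funS measurable_df.
  apply: measurable_funS (continuous_measurable_fun (continuous_clamp cWS)) => //.
- move=> y; rewrite /= in_itv /= => y0X; have y0 : 0 <= y by case/andP: y0X.
  rewrite lee_fin gE// normrM.
  have hK := HK y y0X; rewrite max_l// in hK.
  rewrite [leRHS]ger0_norm; last by rewrite addr_ge0// mulr_ge0// e_ge0.
  have h1 : `|df y| <= 1 + e y.
    have h2 : df y ^+ 2 <= e y by rewrite lerDl mulr_ge0 ?sqr_ge0//; lra.
    have := sqr_ge0 (`|df y| - 1); rewrite sqrrB real_normK ?num_real// => h3.
    by have := normr_ge0 (df y); lra.
  rewrite -[X in _ <= X + _]mulr1 -mulrDr.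
  by apply: ler_pM => //; exact: e_ge0.
Qed.

Let J x := \int[mu]_(y in `[0, x]) g y.
Let L x := \int[mu]_(y in `[0, x]) ((y - lam) * f y).

Let within_L x : {within `[0, x], continuous (fun y => (y - lam) * f y)}.
Proof.
have c1 : {within `[0, x], continuous (fun y : R => y - lam)}.
  by apply: continuous_subspaceT => z; apply: cvgB; [exact: cvg_id|exact: cvg_cst].
by move=> y; apply: cvgM; [exact: c1|exact: f_within].
Qed.

Let dfE x : 0 <= x -> df x = df 0 + (W x + S x) * f x - J x + L x.
Proof.
move=> x0; have := f_eq x0; rewrite -/(J x) -/(L x).
by rewrite -mulrA [f x * _]mulrC mulrA bWS// => E; rewrite -[df x](subrK (df 0)) E; ring.
Qed.

Let within_df X : 0 <= X -> {within `[0, X], continuous df}.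
Proof.
move=> X0.
apply: (@subspace_eq_continuous _ _ _ (fun x => df 0 + (W x + S x) * f x - J x + L x)).
  by move=> y; rewrite inE /= in_itv /= /from_subspace => /andP[y0 _]; rewrite -dfE.
move=> x; apply: cvgD; last first.
  apply: parameterized_integral_continuous => //; apply: integrable_segment.
  exact: within_L.
apply: cvgB; last exact: (parameterized_integral_continuous X0 (integrable_g X)).
apply: cvgD; first exact: cvg_cst.
apply: cvgM; last exact: f_within.
apply: (@continuous_in_subspaceT _ _ _ (fun x => W x + S x)) => y.
by rewrite inE /= in_itv /= => /andP[/cWS].
Qed.

Let cf x : 0 < x -> {for x, continuous f}.
Proof. by move=> x0; exact: isder_continuous (fE x0). Qed.

Let cdf x : 0 < x -> {for x, continuous df}.
Proof.
move=> x0; have x1 : 0 < x + 1 by lra.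
apply: (within_continuous_continuous x1 (within_df (ltW x1))).
by rewrite in_itv /= x0 ltrDl ltr01.
Qed.

(** The counterpart of [phi]: the pair [(f, ph)] solves the same system as [(psi, phi)]. *)
Let ph x := df x - W x * f x.

Let dph x : 0 < x -> is_derive x 1 ph ((Q x - lam) * f x - W x * ph x).
Proof.
move=> x0; have x1 : x < x + 1 by rewrite ltrDl.
have cg : {for x, continuous g}.
  have : {for x, continuous (fun y => (W y + S y) * df y)}.
    by apply: cvgM; [exact: cWS (ltW x0)|exact: cdf].
  have -> : {for x, continuous g} = (g @ x --> g x) by [].
  rewrite gE ?ltW//; apply: cvg_trans; apply: near_eq_cvg.
  near=> y; rewrite gE//; apply: ltW; near: y; exact: lt_nbhsr.
have cl : {for x, continuous (fun y => (y - lam) * f y)}.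
  by apply: cvgM; [apply: cvgB; [exact: cvg_id|exact: cvg_cst]|exact: cf].
have [J1 J2] := continuous_FTC1_closed x1 (integrable_g (x + 1)) x0 cg.
have dJ : is_derive x 1 J (g x) by apply: (DeriveDef J1); rewrite -derive1E; exact: J2.
have [L1 L2] := continuous_FTC1_closed x1 (integrable_segment (@within_L (x + 1))) x0 cl.
have dL : is_derive x 1 L ((x - lam) * f x).
  by apply: (DeriveDef L1); rewrite -derive1E; exact: L2.
apply: (@isder_near _ _ (fun y => df 0 + S y * f y - J y + L y)).
  near=> y; rewrite /ph (@dfE y); first by ring.
  by apply: ltW; near: y; exact: lt_nbhsr.
have dSf := isder_mul (dS (ltW x0)) (fE x0).
apply: (isder_eq (isder_add (isder_add (isder_add (isder_cst x (df 0)) dSf) (isder_opp dJ)) dL)).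
by rewrite /ph gE ?ltW//; ring.
Unshelve. all: by end_near. Qed.

Let within_ph X : 0 <= X -> {within `[0, X], continuous ph}.
Proof.
move=> X0 x; apply: cvgB; first exact: within_df.
by apply: cvgM; [exact: (continuous_subspaceT cW)|exact: f_within].
Qed.

Lemma within_derive0_cst (h : R -> R) X : 0 <= X -> {within `[0, X], continuous h} ->
  (forall x, 0 < x < X -> is_derive x 1 h 0) -> h X = h 0.
Proof.
move=> X0 ch dh; apply/eqP; rewrite eq_le; apply/andP; split.
  rewrite -lerN2; apply: (@nondecreasing_derive R (fun x => - h x) (fun=> - 0)) => //.
  - by move=> x; apply: cvgN; exact: ch.
  - by move=> x /dh; exact: isder_opp.
by apply: (@nondecreasing_derive R h (fun=> 0)).
Qed.

Let within_half h X : (forall x, 0 <= x -> {for x, continuous h}) ->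
  {within `[0, X], continuous (h : R -> R)}.
Proof.
move=> ch; apply: continuous_in_subspaceT => x.
by rewrite inE /= in_itv /= => /andP[/ch].
Qed.

Let f0 : f 0 = 0. Proof. by case: f_Lstar. Qed.

Let wronskian0 x : 0 <= x -> f x * phi lam x = psi lam x * ph x.
Proof.
move=> x0; apply/eqP; rewrite -subr_eq0; apply/eqP.
transitivity (f 0 * phi lam 0 - psi lam 0 * ph 0); last first.
  by rewrite f0 psi0 !mul0r subrr.
apply: (@within_derive0_cst (fun x => f x * phi lam x - psi lam x * ph x)) => //.
  move=> y; apply: cvgB; apply: cvgM.
  - exact: f_within.
  - by apply: within_half => z; exact: continuous_phi.
  - by apply: within_half => z; exact: continuous_psi.
  - exact: within_ph.
move=> y /andP[y0 _].
have d1 := der_psi cW cQ lam (ltW y0); have d2 := der_phi cW cQ lam (ltW y0).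
have d3 := dph y0; have d4 := fE y0.
apply: (isder_eq (isder_add (isder_mul d4 d2) (isder_opp (isder_mul d1 d3)))).
by rewrite /ph; ring.
Qed.

Let r2 x := psi lam x ^+ 2 + phi lam x ^+ 2.

Let r2_gt0 x : 0 < r2 x.
Proof. by rewrite /r2 psi_phi_sqr exprn_gt0// rho_gt0. Qed.

(** The coefficient of [(f, ph)] along [(psi, phi)]. Dividing by [psi ^ 2 + phi ^ 2] instead of
    taking [f / psi] avoids the zeros of [psi]. *)
Let m x := (f x * psi lam x + ph x * phi lam x) * (r2 x)^-1.

Let fm x : 0 <= x -> f x = m x * psi lam x.
Proof.
move=> x0; have := wronskian0 x0; have := r2_gt0 x; rewrite /m /r2.
set p := psi lam x; set q := phi lam x => r0 E.
have -> : (f x * p + ph x * q) / (p ^+ 2 + q ^+ 2) * p =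
  (f x * p ^+ 2 + (p * ph x) * q) / (p ^+ 2 + q ^+ 2) by ring.
by rewrite -E; field; rewrite lt0r_neq0.
Qed.

Let phm x : 0 <= x -> ph x = m x * phi lam x.
Proof.
move=> x0; have := wronskian0 x0; have := r2_gt0 x; rewrite /m /r2.
set p := psi lam x; set q := phi lam x => r0 E.
have -> : (f x * p + ph x * q) / (p ^+ 2 + q ^+ 2) * q =
  ((f x * q) * p + ph x * q ^+ 2) / (p ^+ 2 + q ^+ 2) by ring.
by rewrite E; field; rewrite lt0r_neq0.
Qed.

Let m_cst x : 0 <= x -> m x = m 0.
Proof.
move=> x0; apply: within_derive0_cst => //.
  move=> y; apply: cvgM.
    apply: cvgD; apply: cvgM.
    - exact: f_within.
    - by apply: within_half => z; exact: continuous_psi.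
    - exact: within_ph.
    - by apply: within_half => z; exact: continuous_phi.
  apply: (@within_half (fun y => (r2 y)^-1)) => z z0.
  apply: cvgV; first by rewrite lt0r_neq0.
  by apply: cvgD; apply: continuous_sqr; [exact: continuous_psi|exact: continuous_phi].
move=> y /andP[y0 _].
have d1 := der_psi cW cQ lam (ltW y0); have d2 := der_phi cW cQ lam (ltW y0).
have d3 := dph y0; have d4 := fE y0.
have dr := isder_inv (f := r2) (lt0r_neq0 (r2_gt0 y)) (isder_add (isder_sqr d1) (isder_sqr d2)).
apply: (isder_eq (isder_mul (isder_add (isder_mul d4 d1) (isder_mul d3 d2)) dr)).
have E1 := fm (ltW y0); have E2 := phm (ltW y0).
have E3 : df y = W y * f y + ph y by rewrite /ph; ring.
rewrite E3 E1 E2; have := r2_gt0 y; rewrite /r2.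
move: (m y) (psi lam y) (phi lam y) (W y) (Q y) => M p q w Q' r0.
by field; rewrite lt0r_neq0.
Qed.

Let m0 : m 0 != 0.
Proof.
apply/eqP => m00; have : (\int[mu]_(x in `[0%R, +oo[) (f x ^+ 2)%:E = 0)%E.
  rewrite -(@integral0 _ _ R mu (`[0, +oo[ : set R)); apply: eq_integral => x.
  rewrite inE /= in_itv /= andbT => x0.
  by rewrite fm// m_cst// m00 mul0r expr0n.
by rewrite f_norm => /eqP; rewrite onee_eq0.
Qed.

(** Otherwise [psi phi] is eventually positive and nondecreasing, so [f * ph], a nonzero multiple of
    it, stays above some [eta > 0]. As [f * ph] is at most a constant times the energy density of
    [f], the energy would be infinite. *)
Lemma eigenpair_decaying : decaying lam.
Proof.
apply: contrapT => nd.
have [X X0 HX] := Q_large Q_growth lam.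
have q0 x : X <= x -> 0 < Q x - lam by move=> Xx; apply: (lt_le_trans ltr01); exact: HX.
have [x1 [j [Xx1 /andP[jx xj]]]] := not_decaying_angle X0 nd q0.
have x10 := le_trans X0 Xx1.
have sc y : x1 < y -> 0 < psi lam y * phi lam y.
  move=> xy; have h1 := th_cross x10 xy jx.
  have h2 := th_trap x10 xy (fun z xz => q0 z (le_trans Xx1 xz)) (ltW xj).
  rewrite /psi /phi mulrACA; apply: mulr_gt0; first by rewrite mulr_gt0 ?rho_gt0.
  by apply: (@sincos_gt0 _ j); rewrite h1 h2.
pose a := x1 + 1; have xa : x1 < a by rewrite ltrDl.
have a0 : 0 <= a by rewrite (le_trans x10)// ltW.
pose G y := psi lam y * phi lam y.
have Gge y : a <= y -> G a <= G y.
  move=> ay; apply: (nondecreasing_der ay) => z /andP[az _].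
    by apply: der_psi_phi; exact: le_trans az.
  have Xz : X <= z by apply: (le_trans Xx1); apply: ltW; exact: lt_le_trans az.
  by rewrite addr_ge0 ?sqr_ge0// mulr_ge0 ?sqr_ge0// ltW// q0.
pose eta := m 0 ^+ 2 * G a.
have eta0 : 0 < eta by rewrite mulr_gt0 ?sc// exprn_even_gt0.
(* From [f ph <= (f^2 + df^2) / 2 + |W| f^2] and [|W| <= (1 + W^2) / 2 <= (1 + y + |C|) / 2]. *)
pose K := 1 + `|C|.
have K0 : 0 < K by rewrite ltr_pwDl.
have bound y : a <= y -> eta <= K * e y.
  move=> ay; have y0 := le_trans a0 ay.
  have -> : eta = m 0 ^+ 2 * G a by [].
  apply: (@le_trans _ _ (f y * ph y)).
    rewrite fm// phm// m_cst//.
    have -> : m 0 * psi lam y * (m 0 * phi lam y) = m 0 ^+ 2 * G y by rewrite /G; ring.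
    by rewrite ler_wpM2l ?sqr_ge0// Gge.
  rewrite /ph /e /K.
  have hW : `|W y| <= (1 + y + `|C|) / 2.
    have := W_growth y0; have := ler_norm C; have := sqr_ge0 (`|W y| - 1).
    by rewrite sqrrB real_normK ?num_real//; lra.
  have h1 : f y * (df y - W y * f y) <= (f y ^+ 2 + df y ^+ 2) / 2 + `|W y| * f y ^+ 2.
    have h2 := sqr_ge0 (f y - df y).
    have h3 : - (W y * f y ^+ 2) <= `|W y| * f y ^+ 2.
      by rewrite -mulNr ler_wpM2r ?sqr_ge0// -normrN ler_norm.
    by move: h2 h3; rewrite sqrrB; lra.
  apply: le_trans h1 _.
  have F0 := sqr_ge0 (f y); have D0 := sqr_ge0 (df y); have c0 := normr_ge0 C.
  have h4 : `|W y| * f y ^+ 2 <= (1 + y + `|C|) / 2 * f y ^+ 2 by rewrite ler_wpM2r.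
  have h5 : 0 <= `|C| * df y ^+ 2 by rewrite mulr_ge0.
  have h6 : 0 <= `|C| * f y ^+ 2 by rewrite mulr_ge0.
  have h7 : 0 <= y * f y ^+ 2 by rewrite mulr_ge0.
  have h8 : 0 <= `|C| * (y * f y ^+ 2) by rewrite mulr_ge0.
  by move: h4 h5 h6 h7 h8 F0 D0; lra.
have sub : `[a, +oo[ `<=` (`[0, +oo[ : set R).
  by move=> x; rewrite /= !in_itv /= !andbT; exact: le_trans.
have : (\int[mu]_(x in `[a, +oo[) cst eta%:E x <= \int[mu]_(x in `[a, +oo[) (K%:E * (e x)%:E))%E.
  apply: ge0_le_integral => //.
  - by move=> x _; rewrite /= lee_fin ltW.
  - apply: measurable_funeM; exact: measurable_funS measurable_e.
  - by move=> x; rewrite /= in_itv /= andbT -EFinM lee_fin => /bound.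
have muA : mu `[a, +oo[ = +oo%E by rewrite lebesgue_measure_itv /= ltry.
rewrite integral_cst//= muA gt0_muley ?lte_fin//.
rewrite leye_eq => /eqP Ey.
have : (\int[mu]_(x in `[a, +oo[) (K%:E * (e x)%:E) < +oo)%E; last by rewrite Ey ltxx.
apply: (@le_lt_trans _ _ (\int[mu]_(x in `[0%R, +oo[) (K%:E * (e x)%:E))%E).
  apply: ge0_subset_integral => //.
    by apply: measurable_funeM; exact: measurable_e.
  by move=> x; rewrite /= in_itv /= andbT => x0; rewrite -EFinM lee_fin mulr_ge0 ?(ltW K0)// e_ge0.
rewrite ge0_integralZl_EFin//; last exact: ltW.
  by rewrite lte_mul_pinfty// lee_fin ltW.
by move=> x; rewrite /= in_itv /= andbT => x0; rewrite lee_fin e_ge0.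
Qed.

End converse.

Lemma airy_eigenvalueP lam : airy_eigenvalue beta b lam <-> decaying lam.
Proof.
split; last exact: decaying_airy_eigenvalue.
by move=> [f [fL fn [df fd feq]]]; exact: eigenpair_decaying fL fn fd feq.
Qed.

End eigenfunctions.

(** * Growth of Brownian increments *)

Section normal_tail.
Context {R : realType}.

Lemma expRN_le_sqr (u : R) : 0 < u -> expR (- u) <= 2 / u ^+ 2.
Proof.
move=> u0; rewrite expRN -[leRHS]invrK invf_div lef_pV2 ?posrE ?expR_gt0 ?divr_gt0 ?exprn_gt0//.
have := @expR_ge1Dxn R u 1 (ltW u0); rewrite [2`!]/=.
by move=> h; apply: (le_trans _ h); rewrite lerDr.
Qed.

Lemma measurable_tail (a : R) : measurable [set x : R | a < `|x|].
Proof.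
have -> : [set x : R | a < `|x|] = setT `&` (fun x : R => `|x|) @^-1` `]a, +oo[.
  by rewrite setTI; apply/seteqP; split => x /=; rewrite in_itv/= andbT.
have cn : continuous (fun x : R => `|x|) by move=> y; exact: norm_continuous.
exact: (continuous_measurable_fun cn measurableT).
Qed.

(** Doubling the standard deviation leaves a factor [2 exp (- 3 x^2 / (8 s^2))], small on the tail,
    so a tail bound follows from the total mass of a normal law. A fourth power is wanted:
    increments have variance [2 ^ -m], and a second power would not beat the [2 ^ m] intervals of
    level [m]. *)
Lemma normal_pdf_tail (s a x : R) : 0 < s -> 0 < a -> a < `|x| ->
  normal_pdf 0 s x <= 32 * (s / a) ^+ 4 * normal_pdf 0 (s * 2) x.
Proof.
move=> s0 a0 ax.
have s20 : 0 < s * 2 by rewrite mulr_gt0.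
rewrite !normal_pdfE ?gt_eqF//.
have -> : normal_peak (s * 2) = normal_peak s / 2.
  rewrite /normal_peak (_ : (s * 2) ^+ 2 * pi *+ 2 = s ^+ 2 * pi *+ 2 * 2 ^+ 2); last first.
    by rewrite exprMn mulrAC mulrnAl.
  rewrite sqrtrM; last by rewrite mulrn_wge0// mulr_ge0 ?sqr_ge0// pi_ge0.
  by rewrite sqrtr_sqr ger0_norm// invfM.
rewrite /normal_fun !subr0.
have x2 : 0 < x ^+ 2 by rewrite -real_normK ?num_real// exprn_gt0// (lt_trans a0).
set u := 3 / 8 * (x ^+ 2 / s ^+ 2).
have u0 : 0 < u by rewrite mulr_gt0// divr_gt0// exprn_gt0.
have -> : - x ^+ 2 / (s ^+ 2 *+ 2) = - u + - x ^+ 2 / ((s * 2) ^+ 2 *+ 2).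
  by rewrite /u; field; rewrite gt_eqF.
rewrite expRD.
set e := expR (_ / _).
have e0 : 0 < e by exact: expR_gt0.
have p0 : 0 < normal_peak s by rewrite normal_peak_gt0// gt_eqF.
(* Here [2 / u^2 = 128 / 9 * (s / x)^4], and [128 / 9 < 16]. *)
have h : expR (- u) <= 16 * (s / a) ^+ 4.
  apply: (le_trans (expRN_le_sqr u0)).
  have a4 : a ^+ 4 <= x ^+ 2 ^+ 2.
    have : a ^+ 2 <= x ^+ 2.
      by rewrite -[leRHS]real_normK ?num_real//; apply: lerXn2r; rewrite ?nnegrE// ltW.
    rewrite (_ : a ^+ 4 = a ^+ 2 ^+ 2); last by rewrite -exprM.
    by move=> h; rewrite lerXn2r ?nnegrE ?sqr_ge0.
  rewrite /u ler_pdivrMr; last by rewrite exprn_gt0.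
  have -> : 16 * (s / a) ^+ 4 * (3 / 8 * (x ^+ 2 / s ^+ 2)) ^+ 2 =
     9 / 4 * (x ^+ 2 ^+ 2 / a ^+ 4).
    by field; rewrite !gt_eqF.
  have : 1 <= x ^+ 2 ^+ 2 / a ^+ 4 by rewrite ler_pdivlMr ?mul1r// exprn_gt0.
  lra.
have -> : 32 * (s / a) ^+ 4 * (normal_peak s / 2 * e) = normal_peak s * (16 * (s / a) ^+ 4 * e).
  by field; rewrite gt_eqF.
by rewrite ler_pM2l// ler_pM2r.
Qed.

Lemma normal_prob_tail (s a : R) : 0 < s -> 0 < a ->
  (normal_prob 0 s [set x : R | (a < `|x|)%R] <= (32 * (s / a) ^+ 4)%:E)%E.
Proof.
move=> s0 a0; rewrite /normal_prob.
have mpdf D t : measurable_fun D (fun x : R => (normal_pdf 0 t x)%:E).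
  apply/measurable_EFinP; apply: (@measurable_funS _ _ _ _ setT) => //.
  exact: measurable_normal_pdf.
have k0 : 0 <= 32 * (s / a) ^+ 4.
  by rewrite mulr_ge0// exprn_ge0// divr_ge0// ltW.
have mT := measurable_tail a.
apply: (@le_trans _ _ (\int[lebesgue_measure]_(x in [set x : R | (a < `|x|)%R])
    ((32 * (s / a) ^+ 4)%:E * (normal_pdf 0 (s * 2) x)%:E))%E).
  apply: ge0_le_integral => //.
  - by move=> x _; rewrite lee_fin normal_pdf_ge0.
  - exact: mpdf.
  - by apply: measurable_funeM; exact: mpdf.
  - by move=> x ax; rewrite -EFinM lee_fin normal_pdf_tail.
rewrite ge0_integralZl//; [|exact: mpdf|by move=> x _; rewrite lee_fin normal_pdf_ge0].
rewrite -[leRHS]mule1 lee_wpmul2l ?lee_fin//.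
rewrite -[leRHS](integral_normal_pdf 0 (s * 2)).
apply: ge0_subset_integral => //; first exact: mpdf.
by move=> x _; rewrite lee_fin normal_pdf_ge0.
Qed.

End normal_tail.

Lemma nneseries_le_partial {R : realType} (u : (\bar R)^nat) (M : \bar R) :
  (forall n, (0 <= u n)%E) -> (forall N, (\sum_(0 <= n < N) u n <= M)%E) ->
  (\sum_(n <oo) u n <= M)%E.
Proof.
move=> u0 h; apply: lime_le; last by apply: nearW => N; exact: h.
by apply: is_cvg_nneseries => n _ _; exact: u0.
Qed.

Lemma nneseries_geometric_le {R : realType} (c : R) : 0 <= c ->
  (\sum_(n <oo) (c * (4 / 5) ^+ n)%:E <= (5 * c)%:E)%E.
Proof.
move=> c0; apply: nneseries_le_partial => [n|N].
  by rewrite lee_fin mulr_ge0// exprn_ge0//; lra.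
rewrite sumEFin lee_fin.
have -> : \sum_(0 <= n < N) c * (4 / 5) ^+ n = 5 * c * (1 - (4 / 5) ^+ N).
  elim: N => [|N IH]; first by rewrite big_geq// expr0 subrr mulr0.
  by rewrite big_nat_recr//= IH exprS; field.
by rewrite ler_piMr ?mulr_ge0// gerBl exprn_ge0//; lra.
Qed.

Lemma nneseries_inv_sqr_le {R : realType} (c : R) : 0 <= c ->
  (\sum_(n <oo) (c / n.+1%:R ^+ 2)%:E <= (2 * c)%:E)%E.
Proof.
move=> c0; apply: nneseries_le_partial => [n|N].
  by rewrite lee_fin divr_ge0.
rewrite sumEFin lee_fin.
apply: (@le_trans _ _ (2 * c * (1 - N.+1%:R^-1))); last first.
  by rewrite ler_piMr ?mulr_ge0// gerBl.
elim: N => [|N IH]; first by rewrite big_geq// invr1 subrr mulr0.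
rewrite big_nat_recr//=; apply: (le_trans (lerD IH (lexx _))).
rewrite -subr_ge0.
have -> : 2 * c * (1 - N.+2%:R^-1) - (2 * c * (1 - N.+1%:R^-1) + c / N.+1%:R ^+ 2) =
  c * N%:R / (N.+1%:R ^+ 2 * N.+2%:R).
  by rewrite -[N.+2%:R]natr1 -[N.+1%:R]natr1; field; rewrite !natr1 !pnatr_eq0.
by rewrite divr_ge0 ?mulr_ge0.
Qed.

(** * Union bound over dyadic intervals *)

Section dyadic_increments.
Context {R : realType} {d : measure_display} {T : measurableType d}.
Variables (P : probability T R) (b : R -> T -> R) (eps : R).
Hypothesis brownian_b : standard_brownian_motion P b.
Hypothesis eps0 : 0 < eps.

Let dyadic (n m k : nat) : R := n%:R + k%:R / 2 ^+ m.

(* [2 * (9 / 10) ^ 4 > 5 / 4] makes the union bound over the [2 ^ m] intervals of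
   level [m] geometric in [m]. *)
Let thr (n m : nat) : R := eps * Num.sqrt n.+1%:R * (9 / 10) ^+ m.

Let large_increment n m k :=
  [set w | thr n m < `|b (dyadic n m k.+1) w - b (dyadic n m k) w|].

Let thr_gt0 n m : 0 < thr n m.
Proof. by rewrite /thr !mulr_gt0 ?sqrtr_gt0 ?exprn_gt0//; lra. Qed.

Let dyadic_ge0 n m k : 0 <= dyadic n m k.
Proof. by rewrite addr_ge0// divr_ge0// exprn_ge0. Qed.

Let dyadicS n m k : dyadic n m k.+1 - dyadic n m k = (2 ^+ m)^-1.
Proof. by rewrite /dyadic -natr1; ring. Qed.

Let measurable_large_increment n m k : measurable (large_increment n m k).
Proof.
have [mb _ _ _ _] := brownian_b.
have mf : measurable_fun setT (fun w => b (dyadic n m k.+1) w - b (dyadic n m k) w).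
  by apply: measurable_funB; apply: mb; exact: dyadic_ge0.
have := mf measurableT _ (measurable_tail (thr n m)).
by rewrite setTI.
Qed.

Let large_increment_le n m k : (P (large_increment n m k) <=
  (32 / (eps ^+ 4 * n.+1%:R ^+ 2) * (2 / 5) ^+ m)%:E)%E.
Proof.
have [_ _ _ _ gb] := brownian_b.
have lt_dyadic : dyadic n m k < dyadic n m k.+1.
  by rewrite -subr_gt0 dyadicS invr_gt0 exprn_gt0.
have -> : P (large_increment n m k) =
    normal_prob 0 (Num.sqrt (dyadic n m k.+1 - dyadic n m k)) [set x : R | (thr n m < `|x|)%R].
  by rewrite -gb//; exact: measurable_tail.
rewrite dyadicS.
have i0 : 0 < (2 ^+ m)^-1 :> R by rewrite invr_gt0 exprn_gt0.
have si0 : 0 < Num.sqrt (2 ^+ m)^-1 :> R by rewrite sqrtr_gt0.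
apply: (le_trans (normal_prob_tail si0 (thr_gt0 n m))).
rewrite lee_fin expr_div_n.
rewrite (_ : Num.sqrt _ ^+ 4 = (4 ^+ m)^-1); last first.
  rewrite (exprM _ 2 2) sqr_sqrtr ?ltW// exprVn -exprM mulnC exprM.
  by congr ((_ ^+ _)^-1); ring.
have -> : thr n m ^+ 4 = eps ^+ 4 * n.+1%:R ^+ 2 * ((9 / 10) ^+ 4) ^+ m.
  rewrite /thr; move: (9 / 10 : R) => q; rewrite [in RHS]exprAC !exprMn.
  by rewrite (exprM (Num.sqrt _) 2 2) sqr_sqrtr.
set c := eps ^+ 4 * _.
have c0 : 0 < c by rewrite mulr_gt0 ?exprn_gt0.
rewrite -invfM mulrCA -exprMn invfM mulrCA mulrA [32 / _]mulrC -[leLHS]mulrA -[leRHS]mulrA.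
rewrite ler_pM2l ?invr_gt0// ler_pM2l// -exprVn.
(* What remains is [4^-1 / (9 / 10)^4 <= 2 / 5]. *)
by apply: lerXn2r; rewrite ?nnegrE; lra.
Qed.

Let large_level n m := \big[setU/set0]_(k < 2 ^ m) large_increment n m k.

Let measurable_large_level n m : measurable (large_level n m).
Proof. by apply: bigsetU_measurable => k _; exact: measurable_large_increment. Qed.

Let large_level_le n m : (P (large_level n m) <=
  (32 / (eps ^+ 4 * n.+1%:R ^+ 2) * (4 / 5) ^+ m)%:E)%E.
Proof.
apply: (le_trans (Boole_inequality P (A := large_increment n m) (n := 2 ^ m)
  (fun k _ => measurable_large_increment n m k))).
apply: (@le_trans _ _ (\sum_(k < 2 ^ m) (32 / (eps ^+ 4 * n.+1%:R ^+ 2) * (2 / 5) ^+ m)%:E)%E).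
  by apply: lee_sum => k _; exact: large_increment_le.
rewrite sumEFin lee_fin sumr_const card_ord -[_ *+ (2 ^ m)%N]mulr_natr natrX -[leLHS]mulrA -exprMn.
by rewrite (_ : 2 / 5 * 2%:R = 4 / 5 :> R)//; lra.
Qed.

Let large_block n := \bigcup_m large_level n m.

Let measurable_large_block n : measurable (large_block n).
Proof. by apply: bigcupT_measurable => m; exact: measurable_large_level. Qed.

Let large_block_le n : (P (large_block n) <= (160 / eps ^+ 4 / n.+1%:R ^+ 2)%:E)%E.
Proof.
apply: (@le_trans _ _ (\sum_(m <oo) P (large_level n m))%E).
  by apply: measure_sigma_subadditive => // m; exact: measurable_large_level.
have e4 : 0 < eps ^+ 4 by rewrite exprn_gt0.
have -> : 160 / eps ^+ 4 / n.+1%:R ^+ 2 = 5 * (32 / (eps ^+ 4 * n.+1%:R ^+ 2)).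
  by move: (eps ^+ 4) (n.+1%:R ^+ 2) => x y; rewrite invfM; ring.
apply: le_trans (nneseries_geometric_le _); last first.
  by rewrite divr_ge0// mulr_ge0// ltW.
by apply: lee_nneseries => [m _|m _]//; exact: large_level_le.
Qed.

(** The factor [sqrt n.+1] in the threshold makes the block probabilities of order [1 / n.+1 ^ 2],
    which is summable however small [eps] is. *)
Lemma brownian_dyadic_increments : {ae P, forall w, exists n0 : nat,
  forall n, (n0 <= n)%N -> forall m k, (k < 2 ^ m)%N ->
    `|b (n%:R + k.+1%:R / 2 ^+ m) w - b (n%:R + k%:R / 2 ^+ m) w| <=
    eps * Num.sqrt n.+1%:R * (9 / 10) ^+ m}.
Proof.
have : P (lim_sup_set large_block) = 0%E.
  apply: lim_sup_set_cvg0 => //.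
  apply: (@le_lt_trans _ _ (2 * (160 / eps ^+ 4))%:E); last exact: ltry.
  apply: le_trans (nneseries_inv_sqr_le _); last by rewrite divr_ge0// exprn_ge0// ltW.
  by apply: lee_nneseries => [n _|n _]//; exact: large_block_le.
move=> P0; exists (lim_sup_set large_block); split => //.
  apply: bigcapT_measurable => n; apply: bigcup_measurable => k _.
  exact: measurable_large_block.
move=> w /= h n0 _; apply: contrapT => nb; apply: h; exists n0 => n n0n m k km.
rewrite leNgt; apply/negP => lt; apply: nb; exists n => //; exists m => //.
rewrite /large_level -bigcup_mkord; exists k => //.
Qed.

End dyadic_increments.

(** * From dyadic increments to arbitrary ones *)

Section chaining.
Context {R : realType}.
Implicit Types (f B : R -> R) (a x s : R).

(** An odd [k] moves to its even neighbour at a cost [a (9/10)^m] at level [m], and an even one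
    already belongs to the previous level; the bound is the partial sum of this geometric series. *)
Lemma chaining_dyadic f a : (forall m k, (k < 2 ^ m)%N ->
    `|f (k.+1%:R / 2 ^+ m) - f (k%:R / 2 ^+ m)| <= a * (9 / 10) ^+ m) ->
  forall m k, (k <= 2 ^ m)%N ->
    `|f (k%:R / 2 ^+ m) - f 0| <= 10 * a * (1 - (9 / 10) ^+ m.+1).
Proof.
move=> h.
have a0 : 0 <= a by have := h 0 0 isT; rewrite expr0 mulr1; exact: le_trans.
elim=> [|m IH] k.
  rewrite expn0 expr1 => k1; case: k k1 => [|[|k]]// _.
    by rewrite mul0r subrr normr0 mulr_ge0 ?mulr_ge0//; lra.
  by have := h 0 0 isT; rewrite mul0r; lra.
have half j : j.*2%:R / 2 ^+ m.+1 = j%:R / 2 ^+ m :> R.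
  rewrite -muln2 natrM exprS invfM mulrA mulfK//.
move=> km.
have dE : 10 * a * (1 - (9 / 10) ^+ m.+2) =
    10 * a * (1 - (9 / 10) ^+ m.+1) + a * (9 / 10) ^+ m.+1.
  by rewrite [_ ^+ m.+2]exprS; field.
have kE := odd_double_half k.
have [od|ev] := boolP (odd k).
  have kS : k = k./2.*2.+1 by rewrite -{1}kE od.
  have k2m : (k./2.*2 < 2 ^ m.+1)%N by rewrite -kS.
  have k2 : (k./2 <= 2 ^ m)%N by rewrite -leq_double -[leqRHS]mul2n -expnS ltnW.
  rewrite dE [leRHS]addrC.
  apply: le_trans (lerD (h _ _ k2m) (IH _ k2)).
  rewrite -kS half; move: (f _) (f (_ / 2 ^+ m)) (f 0) => u v z.
  by rewrite (_ : u - z = (u - v) + (v - z)) ?ler_normD//; ring.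
have kS : k = k./2.*2 by rewrite -{1}kE (negbTE ev).
have k2 : (k./2 <= 2 ^ m)%N by rewrite -leq_double -[leqRHS]mul2n -expnS -kS.
rewrite kS half dE; apply: (le_trans (IH _ k2)).
by rewrite lerDl mulr_ge0// exprn_ge0//; lra.
Qed.

Lemma chaining f a s : continuous f -> (forall m k, (k < 2 ^ m)%N ->
    `|f (k.+1%:R / 2 ^+ m) - f (k%:R / 2 ^+ m)| <= a * (9 / 10) ^+ m) ->
  0 <= s <= 1 -> `|f s - f 0| <= 10 * a.
Proof.
move=> cf h /andP[s0 s1].
have a0 : 0 <= a by have := h 0 0 isT; rewrite expr0 mulr1; exact: le_trans.
rewrite leNgt; apply/negP => lt.
have cn : {for s, continuous (fun x : R => `|f x - f 0|)}.
  by apply: cvg_norm; apply: cvgB; [exact: cf|exact: cvg_cst].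
have [e e0 he] := continuous_gt cn lt.
have [m me] : exists m : nat, (2 ^+ m)^-1 < e.
  exists (Num.truncn e^-1); rewrite -ltf_pV2 ?posrE ?invr_gt0 ?exprn_gt0// invrK.
  have ei0 : 0 <= e^-1 by rewrite invr_ge0 ltW.
  have /andP[_ h1] := truncn_itv ei0.
  apply: (lt_le_trans h1); rewrite -natrX ler_nat.
  exact: ltn_expl.
have p0 : 0 < 2 ^+ m :> R by rewrite exprn_gt0.
have /andP[k1 k2] := truncn_itv (mulr_ge0 s0 (ltW p0)).
set k := Num.truncn _ in k1 k2.
have k2m : (k <= 2 ^ m)%N.
  by rewrite -(ler_nat R) natrX; apply: (le_trans k1); rewrite ler_piMl// ltW.
have d : `|k%:R / 2 ^+ m - s| < e.
  apply: le_lt_trans me; rewrite distrC ger0_norm; last first.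
    by rewrite subr_ge0 ler_pdivrMr.
  rewrite lerBlDl -[X in _ + X]mul1r -mulrDl ler_pdivlMr// natr1; exact: ltW.
have := lt_le_trans (he _ d) (chaining_dyadic h k2m).
apply/negP; rewrite -leNgt ler_piMr ?mulr_ge0// gerBl exprn_ge0//; lra.
Qed.

Lemma increments_growth B n0 : continuous B ->
  (forall n, (n0 <= n)%N -> forall m k, (k < 2 ^ m)%N ->
    `|B (n%:R + k.+1%:R / 2 ^+ m) - B (n%:R + k%:R / 2 ^+ m)| <=
    1 / 100 * Num.sqrt n.+1%:R * (9 / 10) ^+ m) ->
  exists2 C, 0 <= C & forall x s, 0 <= x -> 0 <= s <= 1 ->
    (B (x + s) - B x) ^+ 2 <= x / 8 + C.
Proof.
move=> cB h.
have block n s : (n0 <= n)%N -> 0 <= s <= 1 ->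
    `|B (n%:R + s) - B n%:R| <= 1 / 10 * Num.sqrt n.+1%:R.
  move=> n0n s01.
  have cBn : continuous (fun t : R => B (n%:R + t)).
    move=> t; apply: (@continuous_comp _ _ _ (fun t : R => n%:R + t)); last exact: cB.
    by apply: cvgD; [exact: cvg_cst|exact: cvg_id].
  have := chaining cBn (h n n0n) s01; rewrite addr0 => /le_trans; apply.
  by rewrite mulrA ler_wpM2r ?sqrtr_ge0//; lra.
have [M M0 hM] := continuous_bounded_segment (n0%:R + 2) cB.
(* [4 * M ^+ 2] covers [x <= n0], where both values are at most [M]; the 1 absorbs the difference
   between [n + 2] and [x]. *)
exists (4 * M ^+ 2 + 1); first by rewrite addr_ge0// mulr_ge0// exprn_ge0.
move=> x s x0 /andP[s0 s1].
have M2 : 0 <= M ^+ 2 by rewrite exprn_ge0.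
have [xn|nx] := leP x n0%:R.
  have /ler_normlP[a1 a2] : `|B (x + s)| <= M by apply: hM; apply/andP; split; lra.
  have /ler_normlP[a3 a4] : `|B x| <= M by apply: hM; apply/andP; split; lra.
  by nra.
have /andP[n1 n2] := truncn_itv x0; set n := Num.truncn x in n1 n2.
have n0n : (n0 <= n)%N.
  by rewrite -ltnS -(ltr_nat R); exact: lt_trans nx n2.
pose u : R := Num.sqrt n.+2%:R.
have u0 : 0 <= u by exact: sqrtr_ge0.
have u2 : u ^+ 2 = n%:R + 2 by rewrite sqr_sqrtr// -addn2 natrD.
have uu : Num.sqrt n.+1%:R <= u by rewrite ler_wsqrtr// ler_nat.
have n1E : n.+1%:R = n%:R + 1 :> R by rewrite natr1.
rewrite n1E in n2.
have /ler_normlP[x1 x2] : `|B x - B n%:R| <= 1 / 10 * u.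
  have -> : x = n%:R + (x - n%:R) by ring.
  apply: (le_trans (block n _ n0n _)); first by apply/andP; split; lra.
  by rewrite ler_pM2l//; lra.
have /ler_normlP[y1 y2] : `|B (x + s) - B n%:R| <= 2 / 10 * u.
  have [yn|yn] := leP (x + s) (n%:R + 1).
    have -> : x + s = n%:R + (x + s - n%:R) by ring.
    apply: (le_trans (block n _ n0n _)); first by apply/andP; split; lra.
    by move: uu u0; lra.
  have -> : x + s = n.+1%:R + (x + s - n.+1%:R) by ring.
  have b1 : `|B (n.+1%:R + (x + s - n.+1%:R)) - B n.+1%:R| <= 1 / 10 * u.
    by apply: (block n.+1); [exact: leqW|rewrite n1E; apply/andP; split; lra].
  have b2 : `|B (n%:R + 1) - B n%:R| <= 1 / 10 * u.
    apply: (le_trans (block n _ n0n _)); first by rewrite ler01 lexx.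
    by rewrite ler_pM2l//; lra.
  rewrite -n1E in b2.
  move: b1 b2; move: (B _) (B _) (B _) => b1 b2 b3 h1 h2.
  by rewrite (_ : b3 - b1 = (b3 - b2) + (b2 - b1)); [apply: (le_trans (ler_normD _ _)); lra|ring].
(* From [x] to [x + s] at most one integer is crossed: at most three block estimates of [u / 10]
   each, and [(3 / 10)^2 < 1 / 8]. *)
have : (B (x + s) - B x) ^+ 2 <= (3 / 10 * u) ^+ 2.
  rewrite -real_normK ?num_real//; apply: lerXn2r; rewrite ?nnegrE//.
    by rewrite mulr_ge0.
  by apply/ler_normlP; split; lra.
by rewrite exprMn u2 => /le_trans; apply; lra.
Qed.

End chaining.

Lemma continuous_comp_max0 {R : realType} (f : R -> R) :
  {within `[0, +oo[, continuous f} -> continuous (fun x : R => f (Num.max x 0)).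
Proof.
move=> /subspace_continuousP cf x.
have mx (y : R) : `[0, +oo[%classic (Num.max y 0).
  by rewrite /= in_itv/= andbT le_max lexx orbT.
have cm : {for x, continuous (fun y : R => Num.max y 0)}.
  by apply: continuous_max; [exact: cvg_id|exact: cvg_cst].
apply: (@cvg_comp _ _ _ (fun y : R => Num.max y 0) f _ (within `[0, +oo[ (nbhs (Num.max x 0)))); last exact: cf.
move=> U UV; apply: (@filterS _ (nbhs x) _
  (fun y : R => `[0, +oo[%classic (Num.max y 0) -> U (Num.max y 0))).
  by move=> y /(_ (mx y)).
exact: (cm _ UV).
Qed.

Lemma brownian_path_growth {R : realType} (d : measure_display) (T : measurableType d)
    (P : probability T R) (b : R -> T -> R) (c : R) :
  0 < c -> standard_brownian_motion P b ->
  {ae P, forall w, continuous (fun x : R => c * b (Num.max x 0) w) /\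
    exists2 C, 0 <= C & forall x s : R, 0 <= x -> 0 <= s <= 1 ->
      (c * b (Num.max (x + s) 0) w - c * b (Num.max x 0) w) ^+ 2 <= x / 8 + C}.
Proof.
move=> c0 bb.
(* After multiplication by [c] the increments meet the constant [1 / 100] of [increments_growth]. *)
have e0 : 0 < (100 * c)^-1 by rewrite invr_gt0 mulr_gt0.
have dy := brownian_dyadic_increments bb e0.
have [_ _ cb _ _] := bb.
near=> w.
have cw : {within `[0, +oo[, continuous (b ^~ w)} by near: w.
have [n0 h] : exists n0 : nat, forall n, (n0 <= n)%N -> forall m k, (k < 2 ^ m)%N ->
    `|b (n%:R + k.+1%:R / 2 ^+ m) w - b (n%:R + k%:R / 2 ^+ m) w| <=
    (100 * c)^-1 * Num.sqrt n.+1%:R * (9 / 10) ^+ m by near: w.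
have cB : continuous (fun x : R => c * b (Num.max x 0) w).
  move=> x; apply: cvgM; first exact: cvg_cst.
  exact: (continuous_comp_max0 cw).
split => //.
apply: (increments_growth (n0 := n0) cB) => n n0n m k km.
have max0 (j : nat) : Num.max (n%:R + j%:R / 2 ^+ m) 0 = n%:R + j%:R / 2 ^+ m :> R.
  by apply: max_l; rewrite addr_ge0// divr_ge0// exprn_ge0.
rewrite !max0 -mulrBr normrM (gtr0_norm c0).
have := h n n0n m k km; move: (`|_|) => y hy.
apply: (le_trans (ler_wpM2l (ltW c0) hy)).
by rewrite !mulrA (_ : c / (100 * c) = 1 / 100)//; field; rewrite gt_eqF.
Unshelve. all: by end_near. Qed.

(** * Counting blowups and eigenvalues *)

Lemma white_noise_primitive {R : realType} (B : R -> R) (C0 : R) : continuous B -> 0 <= C0 ->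
  (forall x s : R, 0 <= x -> 0 <= s <= 1 -> (B (x + s) - B x) ^+ 2 <= x / 8 + C0) ->
  exists W Q S : R -> R, exists C : R, [/\ continuous W /\ continuous Q,
    forall x : R, 0 <= x -> B x = W x + S x,
    forall x : R, 0 <= x -> is_derive x 1 S (Q x - x + W x ^+ 2),
    forall x : R, 0 <= x -> x / 2 - C <= Q x
  & forall x : R, 0 <= x -> W x ^+ 2 <= x + C].
Proof.
move=> cB C00 growth.
pose S (x : R) := primitive B (x + 1) - primitive B x.
pose W (x : R) := B x - S (Num.max x 0).
pose Q (x : R) := x + (B (x + 1) - B x) - W x ^+ 2.
have dshift (a x : R) : 0 <= a -> 0 <= x ->
    is_derive x 1 (fun y => primitive B (a + y)) (B (a + x)).
  move=> a0 x0; have ax : 0 <= a + x by rewrite addr_ge0.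
  have := isder_comp (f := fun y => a + y) (g := primitive B)
    (isder_primitive cB ax) (isder_add (isder_cst x a) (isder_id x)).
  by rewrite add0r mulr1.
have dS (x : R) : 0 <= x -> is_derive x 1 S (B (x + 1) - B x).
  move=> x0; have h := dshift 1 x ler01 x0; rewrite addrC in h.
  have -> : S = (fun y => primitive B (1 + y) - primitive B y).
    by apply/funext => y; rewrite /S [y + 1]addrC.
  exact: isder_add h (isder_opp (isder_primitive cB x0)).
have cS : continuous (fun x : R => S (Num.max x 0)).
  by apply: continuous_clamp => x x0; exact: isder_continuous (dS x x0).
have cW : continuous W by move=> x; apply: cvgB; [exact: cB|exact: cS].
have cB1 : continuous (fun x : R => B (x + 1)).
  move=> x; apply: (@continuous_comp _ _ _ (fun x : R => x + 1) B); last exact: cB.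
  by apply: cvgD; [exact: cvg_id|exact: cvg_cst].
have cQ : continuous Q.
  move=> x; apply: cvgB; last exact: (continuous_sqr (cW x)).
  by apply: cvgD; [exact: cvg_id|apply: cvgB; [exact: cB1|exact: cB]].
have W2 (x : R) : 0 <= x -> W x ^+ 2 <= x / 8 + C0.
  move=> x0.
  have k0 : 0 <= x / 8 + C0 by rewrite addr_ge0// divr_ge0.
  pose K := Num.sqrt (x / 8 + C0).
  have K0 : 0 <= K by exact: sqrtr_ge0.
  (* [- W x] is the mean of [B (x + s) - B x] over [s] in [[0, 1]], that is [g 1 - g 0], so it
     inherits the bound on these increments. *)
  pose g (s : R) := primitive B (x + s) - s * B x.
  have dg (s : R) : 0 <= s <= 1 -> is_derive s 1 g (B (x + s) - B x).
    move=> /andP[s0 _]; have := isder_add (dshift x s x0 s0)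
      (isder_opp (isder_mul (isder_id s) (isder_cst s (B x)))).
    by move=> h; apply: (isder_eq h); ring.
  have dK (s : R) : 0 <= s <= 1 -> is_derive s 1 (fun t => K * t) K.
    by move=> _; apply: (isder_eq (isder_mul (isder_cst s K) (isder_id s))); ring.
  have gK (s : R) : 0 <= s <= 1 -> `|B (x + s) - B x| <= K.
    by move=> s01; rewrite -sqrtr_sqr; apply: ler_wsqrtr; exact: growth.
  have := isder_bound ler01 dg dK gK; rewrite /g.
  rewrite mul1r mul0r mulr1 mulr0 !subr0 addr0 => h.
  rewrite -[leRHS](sqr_sqrtr k0) -/K -real_normK ?num_real//.
  apply: lerXn2r; rewrite ?nnegrE//.
  apply: le_trans h; rewrite /W max_l// -normrN /S.
  by rewrite le_eqVlt; apply/orP; left; apply/eqP; congr `|_|; ring.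
(* With [v] the unit increment, [v >= - (1 + v^2)]; both [v^2] and [W^2] are at most [x / 8 + C0],
   so [Q >= x - x / 4 - 2 C0 - 1]. *)
exists W, Q, S, (2 * C0 + 1); split.
- by split.
- by move=> x x0; rewrite /W max_l//; ring.
- by move=> x x0; apply: (isder_eq (dS x x0)); rewrite /Q; ring.
- move=> x x0; have := W2 x x0; have := growth x 1 x0; rewrite ler01 lexx => /(_ isT).
  by rewrite /Q; move: (B (x + 1) - B x) (W x ^+ 2) => v w; nra.
- by move=> x x0; have := W2 x x0; lra.
Qed.

Section eigenvalue_count.
Context {R : realType}.
Variables W Q S b : R -> R.
Hypothesis cW : continuous W.
Hypothesis cQ : continuous Q.
Variable beta : R.
Hypothesis bWS : forall x : R, 0 <= x -> 2 / Num.sqrt beta * b x = W x + S x.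
Hypothesis dS : forall x : R, 0 <= x -> is_derive x 1 S (Q x - x + W x ^+ 2).
Variable C : R.
Hypothesis Q_growth : forall x : R, 0 <= x -> x / 2 - C <= Q x.
Hypothesis W_growth : forall x : R, 0 <= x -> W x ^+ 2 <= x + C.

Local Notation zero_count := (zero_count cW cQ Q_growth).
Local Notation decaying := (decaying cW cQ).

Let zero_count_inj (A : set R) : A `<=` decaying -> {in A &, injective zero_count}.
Proof.
move=> AD x y; rewrite !inE => /AD Dx /AD Dy xy.
have [lt|lt|] := ltgtP x y.
- by have := zero_count_decaying Q_growth Dx lt; rewrite xy ltnn.
- by have := zero_count_decaying Q_growth Dy lt; rewrite xy ltnn.
- by [].
Qed.

Lemma card_decaying_lt lam : ([set mu | decaying mu /\ mu < lam] #= `I_(zero_count lam))%card.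
Proof.
have <- : zero_count @` [set mu | decaying mu /\ mu < lam] = `I_(zero_count lam).
  apply/seteqP; split => [_ [mu [Dmu lt] <-]|k /= kl].
    exact: (zero_count_decaying Q_growth Dmu lt).
  by have [mu [lt Dmu E]] := decaying_of_lt_zero_count kl; exists mu.
rewrite card_eq_sym; apply: inj_card_eq.
by apply: zero_count_inj => mu [].
Qed.

Let eigenvalue_countE lam :
  eigenvalue_count beta b lam = counting [set mu | decaying mu /\ mu <= lam].
Proof.
rewrite /eigenvalue_count; congr counting; apply/seteqP; split => mu [] h lt; split => //.
- exact/(airy_eigenvalueP cW cQ bWS dS Q_growth W_growth).
- exact/(airy_eigenvalueP cW cQ bWS dS Q_growth W_growth).
Qed.

Let finite_decaying_le lam : finite_set [set mu | decaying mu /\ mu <= lam].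
Proof.
have /finite_setP : exists n, ([set mu | decaying mu /\ mu < lam + 1] #= `I_n)%card.
  by eexists; exact: card_decaying_lt.
by apply: sub_finite_set => mu [Dmu lt]; split => //; rewrite (le_lt_trans lt)// ltrDl.
Qed.

(** Identifies the left limit of the counting function at [lam] as the number of zeros, also when
    [lam] is itself an eigenvalue. *)
Lemma eigenvalue_count_left lam y : y < lam ->
  (forall mu, decaying mu -> mu < lam -> mu <= y) ->
  eigenvalue_count beta b y = (zero_count lam)%:R%:E.
Proof.
move=> yl h; rewrite eigenvalue_countE -(counting_card (card_decaying_lt lam)).
congr counting; apply/seteqP; split => mu [Dmu lt]; split => //.
- exact: le_lt_trans lt yl.
- exact: h.
Qed.

Lemma eigenvalue_count_not_decaying lam : ~ decaying lam ->
  eigenvalue_count beta b lam = (zero_count lam)%:R%:E.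
Proof.
move=> nD; rewrite eigenvalue_countE -(counting_card (card_decaying_lt lam)).
congr counting; apply/seteqP; split => mu [Dmu lt]; split => //; last exact: ltW.
by rewrite lt_neqAle lt andbT; apply/eqP => E; apply: nD; rewrite -E.
Qed.

(** Eigenvalues are isolated, so the count is constant on a small interval on either side of [x]. *)
Lemma cadlag_eigenvalue_count : cadlag (eigenvalue_count beta b).
Proof.
move=> x.
have [e e0 he] := finite_set_isolated x (finite_decaying_le (x + 1)).
pose r := Num.min e 1.
have r0 : 0 < r by rewrite lt_min e0 ltr01.
have gap mu : decaying mu -> mu != x -> `|mu - x| < r -> False.
  move=> Dmu mux; rewrite lt_min => /andP[m1 m2].
  have mu1 : mu <= x + 1 by have := ler_norm (mu - x); lra.
  by have := he mu (conj Dmu mu1) mux; rewrite leNgt m1.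
split.
- rewrite eigenvalue_countE; have /finite_setP[n An] := finite_decaying_le x.
  by rewrite (counting_card An).
- apply: cvg_near_cst; apply/near_rightP; exists r => // y xy yr.
  rewrite !eigenvalue_countE; congr counting; apply/seteqP; split => mu [Dmu lt]; split => //.
    rewrite leNgt; apply/negP => xmu; apply: (gap mu Dmu); first by rewrite gt_eqF.
    by rewrite gtr0_norm ?subr_gt0//; lra.
  by lra.
- exists (zero_count x)%:R; apply: cvg_near_cst; apply/near_leftP; exists r => // y yx yr.
  apply: eigenvalue_count_left => // mu Dmu mx.
  rewrite leNgt; apply/negP => ymu; apply: (gap mu Dmu); first by rewrite lt_eqF.
  by rewrite ltr0_norm ?subr_lt0//; lra.
Qed.

Lemma negligible_decaying : (@lebesgue_measure R).-negligible decaying.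
Proof.
have cD : countable decaying.
  by apply/countable_injP; exists zero_count; exact: zero_count_inj.
apply/negligibleP; first by apply: countable_measurable.
exact: countable_lebesgue_measure0.
Qed.

Lemma blowups_count_eigenvalues : exists N : R -> \bar R,
  [/\ forall lambda, number_of_blowups beta b lambda (N lambda),
      {ae (@lebesgue_measure R), forall lambda, N lambda = eigenvalue_count beta b lambda}
    & cadlag (eigenvalue_count beta b)].
Proof.
exists (fun lam => (zero_count lam)%:R%:E); split.
- move=> lam; apply: (number_of_blowups_zeros (cW := cW) (cQ := cQ) bWS dS); apply: card_zeros => k.
  exact: reachesP.
- apply: negligibleS negligible_decaying => lam /=; apply: contra_notP => nD.
  by rewrite eigenvalue_count_not_decaying.
- exact: cadlag_eigenvalue_count.
Qed.

End eigenvalue_count.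

Unset Implicit Arguments.

Theorem proposition3p4 (R : realType) (d : measure_display)
  (T : measurableType d) (P : probability T R) (beta : R) (b : R -> T -> R) :
  0 < beta ->
  standard_brownian_motion P b ->
  {ae P, forall w, exists N : R -> \bar R,
    [/\ forall lambda, number_of_blowups beta (b ^~ w) lambda (N lambda),
        {ae (@lebesgue_measure R), forall lambda,
          N lambda = eigenvalue_count beta (b ^~ w) lambda}
      & cadlag (eigenvalue_count beta (b ^~ w))]}.
Proof.
move=> beta0 bb.
have c0 : 0 < 2 / Num.sqrt beta by rewrite divr_gt0 ?sqrtr_gt0.
have := brownian_path_growth c0 bb; apply: filterS => w [cB [C0 C00 growth]].
have [W [Q [S [C [[cW cQ] BWS dS Qg Wg]]]]] := white_noise_primitive cB C00 growth.
apply: (blowups_count_eigenvalues (b := b ^~ w) cW cQ _ dS Qg Wg) => x x0.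
by rewrite -BWS// max_l.
Qed.
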